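(* Let $n\ge0$ and let $\vec\varphi=(\varphi_0,\dots,\varphi_n)$ and $\vec\phi=(\phi_0,\dots,\phi_n)$ be in $L^2(\mathbb R,\mathbb H^{n+1})$. Then $$\langle\mathbb V_{\vec\psi}\vec\phi,\mathbb V_{\vec\psi}\vec\varphi\rangle_{L^2(\mathbb R^2,\mathbb H)}=2\,\langle\vec\phi,\vec\varphi\rangle_{L^2(\mathbb R,\mathbb H^{n+1})}.$$
   Context: $\mathbb H$ is the skew field of quaternions; fix an imaginary unit $I\in\mathbb H$, $I^2=-1$. $\langle f,g\rangle_{L^2(X,\mathbb H)}=\int_X\overline g\,f$ for $X=\mathbb R,\mathbb R^2$, and $\langle\vec f,\vec g\rangle_{L^2(\mathbb R,\mathbb H^{n+1})}=\sum_{j=0}^n\langle f_j,g_j\rangle_{L^2(\mathbb R,\mathbb H)}$. $\vec\psi=(\psi_0,\dots,\psi_n)$ where $\psi_j=h_j/\|h_j\|_{L^2(\mathbb R)}$ with $h_j(t)=(-1)^je^{\pi t^2}\frac{d^j}{dt^j}e^{-2\pi t^2}$ (normalized weighted Hermite functions). The quaternionic Segal–Bargmann transform is $\mathcal B\varphi(q)=2^{3/4}\int_{\mathbb R}e^{-\pi(q^2+t^2)+2\pi\sqrt2\,qt}\varphi(t)\,dt$ (slice regular in $q\in\mathbb H$); the slice derivative is $\partial_sf(x+Jy)=\frac12(\partial_x-J\partial_y)f(x+Jy)$ for $J^2=-1$. The true quaternionic polyanalytic Bargmann transform is $B^{j+1}\varphi(q)=(-1)^j\sqrt{\frac{1}{(2\pi)^jj!}}\sum_{k=0}^j\binom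 jk(-2\pi\bar q)^k\partial_s^{j-k}\mathcal B\varphi(q)$, and the full-polyanalytic one is $\mathfrak B\vec\varphi=\sum_{j=0}^nB^{j+1}\varphi_j$. With $q=x+I\omega$, the full-poly QSTFT is the $\mathbb H$-valued function $\mathbb V_{\vec\psi}\vec\varphi(x,\omega)=e^{-I\pi x\omega}\mathfrak B(\vec\varphi)\left(\frac{\bar q}{\sqrt2}\right)e^{-\frac{|q|^2\pi}{2}}$, $(x,\omega)\in\mathbb R^2$. *)

(* Defs.v *)
From HB Require Import structures.
From mathcomp Require Import all_boot all_order all_algebra.
From mathcomp Require Import ring.
From mathcomp Require Import all_classical all_reals all_analysis.
Set Implicit Arguments.
Unset Strict Implicit.
Unset Printing Implicit Defensive.
Import Order.TTheory GRing.Theory Num.Theory.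
Import numFieldNormedType.Exports.
Local Open Scope classical_set_scope.
Local Open Scope ring_scope.

(* [Quat a b c d] is a + b i + c j + d k, with i^2 = j^2 = k^2 = ijk = -1. *)
Record quat (R : Type) : Type := Quat { qre : R; qi : R; qj : R; qk : R }.

Section QuatAlgebra.
Variable R : realType.
Local Notation H := (quat R).

Lemma quat_ext (p q : H) :
  qre p = qre q -> qi p = qi q -> qj p = qj q -> qk p = qk q -> p = q.
Proof. by case: p => a b c d; case: q => a' b' c' d' /= -> -> -> ->. Qed.

Definition quat_pack (q : H) : R * R * R * R := (qre q, qi q, qj q, qk q).
Definition quat_unpack (t : R * R * R * R) : H :=
  let: (a, b, c, d) := t in Quat a b c d.
Lemma quat_packK : cancel quat_pack quat_unpack. Proof. by case. Qed.
HB.instance Definition _ := Choice.copy H (can_type quat_packK).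

Definition quat_zero : H := Quat 0 0 0 0.
Definition quat_opp (q : H) : H := Quat (- qre q) (- qi q) (- qj q) (- qk q).
Definition quat_add (p q : H) : H :=
  Quat (qre p + qre q) (qi p + qi q) (qj p + qj q) (qk p + qk q).

Fact quat_addA : associative quat_add.
Proof. by move=> p q r; apply: quat_ext => /=; ring. Qed.
Fact quat_addC : commutative quat_add.
Proof. by move=> p q; apply: quat_ext => /=; ring. Qed.
Fact quat_add0 : left_id quat_zero quat_add.
Proof. by move=> p; apply: quat_ext => /=; ring. Qed.
Fact quat_addN : left_inverse quat_zero quat_opp quat_add.
Proof. by move=> p; apply: quat_ext => /=; ring. Qed.
HB.instance Definition _ :=
  GRing.isZmodule.Build H quat_addA quat_addC quat_add0 quat_addN.

Definition quat_one : H := Quat 1 0 0 0.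
Definition quat_mul (p q : H) : H :=
  let: Quat a b c d := p in let: Quat a' b' c' d' := q in
  Quat (a * a' - b * b' - c * c' - d * d')
       (a * b' + b * a' + c * d' - d * c')
       (a * c' - b * d' + c * a' + d * b')
       (a * d' + b * c' - c * b' + d * a').

Fact quat_mulA : associative quat_mul.
Proof. by move=> [? ? ? ?] [? ? ? ?] [? ? ? ?]; apply: quat_ext => /=; ring. Qed.
Fact quat_mul1 : left_id quat_one quat_mul.
Proof. by move=> [? ? ? ?]; apply: quat_ext => /=; ring. Qed.
Fact quat_1mul : right_id quat_one quat_mul.
Proof. by move=> [? ? ? ?]; apply: quat_ext => /=; ring. Qed.
Fact quat_mulDl : left_distributive quat_mul +%R.
Proof. by move=> [? ? ? ?] [? ? ? ?] [? ? ? ?]; apply: quat_ext => /=; ring. Qed.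
Fact quat_mulDr : right_distributive quat_mul +%R.
Proof. by move=> [? ? ? ?] [? ? ? ?] [? ? ? ?]; apply: quat_ext => /=; ring. Qed.
Fact quat_one_neq0 : quat_one != 0 :> H.
Proof. by apply/eqP => -[] /eqP; rewrite oner_eq0. Qed.
HB.instance Definition _ := GRing.Zmodule_isNzRing.Build H
  quat_mulA quat_mul1 quat_1mul quat_mulDl quat_mulDr quat_one_neq0.

Definition quat_scale (a : R) (q : H) : H :=
  Quat (a * qre q) (a * qi q) (a * qj q) (a * qk q).

Fact quat_scaleA a b (q : H) :
  quat_scale a (quat_scale b q) = quat_scale (a * b) q.
Proof. by apply: quat_ext => /=; ring. Qed.
Fact quat_scale1 : left_id 1 quat_scale.
Proof. by move=> q; apply: quat_ext => /=; ring. Qed.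
Fact quat_scaleDr : right_distributive quat_scale +%R.
Proof. by move=> a p q; apply: quat_ext => /=; ring. Qed.
Fact quat_scaleDl (q : H) : {morph quat_scale^~ q : a b / a + b}.
Proof. by move=> a b; apply: quat_ext => /=; ring. Qed.
HB.instance Definition _ := GRing.Zmodule_isLmodule.Build R H
  quat_scaleA quat_scale1 quat_scaleDr quat_scaleDl.

Fact quat_scaleAl (a : R) (p q : H) : a *: (p * q) = (a *: p) * q.
Proof. by case: p q => [? ? ? ?] [? ? ? ?]; apply: quat_ext => /=; ring. Qed.
HB.instance Definition _ := GRing.Lmodule_isLalgebra.Build R H quat_scaleAl.

Fact quat_scaleAr (a : R) (p q : H) : a *: (p * q) = p * (a *: q).
Proof. by case: p q => [? ? ? ?] [? ? ? ?]; apply: quat_ext => /=; ring. Qed.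
HB.instance Definition _ := GRing.Lalgebra_isAlgebra.Build R H quat_scaleAr.

Definition qconj (q : H) : H := Quat (qre q) (- qi q) (- qj q) (- qk q).

(* |q|^2 *)
Definition qnormsq (q : H) : R :=
  qre q ^+ 2 + qi q ^+ 2 + qj q ^+ 2 + qk q ^+ 2.
Definition qnorm (q : H) : R := Num.sqrt (qnormsq q).

Definition qim (q : H) : H := Quat 0 (qi q) (qj q) (qk q).

End QuatAlgebra.

Section QuatAnalysis.
Variable R : realType.
Local Notation H := (quat R).

Definition qlim (u : nat -> H) : H :=
  Quat (limn (fun n => qre (u n))) (limn (fun n => qi (u n)))
       (limn (fun n => qj (u n))) (limn (fun n => qk (u n))).

Definition qexp (q : H) : H :=
  qlim (fun n => \sum_(0 <= k < n) (k`!%:R)^-1 *: q ^+ k).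

Definition qderive (f : R -> H) (x : R) : H :=
  Quat (derive1 (fun t => qre (f t)) x) (derive1 (fun t => qi (f t)) x)
       (derive1 (fun t => qj (f t)) x) (derive1 (fun t => qk (f t)) x).

Definition qintegral d (T : measurableType d) (mu : {measure set T -> \bar R})
    (f : T -> H) : H :=
  Quat (\int[mu]_x qre (f x)) (\int[mu]_x qi (f x))
       (\int[mu]_x qj (f x)) (\int[mu]_x qk (f x)).

Definition qmeasurable d (T : measurableType d) (f : T -> H) : Prop :=
  [/\ measurable_fun setT (fun x => qre (f x)),
      measurable_fun setT (fun x => qi (f x)),
      measurable_fun setT (fun x => qj (f x)) &
      measurable_fun setT (fun x => qk (f x))].

(* Membership in L^2(T, H), for representatives of the classes. *)
Definition qL2 d (T : measurableType d) (mu : {measure set T -> \bar R})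
    (f : T -> H) : Prop :=
  qmeasurable f /\ (\int[mu]_x (qnorm (f x) ^+ 2)%:E < +oo)%E.

Definition qinner d (T : measurableType d) (mu : {measure set T -> \bar R})
    (f g : T -> H) : H :=
  qintegral mu (fun x => qconj (g x) * f x).

Definition leb1 : {measure set (measurableTypeR R) -> \bar R} :=
  @lebesgue_measure R.
Definition leb2 :
    {measure set (measurableTypeR R * measurableTypeR R) -> \bar R} :=
  (@lebesgue_measure R \x @lebesgue_measure R)%E.

Definition qvinner (n : nat) (f g : 'I_n.+1 -> R -> H) : H :=
  \sum_j qinner leb1 (f j) (g j).

End QuatAnalysis.

Arguments leb1 {R}.
Arguments leb2 {R}.

Section Transforms.
Variable R : realType.
Local Notation H := (quat R).

(* The imaginary unit J for which q = x + J y with y = |Im q|.  A real q lies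
   on every slice; the unit i is then used, a choice that does not affect the
   slice derivative of a slice regular function. *)
Definition slice_unit (q : H) : H :=
  if qim q == 0 then Quat 0 1 0 0 else (qnorm (qim q))^-1 *: qim q.

(* (1/2) (d/dx - J d/dy) f(x + J y) at q = x + J y *)
Definition slice_derive (f : H -> H) (q : H) : H :=
  let J := slice_unit q in
  let x := qre q in
  let y := qnorm (qim q) in
  2^-1 *: (qderive (fun u => f (u%:A + y *: J)) x
           - J * qderive (fun v => f (x%:A + v *: J)) y).

Definition bargmann (phi : R -> H) (q : H) : H :=
  (2 `^ (3 / 4)) *:
  qintegral leb1 (fun t : R =>
    qexp (- (pi *: (q ^+ 2 + (t ^+ 2)%:A)) + (2 * pi * Num.sqrt 2 * t) *: q)
    * phi t).

(* [true_poly_bargmann j] is B^{j+1}. *)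
Definition true_poly_bargmann (j : nat) (phi : R -> H) (q : H) : H :=
  ((-1) ^+ j * Num.sqrt (((2 * pi) ^+ j * j`!%:R)^-1)) *:
  \sum_(k < j.+1)
    'C(j, k)%:R *:
      ((- (2 * pi) *: qconj q) ^+ k
       * iter (j - k) slice_derive (bargmann phi) q).

Definition full_poly_bargmann (n : nat) (phi : 'I_n.+1 -> R -> H) (q : H) : H :=
  \sum_(j < n.+1) true_poly_bargmann j (phi j) q.

(* The full-poly QSTFT with respect to the normalized weighted Hermite windows
   psi_0, ..., psi_n: it is defined through the full-polyanalytic Bargmann
   transform, so the windows do not occur in the formula. *)
Definition full_poly_qstft (I : H) (n : nat) (phi : 'I_n.+1 -> R -> H)
    (z : R * R) : H :=
  let x := z.1 in
  let omega := z.2 in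
  let q := x%:A + omega *: I in
  qexp (- (pi * x * omega) *: I)
  * full_poly_bargmann phi ((Num.sqrt 2)^-1 *: qconj q)
  * (expR (- (qnorm q ^+ 2 * pi / 2)))%:A.

End Transforms.

(* Main.v *)
Require Import Defs.
From mathcomp Require Import all_boot all_order all_algebra.
From mathcomp Require Import ring lra.
From mathcomp Require Import all_classical all_reals all_analysis.
From mathcomp Require Import measurable_realfun lebesgue_integral_under.
Set Implicit Arguments.
Unset Strict Implicit.
Unset Printing Implicit Defensive.
Import Order.TTheory GRing.Theory Num.Theory.
Import numFieldNormedType.Exports.
Local Open Scope classical_set_scope.
Local Open Scope ring_scope.

(** Why the identity holds.

    On the slice of J (J * J = -1) the number q = u + v J commutes with every
    a + b J, so the quaternionic exponential behaves there like the complex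
    one ([qexpE]).  Hence, for q in the slice, the Bargmann transform is the
    integral of phi against a kernel with values in R + R J, and one may
    differentiate under the integral: since the kernel is holomorphic, the
    slice derivative of order m replaces it by its complex derivative of order
    m ([iter_slice_derive_bargmann]).  These derivatives are the kernel times
    polynomials obeying a Hermite recurrence, and the binomial sum that defines
    the true polyanalytic transform shifts the variable of those polynomials
    from a quaternionic to a real one ([binomial_sum_hermite]).  At the point
    conj(q)/sqrt 2 the remaining Gaussian factors complete a square, and the
    transform becomes a windowed Fourier transform
    [[
      V phi (x, w) = int exp(- 2 pi w t I) sum_j g_j (t - x) phi_j (t) dt
    ]]
    ([full_poly_qstft_windowed]), where g_j is, up to sign, sqrt 2 times the
    normalized weighted Hermite function psi_j ([window]); in particular the
    g_j are orthogonal with squared norm 2 ([window_orthogonal]), which is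
    where the factor 2 of the statement comes from.

    For fixed x, write V phi (x, w) = P w - I (Q w) with P and Q the cosine
    and sine transforms.  P is even and Q is odd, so averaging over w and - w
    removes the cross terms, and the squared norm in w is that of the window
    sum by Plancherel's identity for real functions ([plancherel]), applied to
    the four real components ([stft_energy_slice]).  Integrating over x,
    exchanging the integrals by Tonelli and using the orthogonality of the
    windows at fixed t gives
    [[
      int |V phi|^2 = 2 sum_j int |phi_j|^2
    ]]
    ([stft_energy]).  Finally V is additive and commutes with right
    multiplication by quaternions, so this identity of norms polarizes: first
    to the real parts of the inner products ([stft_inner_real]), and then, by
    multiplying on the right by - i, - j, - k, to the imaginary ones
    ([stft_inner]).

    Plancherel's identity is proved for integrable square-integrable functions
    by Abel summation: damping the spectrum by exp(- 2 pi b |w|) corresponds to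
    convolving with the Poisson kernel ([integral_regularized]).  Schur's test
    gives the inequality in one direction; the other one follows by duality
    against continuous bounded functions, which are dense. *)

(** * Lebesgue integrals over the line and the plane *)
Section LebesgueLine.
Variable R : realType.
Local Notation mu := (@lebesgue_measure R).

Lemma measurable_affine (a c : R) :
  measurable_fun [set: measurableTypeR R]
    ((fun x => a * x + c) : measurableTypeR R -> measurableTypeR R).
Proof. by apply: measurable_funD => //; apply: measurable_funM. Qed.

Lemma preimage_affine_ocitv (a c p q : R) : 0 < a ->
  (fun x => a * x + c) @^-1` `]p, q]%classic = `](p - c) / a, (q - c) / a]%classic.
Proof.
move=> a0; apply/seteqP; split => x /=; rewrite !in_itv/=.
  move=> /andP[h1 h2]; apply/andP; split.
    by rewrite ltr_pdivrMr//; lra.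
  by rewrite ler_pdivlMr//; lra.
rewrite ltr_pdivrMr// ler_pdivlMr// => /andP[h1 h2]; apply/andP; split; lra.
Qed.

(** Lebesgue measure is determined by its values on half-open intervals, so the
    scaled image measure coincides with it as soon as both agree there. *)
Lemma lebesgue_measure_affine (a c : R) (A : set R) : 0 < a -> measurable A ->
  mu A = (a%:E * mu ((fun x => (a * x + c)%R) @^-1` A))%E.
Proof.
move=> a0 mA.
have a0' : 0 <= a by exact: ltW.
have mphi := measurable_affine a c.
pose phi : measurableTypeR R -> measurableTypeR R := fun x => a * x + c.
pose nu := mscale (NngNum a0') (pushforward mu phi).
have -> : (a%:E * mu ((fun x => (a * x + c)%R) @^-1` A))%E = nu mphi A by [].
apply: lebesgue_measure_unique => // _ [[p q]] _ <-.
rewrite [RHS](_ : _ =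
  (a%:E * mu [set` `]((p - c) / a)%R, ((q - c) / a)%R]])%E); last first.
  by rewrite -(preimage_affine_ocitv c p q a0).
rewrite !lebesgue_measure_itv/=.
rewrite !lte_fin ltr_pM2r ?invr_gt0// ltrD2r.
case: ifPn => // _; last by rewrite mule0.
by rewrite -!EFinD -EFinM; congr EFin; field; rewrite gt_eqF.
Qed.

Lemma ge0_integral_affine (a c : R) (f : R -> \bar R) : 0 < a ->
  measurable_fun setT f -> (forall x, 0 <= f x)%E ->
  (\int[mu]_x f x = a%:E * \int[mu]_x f (a * x + c)%R)%E.
Proof.
move=> a0 mf f0.
have a0' : 0 <= a by exact: ltW.
have mphi := measurable_affine a c.
pose phi : measurableTypeR R -> measurableTypeR R := fun x => a * x + c.
rewrite -[X in (_ * X)%E](_ : (\int[pushforward mu phi]_y f y)%E = _); last first.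
  by rewrite ge0_integral_pushforward.
rewrite -(ge0_integral_mscale _ _ (NngNum a0'))//.
by apply: eq_measure_integral => A mA _ /=; rewrite (lebesgue_measure_affine c a0).
Qed.

Lemma integral_affine (a c : R) (f : R -> R) : 0 < a ->
  mu.-integrable setT (EFin \o f) ->
  mu.-integrable setT (fun x => (f (a * x + c))%:E) /\
  \int[mu]_x f x = a * \int[mu]_x f (a * x + c).
Proof.
move=> a0 intf.
have /integrableP[mf foo] := intf.
have mphi := measurable_affine a c.
have intg : mu.-integrable setT (fun x => (f (a * x + c))%:E).
  apply/integrableP; split; first exact: measurableT_comp mf mphi.
  move: foo; rewrite (@ge0_integral_affine a c)//; last exact: measurableT_comp.
  rewrite /= => foo; rewrite ltNge leye_eq; apply/negP => /eqP h.
  by move: foo; rewrite h mulry gtr0_sg// mul1e ltxx.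
split => //.
rewrite /Rintegral.
have -> : (\int[mu]_x (f x)%:E = a%:E * \int[mu]_x (f (a * x + c))%:E)%E.
  rewrite [LHS]integralE [in RHS]integralE muleBr//; last exact: integrable_add_def.
  congr (_ - _)%E.
    rewrite (@ge0_integral_affine a c (EFin \o f)^\+%E a0)//; last exact: measurable_funepos.
    by congr (_ * _)%E; apply: eq_integral => x _; rewrite !funeposE.
  rewrite (@ge0_integral_affine a c (EFin \o f)^\-%E a0)//; last exact: measurable_funeneg.
    by congr (_ * _)%E; apply: eq_integral => x _; rewrite !funenegE.
by rewrite fineM// integrable_fin_num.
Qed.

Lemma ge0_integral_reflect (f : R -> \bar R) :
  measurable_fun setT f -> (forall x, 0 <= f x)%E ->
  (\int[mu]_x f x = \int[mu]_x f (- x)%R)%E.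
Proof.
move=> mf f0.
rewrite -[RHS](_ :
  (\int[pushforward mu (-%R : measurableTypeR R -> measurableTypeR R)]_y f y)%E = _).
  by apply: eq_measure_integral => A mA _ /=; rewrite -lebesgue_measureN.
by rewrite ge0_integral_pushforward.
Qed.

Lemma integral_reflect (f : R -> R) : mu.-integrable setT (EFin \o f) ->
  mu.-integrable setT (fun x => (f (- x))%:E) /\
  \int[mu]_x f x = \int[mu]_x f (- x).
Proof.
move=> intf; have /integrableP[mf foo] := intf.
have mN : measurable_fun [set: measurableTypeR R]
  (-%R : measurableTypeR R -> measurableTypeR R) by [].
split.
  apply/integrableP; split; first exact: measurableT_comp mf mN.
  by move: foo; rewrite ge0_integral_reflect//; exact: measurableT_comp.
rewrite /Rintegral; congr fine.
rewrite [LHS]integralE [in RHS]integralE.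
congr (_ - _)%E.
  rewrite (@ge0_integral_reflect (EFin \o f)^\+%E)//; last exact: measurable_funepos.
  by apply: eq_integral => x _; rewrite !funeposE.
rewrite (@ge0_integral_reflect (EFin \o f)^\-%E)//; last exact: measurable_funeneg.
  by apply: eq_integral => x _; rewrite !funenegE.
Qed.

(** Domination by a product of two integrable functions of one variable is the
    form in which integrability over the plane is checked in all later uses of
    Fubini's theorem. *)
Lemma integrable_product (h : R -> R -> R) (p q : R -> R) :
  measurable_fun setT (fun z : measurableTypeR R * measurableTypeR R => h z.1 z.2) ->
  (forall x y, `|h x y| <= p x * q y) ->
  mu.-integrable setT (EFin \o p) -> mu.-integrable setT (EFin \o q) ->
  (mu \x mu)%E.-integrable setT (fun z => (h z.1 z.2)%:E).
Proof.
move=> mh hpq intp intq.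
have /integrableP[mp p_lty] := intp.
have /integrableP[mq q_lty] := intq.
apply/integrable12ltyP; first exact/measurable_EFinP.
have q_fin : (\int[mu]_y `|(q y)%:E|)%E \is a fin_num.
  by rewrite ge0_fin_numE// integral_ge0.
apply: (@le_lt_trans _ _ (\int[mu]_x (`|(p x)%:E| * \int[mu]_y `|(q y)%:E|))%E).
  apply: ge0_le_integral => //.
  - by move=> x _; apply: integral_ge0.
  - apply: (@measurable_fun_fubini_tonelli_F _ _ _ _ _ mu
      (fun z => `|(h z.1 z.2)%:E|%E)) => //.
    by apply: measurableT_comp => //; exact/measurable_EFinP.
  - by apply: emeasurable_funM => //; apply: measurableT_comp.
  - have mnq : measurable_fun setT (fun y => `|q y|).
      by apply: measurableT_comp => //; exact/measurable_EFinP.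
    move=> x _; rewrite -ge0_integralZl//=; last exact/measurable_EFinP.
    apply: ge0_le_integral => //.
    + apply/measurable_EFinP; apply: measurableT_comp => //.
      exact: (measurableT_comp mh (measurable_pair1 x)).
    + under eq_fun do rewrite -EFinM.
      by apply/measurable_EFinP; exact: measurable_funM.
    + move=> y _; rewrite -EFinM lee_fin -normrM.
      by apply: (le_trans (hpq x y)); exact: ler_norm.
rewrite ge0_integralZr//; last 2 first.
- exact: measurableT_comp.
- by rewrite integral_ge0.
have p_fin : (\int[mu]_x `|(p x)%:E|)%E \is a fin_num.
  by rewrite ge0_fin_numE// integral_ge0.
by rewrite -(fineK p_fin) -(fineK q_fin) -EFinM ltry.
Qed.

Lemma fubini_product (h : R -> R -> R) (p q : R -> R) :
  measurable_fun setT (fun z : measurableTypeR R * measurableTypeR R => h z.1 z.2) ->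
  (forall x y, `|h x y| <= p x * q y) ->
  mu.-integrable setT (EFin \o p) -> mu.-integrable setT (EFin \o q) ->
  \int[mu]_x (\int[mu]_y h x y) = \int[mu]_y (\int[mu]_x h x y).
Proof.
move=> mh hpq intp intq.
have inth := integrable_product mh hpq intp intq.
rewrite /Rintegral.
have := Fubini inth => /(congr1 fine) /=.
have hx x : mu.-integrable setT (fun y => (h x y)%:E).
  have := integrableZl measurableT (p x) intq.
  apply: le_integrable => //.
    by apply/measurable_EFinP; exact: (measurableT_comp mh (measurable_pair1 x)).
  by move=> y _ /=; rewrite lee_fin; apply: (le_trans (hpq x y)); exact: ler_norm.
have hy y : mu.-integrable setT (fun x => (h x y)%:E).
  have := integrableZl measurableT (q y) intp.
  apply: le_integrable => //.
    by apply/measurable_EFinP; exact: (measurableT_comp mh (measurable_pair2 y)).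
  move=> x _ /=; rewrite lee_fin mulrC.
  by apply: (le_trans (hpq x y)); exact: ler_norm.
under eq_integral do rewrite -(fineK (integrable_fin_num _ (hx _)))//.
under [in RHS]eq_integral do rewrite -(fineK (integrable_fin_num _ (hy _)))//.
by [].
Qed.

Lemma measurable_integral_param (d : measure_display) (T : measurableType d) (h : T -> R -> R) :
  measurable_fun setT (fun z : T * measurableTypeR R => h z.1 z.2) ->
  measurable_fun setT (fun x => \int[mu]_y h x y).
Proof.
move=> mh; rewrite /Rintegral.
apply: measurableT_comp => //.
pose g := EFin \o (fun z : T * measurableTypeR R => h z.1 z.2).
have mg : measurable_fun setT g by exact/measurable_EFinP.
rewrite (_ : (fun x : T => _) =
  (fubini_F mu (g ^\+) \- fubini_F mu (g ^\-))%E); last first.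
    apply/funext => x; rewrite [LHS]integralE /fubini_F.
  by congr (_ - _)%E; apply: eq_integral => y _; rewrite ?funeposE ?funenegE.
apply: emeasurable_funB; apply: measurable_fun_fubini_tonelli_F => //.
  exact: measurable_funepos.
exact: measurable_funeneg.
Qed.

Lemma measurable_integral_ge0 (d : measure_display) (T : measurableType d)
    (f : T * measurableTypeR R -> \bar R) :
  measurable_fun setT f -> (forall z, 0 <= f z)%E ->
  measurable_fun setT (fun x => \int[mu]_y f (x, y))%E.
Proof. by move=> mf f0; exact: (@measurable_fun_fubini_tonelli_F _ _ _ _ _ mu f). Qed.

Lemma dominated_Rintegral (d : measure_display) (T : measurableType d)
    (nu : {measure set T -> \bar R}) (F : nat -> T -> R) (f g : T -> R) :
  (forall n, measurable_fun setT (F n)) -> measurable_fun setT f ->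
  {ae nu, forall x, F n x @[n --> \oo] --> f x} ->
  nu.-integrable setT (EFin \o g) -> (forall n x, `|F n x| <= g x) ->
  nu.-integrable setT (EFin \o f) /\
  (\int[nu]_x F n x) @[n --> \oo] --> \int[nu]_x f x.
Proof.
move=> mF mf Ff intg Fg.
have [] := @dominated_convergence _ T R nu setT measurableT
  (fun n x => (F n x)%:E) (EFin \o f) (EFin \o g).
- by move=> n; exact/measurable_EFinP.
- exact/measurable_EFinP.
- apply: filterS Ff => x Fx _.
  by apply/fine_cvgP; split => //; near=> n.
- by [].
- by apply: aeW => x n _; rewrite lee_fin.
move=> intf _ cvgF; split => //.
have fin : (\int[nu]_x (EFin \o f) x)%E \is a fin_num by exact: integrable_fin_num.
rewrite /Rintegral; apply: fine_cvg.
by rewrite fineK.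
Unshelve. all: by end_near. Qed.

(** Folding the line onto the half-line reduces integrals of functions given by
    different formulas on the two sides of 0 to the fundamental theorem of
    calculus on [0, +oo[. *)
Lemma integral_fold (f : R -> R) : mu.-integrable setT (EFin \o f) ->
  \int[mu]_x f x = \int[mu]_(x in `[0, +oo[) (f x + f (- x)).
Proof.
move=> intf.
have mp : measurable (`[0, +oo[%classic : set R) by exact: measurable_itv.
have mn : measurable (`]-oo, 0[%classic : set R) by exact: measurable_itv.
have [intfN _] := integral_reflect intf.
have -> : [set: measurableTypeR R] = `[0, +oo[%classic `|` `]-oo, 0[%classic.
  by rewrite setUC; apply/esym/itv_setU_setT.
have intP : mu.-integrable `[0, +oo[ (EFin \o f) by exact: integrableS intf.
have intN : mu.-integrable `[0, +oo[ (EFin \o (fun x => f (- x))).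
  by exact: integrableS intfN.
rewrite Rintegral_setU//; last 2 first.
- by apply: integrableS intf => //; exact: measurableU.
- apply/disj_setPLR => x /=; rewrite !in_itv/= andbT => x0.
  by apply/negP; rewrite -leNgt.
rewrite RintegralD//; congr (_ + _).
rewrite Rintegral_mkcond.
have [] := @integral_reflect (f \_ `]-oo, 0[).
  by rewrite -restrict_EFin; apply/integrable_restrict => //; rewrite ?setTI ?setIT;
    exact: integrableS intf.
move=> _ ->.
rewrite -(@Rintegral_itv_obnd_cbnd _ 0 +oo%O (fun x => f (- x))); last first.
  apply: integrableS intN => //.
  by move=> x; rewrite /= !in_itv/= !andbT; exact: ltW.
rewrite [RHS]Rintegral_mkcond; apply: eq_Rintegral => x _.
rewrite !patchE; congr (if _ then _ else _).
by apply/idP/idP => /set_mem; rewrite /= !in_itv/= ?andbT => h; apply/mem_set;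
  rewrite /= in_itv/= ?andbT; lra.
Qed.

(** The integrand need not have a sign: integrability lets the integrals over
    [0, n] converge by dominated convergence. *)
Lemma integral_halfline_FTC (f F : R -> R) (l : R) :
  continuous f -> (forall x : R, is_derive x 1 F (f x)) ->
  mu.-integrable `[0, +oo[ (EFin \o f) -> F x @[x --> +oo] --> l ->
  \int[mu]_(x in `[0, +oo[) f x = l - F 0.
Proof.
move=> cf dF intf Fl.
have mp : measurable (`[0, +oo[%classic : set R) by exact: measurable_itv.
have int' : mu.-integrable setT (EFin \o (f \_ `[0, +oo[)).
  by rewrite -restrict_EFin; apply/integrable_restrict; rewrite ?setTI.
have mf : measurable_fun [set: measurableTypeR R] f by exact: continuous_measurable_fun.
have mn n : measurable (`[0, n%:R]%classic : set R) by exact: measurable_itv.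
have [|||||_] := @dominated_Rintegral _ _ mu (fun n => f \_ `[0, n%:R])
  (f \_ `[0, +oo[) (fun x => `|(f \_ `[0, +oo[) x|).
- move=> n; apply/(measurable_restrict _ _ _) => //.
  exact: measurable_funTS.
- apply/(measurable_restrict _ _ _) => //; exact: measurable_funTS.
- apply: aeW => x; apply: cvg_near_cst; near=> n.
  rewrite !patchE; congr (if _ then _ else _).
  apply/idP/idP => /set_mem; rewrite /= !in_itv/= ?andbT => h; apply/mem_set;
  rewrite /= in_itv/= ?andbT; first by case/andP: h.
  by rewrite h/=; near: n; exact: nbhs_infty_ger.
- by have := integrable_norm int'.
- move=> n x; rewrite !patchE.
  case: ifPn => [/set_mem|_]; last by rewrite normr0.
  rewrite /= in_itv/= => /andP[x0 _].
  by rewrite ifT//; apply/mem_set; rewrite /= in_itv/= x0.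
rewrite -Rintegral_mkcond => cv1.
have cv2 : (F n%:R - F 0) @[n --> \oo] --> l - F 0.
  by apply: cvgB; [apply: (cvg_comp _ _ _ Fl); exact: cvgr_idn|exact: cvg_cst].
apply: (cvg_unique _ cv1) => //.
apply: cvg_trans cv2; apply: near_eq_cvg; near=> n.
rewrite -Rintegral_mkcond /Rintegral (@continuous_FTC2 _ f F)//.
- by rewrite ltr0n; near: n; exact: nbhs_infty_gt.
- exact: continuous_subspaceT.
- split.
  + by move=> x _; exact: ex_derive.
  + by apply: cvg_at_right_filter; apply: differentiable_continuous; apply/derivable1_diffP; exact: ex_derive.
  + by apply: cvg_at_left_filter; apply: differentiable_continuous; apply/derivable1_diffP; exact: ex_derive.
- by move=> x _; rewrite derive1E; exact: derive_val.
Unshelve. all: by end_near. Qed.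

End LebesgueLine.

(** * Damped spectra and the Poisson kernel *)
Section Plancherel.
Variable R : realType.
Local Notation mu := (@lebesgue_measure R).

Definition sqintegrable (f : R -> R) : Prop :=
  measurable_fun setT f /\ mu.-integrable setT (fun x => (f x ^+ 2)%:E).

(** Plancherel's identity is stated with the real cosine and sine transforms:
    [spectrum f] is the squared modulus of the Fourier transform of f. *)
Definition cosT (f : R -> R) (w : R) : R := \int[mu]_t (cos (2 * pi * w * t) * f t).
Definition sinT (f : R -> R) (w : R) : R := \int[mu]_t (sin (2 * pi * w * t) * f t).

Definition spectrum (f : R -> R) (w : R) : R := cosT f w ^+ 2 + sinT f w ^+ 2.

(** The Fourier transform of w |-> exp (- 2 pi b |w|), an approximate identity
    as b tends to 0. *)
Definition poisson (b u : R) : R := b / (pi * (b ^+ 2 + u ^+ 2)).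

Lemma integrable_measurable (f : R -> R) :
  mu.-integrable setT (EFin \o f) -> measurable_fun setT f.
Proof. by case/integrableP => /measurable_EFinP. Qed.

Lemma integrable_bounded_mul (f h : R -> R) (M : R) :
  mu.-integrable setT (EFin \o f) -> measurable_fun setT h ->
  (forall x, `|h x| <= M) -> mu.-integrable setT (fun x => (h x * f x)%:E).
Proof.
move=> intf mh hM; have mf := integrable_measurable intf.
have := integrableZl measurableT M intf; apply: le_integrable => //.
  by apply/measurable_EFinP; exact: measurable_funM.
move=> x _ /=; rewrite lee_fin !normrM ler_wpM2r//.
by apply: (le_trans (hM x)); exact: ler_norm.
Qed.

Lemma norm_cos_le1 (x : R) : `|cos x| <= 1.
Proof. by rewrite ler_norml cos_geN1 cos_le1. Qed.
Lemma norm_sin_le1 (x : R) : `|sin x| <= 1.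
Proof. by rewrite ler_norml sin_geN1 sin_le1. Qed.

Lemma measurable_cos_comp d (T : measurableType d) (h : T -> R) :
  measurable_fun setT h -> measurable_fun setT (fun x => cos (h x)).
Proof.
apply: measurableT_comp.
by apply: continuous_measurable_fun; exact: continuous_cos.
Qed.
Lemma measurable_sin_comp d (T : measurableType d) (h : T -> R) :
  measurable_fun setT h -> measurable_fun setT (fun x => sin (h x)).
Proof.
apply: measurableT_comp.
by apply: continuous_measurable_fun; exact: continuous_sin.
Qed.
Lemma measurable_expR_comp d (T : measurableType d) (h : T -> R) :
  measurable_fun setT h -> measurable_fun setT (fun x => expR (h x)).
Proof.
apply: measurableT_comp.
by apply: continuous_measurable_fun; exact: continuous_expR.
Qed.

Lemma integrable_cosT (f : R -> R) (w : R) : mu.-integrable setT (EFin \o f) ->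
  mu.-integrable setT (fun t => (cos (2 * pi * w * t) * f t)%:E).
Proof.
move=> intf; apply: (integrable_bounded_mul (M := 1)) => //.
  exact: measurable_cos_comp.
by move=> x; exact: norm_cos_le1.
Qed.

Lemma integrable_sinT (f : R -> R) (w : R) : mu.-integrable setT (EFin \o f) ->
  mu.-integrable setT (fun t => (sin (2 * pi * w * t) * f t)%:E).
Proof.
move=> intf; apply: (integrable_bounded_mul (M := 1)) => //.
  exact: measurable_sin_comp.
by move=> x; exact: norm_sin_le1.
Qed.

Lemma measurable_cosT (f : R -> R) : measurable_fun setT f ->
  measurable_fun setT (cosT f).
Proof.
move=> mf; apply: measurable_integral_param.
apply: measurable_funM; last exact: (measurableT_comp mf measurable_snd).
apply: measurable_cos_comp.
by apply: measurable_funM => //; apply: measurable_funM.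
Qed.

Lemma measurable_sinT (f : R -> R) : measurable_fun setT f ->
  measurable_fun setT (sinT f).
Proof.
move=> mf; apply: measurable_integral_param.
apply: measurable_funM; last exact: (measurableT_comp mf measurable_snd).
apply: measurable_sin_comp.
by apply: measurable_funM => //; apply: measurable_funM.
Qed.

Lemma measurable_spectrum (f : R -> R) : measurable_fun setT f ->
  measurable_fun setT (spectrum f).
Proof.
move=> mf; apply: measurable_funD; apply: measurable_funX.
  exact: measurable_cosT.
exact: measurable_sinT.
Qed.

Lemma spectrum_ge0 (f : R -> R) w : 0 <= spectrum f w.
Proof. by rewrite addr_ge0// sqr_ge0. Qed.

Lemma is_derive_mul (f g : R -> R) (x a b : R) :
  is_derive x 1 f a -> is_derive x 1 g b ->
  is_derive x 1 (fun y => f y * g y) (a * g x + f x * b).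
Proof.
move=> df dg; have := is_deriveM df dg.
by move=> /is_derive_eq; apply; rewrite /GRing.scale/= addrC mulrC [f x * b]mulrC; ring.
Qed.

Lemma is_derive_add (f g : R -> R) (x a b : R) :
  is_derive x 1 f a -> is_derive x 1 g b ->
  is_derive x 1 (fun y => f y + g y) (a + b).
Proof. by move=> df dg; have := is_deriveD df dg. Qed.

Lemma is_derive_const (c x : R) : is_derive x 1 ((fun=> c) : R -> R) 0.
Proof. exact: is_derive_cst. Qed.

Lemma is_derive_lin (c x : R) : is_derive x 1 (fun y => c * y) c.
Proof.
have := is_derive_mul (is_derive_const c x) (is_derive_id x 1).
by move=> /is_derive_eq; apply; ring.
Qed.

Lemma is_derive_expR_comp (f : R -> R) (x a : R) : is_derive x 1 f a ->
  is_derive x 1 (fun y => expR (f y)) (a * expR (f x)).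
Proof.
move=> df; have := is_derive1_comp (is_derive_expR (f x)) df.
by move=> /is_derive_eq; apply; rewrite mulrC.
Qed.

Lemma is_derive_cos_comp (f : R -> R) (x a : R) : is_derive x 1 f a ->
  is_derive x 1 (fun y => cos (f y)) (- (a * sin (f x))).
Proof.
move=> df; have := is_derive1_comp (is_derive_cos (f x)) df.
by move=> /is_derive_eq; apply; ring.
Qed.

Lemma is_derive_sin_comp (f : R -> R) (x a : R) : is_derive x 1 f a ->
  is_derive x 1 (fun y => sin (f y)) (a * cos (f x)).
Proof.
move=> df; have := is_derive1_comp (is_derive_sin (f x)) df.
by move=> /is_derive_eq; apply; ring.
Qed.

Lemma is_derive_continuous (f df : R -> R) :
  (forall x : R, is_derive x 1 f (df x)) -> continuous f.
Proof.
move=> h x; apply: differentiable_continuous.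
by apply/derivable1_diffP; exact: ex_derive.
Qed.

Lemma is_derive_exp_lin (c x : R) :
  is_derive x 1 (fun w => expR (- (c * w))) (- c * expR (- (c * x))).
Proof.
apply: is_derive_expR_comp.
by under eq_fun do rewrite -mulNr; exact: is_derive_lin.
Qed.

Lemma cvg_exp_lin (c : R) : 0 < c -> expR (- (c * w)) @[w --> +oo] --> (0 : R).
Proof.
move=> c0; apply: (@cvg_comp _ _ _ (fun w => c * w) (fun z => expR (- z)) _ +oo).
  apply: gt0_cvgMry => //; exact: cvg_id.
exact: cvgr_expR.
Qed.

Lemma integrable_exp_abs (c : R) : 0 < c ->
  mu.-integrable setT (fun w => (expR (- (c * `|w|)))%:E).
Proof.
move=> c0.
have cont : continuous (fun w : R => expR (- (c * `|w|))).
  move=> w; apply: continuous_comp; last exact: continuous_expR.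
  apply: cvgN; apply: cvgM; [exact: cvg_cst|exact: norm_continuous].
apply/integrableP; split.
  by apply/measurable_EFinP; exact: continuous_measurable_fun.
under eq_integral do rewrite /= ger0_norm ?expR_ge0//.
rewrite ge0_symfun_integralT//=; last by move=> w /=; rewrite normrN.
rewrite (_ : [set x | _] = `[0, +oo[%classic); last first.
  by apply/seteqP; split => x/=; rewrite in_itv/= andbT.
rewrite (_ : (\int[mu]_(x in _) _ = \int[mu]_(w in `[0%R, +oo[) (expR (- (c * w)))%:E)%E); last first.
  apply: eq_integral.
  by move=> w /set_mem; rewrite /= in_itv/= andbT => w0; rewrite ger0_norm.
have dF (x : R) : is_derive x 1 (fun w => - c^-1 * expR (- (c * w))) (expR (- (c * x))).
  have := is_derive_mul (is_derive_const (- c^-1) x) (is_derive_exp_lin c x).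
  by move=> /is_derive_eq; apply; field; rewrite gt_eqF.
rewrite (@ge0_continuous_FTC2y _ _ (fun w => - c^-1 * expR (- (c * w))) _ 0).
- by rewrite -EFinD -EFinM ltry.
- by move=> x _; exact: expR_ge0.
- apply: continuous_subspaceT => x.
  exact: (is_derive_continuous (fun y => is_derive_exp_lin c y)).
- by rewrite -(mulr0 (- c^-1)); apply: cvgM; [exact: cvg_cst|exact: cvg_exp_lin].
- by move=> x _; exact: ex_derive.
- by apply: cvg_at_right_filter; exact: (is_derive_continuous dF).
- by move=> x _; rewrite derive1E; exact: derive_val.
Qed.

(** The integrand is even in w; on the half-line it has an explicit primitive,
    found by integrating exp (- (c - i d) w). *)
Lemma integral_exp_cos (b u : R) : 0 < b ->
  \int[mu]_w (expR (- (2 * pi * b * `|w|)) * cos (2 * pi * w * u)) = poisson b u.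
Proof.
move=> b0; set c := 2 * pi * b; set d := 2 * pi * u.
have pi0 := pi_gt0 R.
have c0 : 0 < c by rewrite !mulr_gt0.
have D0 : c ^+ 2 + d ^+ 2 != 0 by rewrite gt_eqF// ltr_wpDr ?sqr_ge0// exprn_gt0.
have intf : mu.-integrable setT (EFin \o
    (fun w => expR (- (c * `|w|)) * cos (2 * pi * w * u))).
  rewrite /comp; under eq_fun do rewrite mulrC.
  apply: (integrable_bounded_mul (M := 1) (integrable_exp_abs c0)).
    by apply: measurable_cos_comp; apply: measurable_funM => //; exact: measurable_funM.
  by move=> x; exact: norm_cos_le1.
pose f0 w := 2 * (expR (- (c * w)) * cos (d * w)).
(* A primitive of f0 that vanishes at infinity. *)
pose F w := expR (- (c * w)) * (2 * (d * sin (d * w) - c * cos (d * w)) / (c ^+ 2 + d ^+ 2)).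
have dF (x : R) : is_derive x 1 F (f0 x).
  have dc := is_derive_cos_comp (is_derive_lin d x).
  have ds := is_derive_sin_comp (is_derive_lin d x).
  have d1 := is_derive_add (is_derive_mul (is_derive_const d x) ds)
    (is_derive_mul (is_derive_const (- c) x) dc).
  have := is_derive_mul (is_derive_exp_lin c x)
    (is_derive_mul (is_derive_mul (is_derive_const 2 x) d1)
                   (is_derive_const (c ^+ 2 + d ^+ 2)^-1 x)).
  rewrite /F; under [in X in X -> _]eq_fun do rewrite mulNr.
  move=> /is_derive_eq; apply; rewrite /f0.
  by move: D0; clear; move: (expR _) (cos _) (sin _) => e co si D0; field.
have cF := is_derive_continuous dF.
have cf0 : continuous f0.
  have df0 (x : R) : is_derive x 1 f0 _ := is_derive_mul (is_derive_const 2 x)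
    (is_derive_mul (is_derive_exp_lin c x) (is_derive_cos_comp (is_derive_lin d x))).
  exact: (is_derive_continuous df0).
rewrite integral_fold//.
transitivity (\int[mu]_(x in `[0, +oo[) f0 x).
  apply: eq_Rintegral; move=> w /set_mem; rewrite /= in_itv/= andbT => w0.
  rewrite normrN ger0_norm// /f0 !mulrN !mulNr cosN.
  by rewrite (_ : 2 * pi * w * u = d * w) ?/d; ring.
rewrite (@integral_halfline_FTC _ f0 F 0)//.
- rewrite /F !mulr0 oppr0 expR0 sin0 cos0 /poisson /c /d.
  have D1 : b ^+ 2 + u ^+ 2 != 0 by rewrite gt_eqF// ltr_wpDr ?sqr_ge0// exprn_gt0.
  move: D0 D1; rewrite /c /d; move: pi0; clear; move: (pi : R) => P P0 D0 D1.
  by field; rewrite D1 D0 gt_eqF.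
- have h : mu.-integrable `[0, +oo[ (EFin \o (fun w => expR (- (c * `|w|)) * cos (2 * pi * w * u))).
    by apply: integrableS intf => //; exact: measurable_itv.
  have mp : measurable (`[0, +oo[%classic : set (measurableTypeR R)).
    exact: measurable_itv.
  have := integrableZl mp 2 h; apply: eq_integrable => //.
  move=> w /set_mem; rewrite /= in_itv/= andbT => w0.
  by rewrite -EFinM ger0_norm// /f0 (_ : 2 * pi * w * u = d * w) ?/d//; ring.
- have Mb (w : R) : `|2 * (d * sin (d * w) - c * cos (d * w)) / (c ^+ 2 + d ^+ 2)| <=
     2 * (`|d| + `|c|) / `|c ^+ 2 + d ^+ 2|.
    rewrite normrM normfV ler_wpM2r ?invr_ge0// normrM ger0_norm// ler_wpM2l//.
    rewrite (le_trans (ler_normB _ _))// !normrM lerD//.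
      by rewrite ler_piMr// norm_sin_le1.
    by rewrite ler_piMr// norm_cos_le1.
  apply: norm_cvg0.
  apply: (@squeeze_cvgr _ _ _ _ (fun=> 0) (fun w => expR (- (c * w)) * (2 * (`|d| + `|c|) / `|c ^+ 2 + d ^+ 2|))).
  + apply: nearW => w; rewrite normr_ge0/= /F normrM ger0_norm ?expR_ge0// ler_wpM2l ?expR_ge0//.
  + exact: cvg_cst.
  + rewrite -[X in _ --> X](mul0r (2 * (`|d| + `|c|) / `|c ^+ 2 + d ^+ 2|)).
    by apply: cvgM; [exact: cvg_exp_lin|exact: cvg_cst].
Unshelve. all: by end_near. Qed.

Lemma poisson_gt0 (b u : R) : 0 < b -> 0 < poisson b u.
Proof.
move=> b0; rewrite divr_gt0// mulr_gt0 ?pi_gt0//.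
by rewrite ltr_wpDr ?sqr_ge0// exprn_gt0.
Qed.

Lemma poisson_scale (b v : R) : 0 < b -> b * poisson b (b * v) = poisson 1 v.
Proof.
move=> b0; have := pi_gt0 R; rewrite /poisson; move: (pi : R) => P P0.
have v0 : 1 + v ^+ 2 != 0 by rewrite gt_eqF// ltr_wpDr ?sqr_ge0.
have bv0 : b ^+ 2 + (b * v) ^+ 2 != 0.
  by rewrite gt_eqF// ltr_wpDr ?sqr_ge0// exprn_gt0.
by field; rewrite bv0 v0 !gt_eqF.
Qed.

Lemma poissonN (b v : R) : poisson b (- v) = poisson b v.
Proof. by rewrite /poisson sqrrN. Qed.

Lemma continuous_poisson (b : R) : 0 < b -> continuous (poisson b).
Proof.
move=> b0 x; rewrite /poisson; apply: cvgM; first exact: cvg_cst.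
apply: cvgV.
  by rewrite gt_eqF// mulr_gt0 ?pi_gt0// ltr_wpDr ?sqr_ge0// exprn_gt0.
apply: cvgM; first exact: cvg_cst.
by apply: cvgD; [exact: cvg_cst|exact: exprn_continuous].
Qed.

Lemma measurable_poisson (b : R) : 0 < b -> measurable_fun setT (poisson b).
Proof. by move=> b0; apply: continuous_measurable_fun; exact: continuous_poisson. Qed.

Lemma integral_poisson1 : (\int[mu]_s (poisson 1 s)%:E = 1)%E.
Proof.
rewrite ge0_symfun_integralT//=; last 3 first.
- by move=> x; apply/ltW/poisson_gt0.
- exact: continuous_poisson.
- by move=> x; rewrite /= poissonN.
rewrite (_ : [set x | _] = `[0, +oo[%classic); last first.
  by apply/seteqP; split => x/=; rewrite in_itv/= andbT.
under eq_integral.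
  move=> x _; rewrite /poisson expr1n invfM mul1r EFinM.
  over.
rewrite ge0_integralZl_EFin//=.
- rewrite integral0y_oneDsqr -!EFinM; congr EFin.
  by have := pi_gt0 R; move: (pi : R) => P P0; field; rewrite gt_eqF.
- by move=> x _; rewrite lee_fin invr_ge0 addr_ge0// sqr_ge0.
- apply/measurable_EFinP/measurable_funTS.
  by apply: continuous_measurable_fun; exact: continuous_oneDsqrV.
- by rewrite invr_ge0 pi_ge0.
Qed.

Lemma integral_poisson (b t : R) : 0 < b ->
  (\int[mu]_s (poisson b (t - s))%:E = 1)%E.
Proof.
move=> b0; have mp : measurable_fun setT (fun s : measurableTypeR R => poisson b (t - s)).
  by apply: measurableT_comp (measurable_poisson b0) _; exact: measurable_funB.
rewrite (@ge0_integral_affine _ b t (fun s => (poisson b (t - s))%:E))//; last 2 first.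
- exact/measurable_EFinP.
- by move=> s; rewrite lee_fin ltW// poisson_gt0.
rewrite -ge0_integralZl_EFin//.
- rewrite -[RHS]integral_poisson1; apply: eq_integral => v _.
  by rewrite -EFinM opprD addrCA subrr addr0 poissonN poisson_scale.
- by move=> s _; rewrite lee_fin ltW// poisson_gt0.
- apply/measurable_EFinP.
  by apply: (measurableT_comp mp); exact: measurable_affine.
- exact: ltW.
Qed.

(** Unit mass in the other variable: both normalizations together make
    convolution with the Poisson kernel a contraction of L^2. *)
Lemma integral_poissonC (b s : R) : 0 < b ->
  (\int[mu]_t (poisson b (t - s))%:E = 1)%E.
Proof.
move=> b0; rewrite -(integral_poisson s b0); apply: eq_integral => t _.
by congr EFin; rewrite /poisson -(sqrrN (t - s)) opprB.
Qed.

(** The damping factor makes the triple integral in (w, t, s) absolutely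
    convergent, so Fubini's theorem applies twice; the integral in w is then the
    Poisson kernel, because cos a cos b + sin a sin b = cos (a - b). *)
Lemma integral_regularized (b : R) (f g : R -> R) : 0 < b ->
  mu.-integrable setT (EFin \o f) -> mu.-integrable setT (EFin \o g) ->
  mu.-integrable setT (fun w => (expR (- (2 * pi * b * `|w|)) *
     (cosT f w * cosT g w + sinT f w * sinT g w))%:E) /\
  \int[mu]_w (expR (- (2 * pi * b * `|w|)) *
     (cosT f w * cosT g w + sinT f w * sinT g w)) =
  \int[mu]_t (f t * \int[mu]_s (poisson b (t - s) * g s)).
Proof.
move=> b0 intf intg.
have mf := integrable_measurable intf; have mg := integrable_measurable intg.
have c0 : 0 < 2 * pi * b by rewrite !mulr_gt0// pi_gt0.
pose E (w : R) := expR (- (2 * pi * b * `|w|)).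
have intE : mu.-integrable setT (EFin \o E) := integrable_exp_abs c0.
have mE := integrable_measurable intE.
have E0 w : 0 <= E w by exact: expR_ge0.
have boundc (h : R -> R) w : mu.-integrable setT (EFin \o h) ->
    `|cosT h w| <= \int[mu]_t `|h t|.
  move=> inth; apply: le_trans (le_normr_Rintegral _ _) _ => //.
    exact: integrable_cosT.
  apply: le_Rintegral => //.
  - by apply: integrable_norm; exact: integrable_cosT.
  - exact: integrable_norm.
  - by move=> t _; rewrite normrM ler_piMl// norm_cos_le1.
have bounds (h : R -> R) w : mu.-integrable setT (EFin \o h) ->
    `|sinT h w| <= \int[mu]_t `|h t|.
  move=> inth; apply: le_trans (le_normr_Rintegral _ _) _ => //.
    exact: integrable_sinT.
  apply: le_Rintegral => //.
  - by apply: integrable_norm; exact: integrable_sinT.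
  - exact: integrable_norm.
  - by move=> t _; rewrite normrM ler_piMl// norm_sin_le1.
set N := \int[mu]_t `|g t| in boundc bounds *.
pose G w t := cos (2 * pi * w * t) * cosT g w + sin (2 * pi * w * t) * sinT g w.
have GE w t : G w t = \int[mu]_s (cos (2 * pi * w * (t - s)) * g s).
  rewrite /G /cosT /sinT -!RintegralZl//; [|exact: integrable_sinT|exact: integrable_cosT].
  rewrite -RintegralD//.
  - by apply: eq_Rintegral => s _; rewrite mulrBr cosB; ring.
  - exact: integrableZl (integrable_cosT _ intg).
  - exact: integrableZl (integrable_sinT _ intg).
have Gb w t : `|G w t| <= N + N.
  rewrite (le_trans (ler_normD _ _))// !normrM lerD//.
    by rewrite (le_trans _ (boundc g w intg))// ler_piMl// norm_cos_le1.
  by rewrite (le_trans _ (bounds g w intg))// ler_piMl// norm_sin_le1.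
have HE w : cosT f w * cosT g w + sinT f w * sinT g w = \int[mu]_t (G w t * f t).
  rewrite /G /cosT -/(cosT g w) /sinT -/(sinT g w) -!RintegralZr//; [|exact: integrable_sinT|exact: integrable_cosT].
  rewrite -RintegralD//.
  - by apply: eq_Rintegral => s _; ring.
  - exact: integrableZr (integrable_cosT _ intf).
  - exact: integrableZr (integrable_sinT _ intf).
have mG : measurable_fun setT (fun z : measurableTypeR R * measurableTypeR R => G z.1 z.2).
  have m1 : measurable_fun setT (fun z : measurableTypeR R * measurableTypeR R =>
      2 * pi * z.1 * z.2).
    by apply: measurable_funM => //; apply: measurable_funM.
  apply: measurable_funD; apply: measurable_funM.
  - exact: measurable_cos_comp.
  - exact: (measurableT_comp (measurable_cosT mg) measurable_fst).
  - exact: measurable_sin_comp.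
  - exact: (measurableT_comp (measurable_sinT mg) measurable_fst).
split.
  under eq_fun do rewrite mulrC.
  apply: (integrable_bounded_mul (M := (\int[mu]_t `|f t|) * N + (\int[mu]_t `|f t|) * N) intE).
    apply: measurable_funD; apply: measurable_funM.
    - exact: measurable_cosT.
    - exact: measurable_cosT.
    - exact: measurable_sinT.
    - exact: measurable_sinT.
  move=> w; rewrite (le_trans (ler_normD _ _))// !normrM lerD//.
    by apply: ler_pM; rewrite ?normr_ge0//; [exact: boundc|exact: boundc].
  by apply: ler_pM; rewrite ?normr_ge0//; [exact: bounds|exact: bounds].
transitivity (\int[mu]_w \int[mu]_t (E w * (G w t * f t))).
  apply: eq_Rintegral => w _; rewrite HE RintegralZl//.
  apply: (integrable_bounded_mul (M := N + N)) => //.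
  exact: (measurableT_comp mG (measurable_pair1 w)).
rewrite (@fubini_product _ _ (fun w => (N + N) * E w) (fun t => `|f t|)); last 4 first.
- apply: measurable_funM; first exact: (measurableT_comp mE measurable_fst).
  by apply: measurable_funM => //; exact: (measurableT_comp mf measurable_snd).
- move=> w t; rewrite !normrM (ger0_norm (E0 w)) [X in _ <= X]mulrAC mulrA mulrC.
  by rewrite [E w * _]mulrC mulrA ler_wpM2r// mulrC ler_wpM2r.
- exact: (integrableZl _ (N + N) intE).
- exact: integrable_norm.
apply: eq_Rintegral => t _.
transitivity (\int[mu]_w (f t * (E w * G w t))).
  by apply: eq_Rintegral => w _; ring.
rewrite RintegralZl//; last first.
  under eq_fun do rewrite mulrC.
  apply: (integrable_bounded_mul (M := N + N) intE) => //.
  exact: (measurableT_comp mG (measurable_pair2 t)).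
congr (_ * _).
transitivity (\int[mu]_w \int[mu]_s (E w * (cos (2 * pi * w * (t - s)) * g s))).
  apply: eq_Rintegral => w _; rewrite GE RintegralZl//.
  apply: (integrable_bounded_mul (M := 1)) => //.
    by apply: measurable_cos_comp; apply: measurable_funM => //; exact: measurable_funB.
  by move=> x; exact: norm_cos_le1.
rewrite (@fubini_product _ _ E (fun t => `|g t|))//; last 3 first.
- apply: measurable_funM; first exact: (measurableT_comp mE measurable_fst).
  apply: measurable_funM; last exact: (measurableT_comp mg measurable_snd).
  apply: measurable_cos_comp; apply: measurable_funM => //.
    exact: measurable_funM.
  exact: measurable_funB.
- move=> w s; rewrite !normrM (ger0_norm (E0 w)) ler_wpM2l//.
  by rewrite ler_piMl// norm_cos_le1.
- exact: integrable_norm.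
apply: eq_Rintegral => s _.
rewrite -(integral_exp_cos _ b0) -RintegralZr//.
  by apply: eq_Rintegral => w _; rewrite mulrA.
under eq_fun do rewrite mulrC.
apply: (integrable_bounded_mul (M := 1) intE).
  by apply: measurable_cos_comp; apply: measurable_funM => //; exact: measurable_funM.
by move=> x; exact: norm_cos_le1.
Qed.

(** Since 2 |f g| <= f^2 + g^2. *)
Lemma sqintegrable_mul (f g : R -> R) : sqintegrable f -> sqintegrable g ->
  mu.-integrable setT (fun x => (f x * g x)%:E).
Proof.
move=> [mf f2] [mg g2].
have := integrableD measurableT f2 g2; apply: le_integrable => //.
  by apply/measurable_EFinP; exact: measurable_funM.
move=> x _ /=; rewrite lee_fin [X in _ <= X]ger0_norm ?addr_ge0 ?sqr_ge0// normrM.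
rewrite -(real_normK (num_real (f x))) -(real_normK (num_real (g x))).
have := sqr_ge0 (`|f x| - `|g x|); have := normr_ge0 (f x); have := normr_ge0 (g x).
move: `|f x| `|g x| => a b; nra.
Qed.

Lemma sqintegrableD (f g : R -> R) : sqintegrable f -> sqintegrable g ->
  sqintegrable (fun x => f x + g x).
Proof.
move=> hf hg; have [mf f2] := hf; have [mg g2] := hg.
split; first exact: measurable_funD.
have fg := integrableZl measurableT 2 (sqintegrable_mul hf hg).
have := integrableD measurableT (integrableD measurableT f2 g2) fg.
by apply: eq_integrable => // x _; rewrite /= -!EFinD; congr EFin; ring.
Qed.

Lemma sqintegrableZ (c : R) (f : R -> R) : sqintegrable f ->
  sqintegrable (fun x => c * f x).
Proof.
move=> [mf f2]; split; first exact: measurable_funM.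
have := integrableZl measurableT (c ^+ 2) f2.
by apply: eq_integrable => // x _; rewrite /= -!EFinM exprMn.
Qed.

Lemma sqintegrableB (f g : R -> R) : sqintegrable f -> sqintegrable g ->
  sqintegrable (fun x => f x - g x).
Proof.
move=> hf hg; have := sqintegrableD hf (sqintegrableZ (-1) hg).
by rewrite (_ : (fun x => f x - g x) = (fun x => f x + -1 * g x))//; apply/funext => x; ring.
Qed.

(** Extended-real valued on the right: the bound is also used where the
    integrability of h is unknown, the left-hand side being then 0. *)
Lemma Rintegral_abs_le (h : R -> R) : measurable_fun setT h ->
  (`|\int[mu]_x h x|%:E <= \int[mu]_x `|h x|%:E)%E.
Proof.
move=> mh; have mh' : measurable_fun setT (EFin \o h) by exact/measurable_EFinP.
have [fin|] := ltP (\int[mu]_x `|h x|%:E)%E +oo%E; last first.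
  by rewrite leye_eq => /eqP ->; rewrite leey.
have inth : mu.-integrable setT (EFin \o h) by apply/integrableP.
by rewrite EFin_normr_Rintegral//; exact: le_abse_integral.
Qed.

(** Schur's test: |f t f s| <= (f t^2 + f s^2) / 2, and the Poisson kernel has
    integral 1 in each variable. *)
Lemma regularized_spectrum_le (b : R) (f : R -> R) : 0 < b ->
  mu.-integrable setT (EFin \o f) -> sqintegrable f ->
  (\int[mu]_w (expR (- (2 * pi * b * `|w|)) * spectrum f w)%:E <=
   \int[mu]_t (f t ^+ 2)%:E)%E.
Proof.
move=> b0 intf [mf f2].
have [intS eqS] := integral_regularized b0 intf intf.
rewrite (_ : (\int[mu]_w _ = (\int[mu]_t (f t * \int[mu]_s (poisson b (t - s) * f s)))%:E)%E); last first.
  rewrite -eqS fineK; first by apply: eq_integral => w _; rewrite /spectrum !expr2.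
  exact: integrable_fin_num.
have mp : measurable_fun setT (fun z : measurableTypeR R * measurableTypeR R => poisson b (z.1 - z.2)).
  apply: measurableT_comp (measurable_poisson b0) _; exact: measurable_funB.
have mf1 : measurable_fun setT (fun z : measurableTypeR R * measurableTypeR R => f z.1).
  exact: (measurableT_comp mf measurable_fst).
have mf2 : measurable_fun setT (fun z : measurableTypeR R * measurableTypeR R => f z.2).
  exact: (measurableT_comp mf measurable_snd).
have p0 u : 0 <= poisson b u by apply/ltW/poisson_gt0.
pose A (z : measurableTypeR R * measurableTypeR R) := (2^-1 * f z.1 ^+ 2 * poisson b (z.1 - z.2))%:E.
pose B (z : measurableTypeR R * measurableTypeR R) := (2^-1 * f z.2 ^+ 2 * poisson b (z.1 - z.2))%:E.
have A0 z : (0 <= A z)%E by rewrite lee_fin mulr_ge0// mulr_ge0 ?sqr_ge0.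
have B0 z : (0 <= B z)%E by rewrite lee_fin mulr_ge0// mulr_ge0 ?sqr_ge0.
have mA : measurable_fun setT A.
  apply/measurable_EFinP; apply: measurable_funM => //; apply: measurable_funM => //.
  exact: measurable_funX.
have mB : measurable_fun setT B.
  apply/measurable_EFinP; apply: measurable_funM => //; apply: measurable_funM => //.
  exact: measurable_funX.
have IA : (\int[mu]_t \int[mu]_s A (t, s) = \int[mu]_t (2^-1 * f t ^+ 2)%:E)%E.
  apply: eq_integral => t _; rewrite /A/=.
  under eq_integral do rewrite EFinM.
  rewrite ge0_integralZl_EFin ?integral_poisson ?mule1//.
  - by move=> s _; rewrite lee_fin.
  - apply/measurable_EFinP; exact: (measurableT_comp mp (measurable_pair1 t)).
  - by rewrite mulr_ge0 ?sqr_ge0.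
have IB : (\int[mu]_t \int[mu]_s B (t, s) = \int[mu]_t (2^-1 * f t ^+ 2)%:E)%E.
  rewrite (@fubini_tonelli _ _ _ _ _ mu mu B mB B0).
  apply: eq_integral => t _; rewrite /B/=.
  under eq_integral do rewrite EFinM.
  rewrite ge0_integralZl_EFin ?integral_poissonC ?mule1//.
  - by move=> s _; rewrite lee_fin.
  - apply/measurable_EFinP; exact: (measurableT_comp mp (measurable_pair2 t)).
  - by rewrite mulr_ge0 ?sqr_ge0.
have half : (\int[mu]_t (f t ^+ 2)%:E = \int[mu]_t (2^-1 * f t ^+ 2)%:E + \int[mu]_t (2^-1 * f t ^+ 2)%:E)%E.
  have m2 : measurable_fun setT (fun t => (2^-1 * f t ^+ 2)%:E).
    by apply/measurable_EFinP; apply: measurable_funM => //; exact: measurable_funX.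
  rewrite -ge0_integralD//; last 2 first.
  - by move=> t _; rewrite lee_fin mulr_ge0 ?sqr_ge0.
  - by move=> t _; rewrite lee_fin mulr_ge0 ?sqr_ge0.
  by apply: eq_integral => t _; rewrite -EFinD; congr EFin; field.
rewrite half -[X in (_ <= X + _)%E]IA -[X in (_ <= _ + X)%E]IB.
rewrite -ge0_integralD//; last 4 first.
- by move=> t _; exact: integral_ge0.
- exact: (measurable_integral_ge0 mA A0).
- by move=> t _; exact: integral_ge0.
- exact: (measurable_integral_ge0 mB B0).
pose G t := \int[mu]_s (poisson b (t - s) * f s).
have mG : measurable_fun setT G.
  by apply: measurable_integral_param; exact: measurable_funM.
apply: (@le_trans _ _ (\int[mu]_t `|(f t * G t)%:E|)%E).
  apply: le_trans (Rintegral_abs_le _); first by rewrite lee_fin ler_norm.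
  exact: measurable_funM.
apply: ge0_le_integral => //.
- by apply/measurable_EFinP; apply: measurableT_comp => //; exact: measurable_funM.
- apply: emeasurable_funD.
    exact: (measurable_integral_ge0 mA A0).
  exact: (measurable_integral_ge0 mB B0).
move=> t _.
have mpt : measurable_fun setT (fun s : R => poisson b (t - s)).
  exact: (measurableT_comp mp (measurable_pair1 t)).
have mAt : measurable_fun setT (fun s => A (t, s)).
  exact: (measurableT_comp mA (measurable_pair1 t)).
have mBt : measurable_fun setT (fun s => B (t, s)).
  exact: (measurableT_comp mB (measurable_pair1 t)).
rewrite -ge0_integralD//.
rewrite abse_EFin normrM EFinM.
have mh : measurable_fun setT (fun s : R => poisson b (t - s) * f s) by exact: measurable_funM.
apply: (@le_trans _ _ (`|f t|%:E * \int[mu]_s `|poisson b (t - s) * f s|%:E)%E).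
  by rewrite lee_wpmul2l//; exact: Rintegral_abs_le.
rewrite -ge0_integralZl_EFin//; last first.
  by apply/measurable_EFinP; exact: measurableT_comp.
apply: ge0_le_integral => //.
- by apply/measurable_EFinP; apply: measurable_funM => //; exact: measurableT_comp.
- exact: emeasurable_funD.
move=> s _; rewrite /A /B /= -EFinM -EFinD lee_fin normrM ger0_norm//.
rewrite -(real_normK (num_real (f t))) -(real_normK (num_real (f s))).
have := p0 (t - s); have := sqr_ge0 (`|f t| - `|f s|).
move: `|f t| `|f s| (poisson _ _) => x y p h1 h2; nra.
Qed.

End Plancherel.

(** * Plancherel's identity for real functions *)
Section PlancherelIdentity.
Variable R : realType.
Local Notation mu := (@lebesgue_measure R).

(** Monotone convergence, as the damping factor increases to 1. *)
Lemma spectrum_le (f : R -> R) :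
  mu.-integrable setT (EFin \o f) -> sqintegrable f ->
  (\int[mu]_w (spectrum f w)%:E <= \int[mu]_t (f t ^+ 2)%:E)%E.
Proof.
move=> intf sqf; have mf := integrable_measurable intf.
pose b n : R := n.+1%:R^-1.
have b0 n : 0 < b n by rewrite invr_gt0.
have pi0 := pi_gt0 R.
pose F n w := (expR (- (2 * pi * b n * `|w|)) * spectrum f w)%:E.
have mF n : measurable_fun setT (F n).
  apply/measurable_EFinP; apply: measurable_funM; last exact: measurable_spectrum.
  by have /integrable_measurable := integrable_exp_abs (c := 2 * pi * b n) ltac:(by rewrite !mulr_gt0).
have F0 n w : setT w -> (0 <= F n w)%E.
  by move=> _; rewrite lee_fin mulr_ge0 ?expR_ge0 ?spectrum_ge0.
have ndF w : setT w -> {homo F^~ w : m n / (m <= n)%N >-> (m <= n)%E}.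
  move=> _ m n mn; rewrite lee_fin ler_wpM2r ?spectrum_ge0// ler_expR lerN2.
  apply: ler_wpM2r => //; apply: ler_wpM2l; first by rewrite mulr_ge0// ltW.
  by rewrite /b lef_pV2 ?posrE// ler_nat ltnS.
have cF w : setT w -> F n w @[n --> \oo] --> (spectrum f w)%:E.
  move=> _; apply/fine_cvgP; split; first exact: nearW.
  have e1 : expR (- (2 * pi * 0 * `|w|)) = 1 by rewrite mulr0 mul0r oppr0 expR0.
  rewrite /= -[X in _ --> X]mul1r -e1.
  apply: cvgM; last exact: cvg_cst.
  apply: continuous_cvg; first exact: continuous_expR.
  apply: cvgN; apply: cvgM; last exact: cvg_cst.
  by apply: cvgM; [exact: cvg_cst|exact: cvg_harmonic].
have cv := @cvg_monotone_convergence _ (measurableTypeR R) R mu setT measurableT F mF F0 ndF.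
rewrite (_ : (\int[mu]_w (spectrum f w)%:E)%E = limn (fun n => \int[mu]_w F n w)%E); last first.
  rewrite -monotone_convergence//; apply: eq_integral => w _.
  by apply/esym/cvg_lim => //; exact: cF.
apply: lime_le; first by apply/cvg_ex; eexists; exact: cv.
by apply: nearW => n; exact: regularized_spectrum_le.
Qed.

(** After the change of variable s = b v + t the mass of the Poisson kernel no
    longer moves, and dominated convergence applies in v and then in t. *)
Lemma poisson_mollify (f g : R -> R) (M : R) :
  mu.-integrable setT (EFin \o f) -> mu.-integrable setT (EFin \o g) ->
  continuous g -> (forall x, `|g x| <= M) ->
  \int[mu]_t (f t * \int[mu]_s (poisson (n.+1%:R^-1) (t - s) * g s)) @[n --> \oo] -->
  \int[mu]_t (f t * g t).
Proof.
move=> intf intg cg gM.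
have mf := integrable_measurable intf; have mg := integrable_measurable intg.
pose b n : R := n.+1%:R^-1.
have b0 n : 0 < b n by rewrite invr_gt0.
have p0 c u : 0 < c -> 0 <= poisson c u :> R by move=> c0; apply/ltW/poisson_gt0.
have intp : mu.-integrable setT (EFin \o poisson 1).
  apply/integrableP; split; first by apply/measurable_EFinP; exact: measurable_poisson.
  under eq_integral do rewrite /= ger0_norm ?p0//.
  by rewrite integral_poisson1 ltry.
have p1 : \int[mu]_v poisson 1 v = 1 by rewrite /Rintegral integral_poisson1.
pose H n t := \int[mu]_v (poisson 1 v * g (b n * v + t)).
have HE n t : \int[mu]_s (poisson (b n) (t - s) * g s) = H n t.
  have bp (u : R) : `|poisson (b n) u| <= b n / (pi * b n ^+ 2).
    rewrite ger0_norm ?p0// /poisson; apply: ler_wpM2l; first exact: ltW.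
    rewrite lef_pV2 ?posrE.
    - by rewrite ler_pM2l ?pi_gt0// lerDl sqr_ge0.
    - by rewrite mulr_gt0 ?pi_gt0// ltr_wpDr ?sqr_ge0// exprn_gt0.
    - by rewrite mulr_gt0 ?pi_gt0// exprn_gt0.
  have [||ia ->] := @integral_affine _ (b n) t (fun s => poisson (b n) (t - s) * g s).
  - exact: b0.
  - apply: (integrable_bounded_mul intg _ (fun s => bp (t - s))).
    by apply: measurableT_comp (measurable_poisson (b0 n)) _; exact: measurable_funB.
  rewrite -RintegralZl//.
  apply: eq_Rintegral => v _; rewrite mulrA; congr (_ * _).
  by rewrite opprD addrCA subrr addr0 poissonN poisson_scale.
have gbM n t v : `|poisson 1 v * g (b n * v + t)| <= M * poisson 1 v.
  by rewrite normrM ger0_norm ?p0// mulrC ler_wpM2r ?p0.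
have mgb n t : measurable_fun setT (fun v : R => poisson 1 v * g (b n * v + t)).
  apply: measurable_funM; first exact: measurable_poisson.
  exact: (measurableT_comp mg (measurable_affine (b n) t)).
have intMp : mu.-integrable setT (EFin \o (fun v => M * poisson 1 v)).
  exact: (integrableZl measurableT M intp).
have Hc t : H n t @[n --> \oo] --> g t.
  rewrite -[g t]mul1r -p1 -RintegralZr//.
  apply: (dominated_Rintegral _ _ _ intMp (fun n v => gbM n t v)).2 => //.
  - by move=> n; exact: mgb.
  - by apply: measurable_funM => //; exact: measurable_poisson.
  - apply: aeW => v; apply: cvgM; first exact: cvg_cst.
    apply: continuous_cvg; first exact: cg.
    rewrite -[X in _ --> X]add0r -[X in X + _](mul0r v).
    by apply: cvgD; [apply: cvgM; [exact: cvg_harmonic|exact: cvg_cst]|exact: cvg_cst].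
have HM n t : `|H n t| <= M.
  have intn : mu.-integrable setT (EFin \o (fun v => poisson 1 v * g (b n * v + t))).
    apply: le_integrable intMp => //; first by apply/measurable_EFinP; exact: mgb.
    by move=> v _; rewrite lee_fin (le_trans (gbM n t v))// ler_norm.
  rewrite (le_trans (le_normr_Rintegral _ intn))//.
  rewrite [leRHS](_ : M = \int[mu]_v (M * poisson 1 v)).
    by apply: le_Rintegral => //; exact: integrable_norm.
  by rewrite RintegralZl// p1 mulr1.
have mH n : measurable_fun setT (H n).
  apply: measurable_integral_param; apply: measurable_funM.
    exact: (measurableT_comp (measurable_poisson ltr01) measurable_snd).
  apply: (measurableT_comp mg); apply: measurable_funD => //.
  exact: measurable_funM.
under eq_cvg => n do under eq_Rintegral => t _ do rewrite HE.
have [|||||_ cv] := @dominated_Rintegral R _ _ mu (fun n t => f t * H n t)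
  (fun t => f t * g t) (fun t => M * `|f t|).
- by move=> n; exact: (measurable_funM mf (mH n)).
- exact: (measurable_funM mf mg).
- by apply: aeW => t; apply: cvgM; [exact: cvg_cst|exact: Hc].
- exact: (integrableZl measurableT M (integrable_norm intf)).
- by move=> n t; rewrite normrM mulrC ler_wpM2r.
exact: cv.
Qed.

Lemma integrable_spectrum (f : R -> R) :
  mu.-integrable setT (EFin \o f) -> sqintegrable f ->
  mu.-integrable setT (fun w => (spectrum f w)%:E).
Proof.
move=> intf sqf; have mf := integrable_measurable intf.
apply/integrableP; split; first by apply/measurable_EFinP; exact: measurable_spectrum.
under eq_integral do rewrite /= ger0_norm ?spectrum_ge0//.
apply: le_lt_trans (spectrum_le intf sqf) _.
have [_ /integrableP[_]] := sqf.
by under eq_integral do rewrite /= ger0_norm ?sqr_ge0//.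
Qed.

Lemma spectrum_le_Rintegral (f : R -> R) :
  mu.-integrable setT (EFin \o f) -> sqintegrable f ->
  \int[mu]_w spectrum f w <= \int[mu]_t f t ^+ 2.
Proof.
move=> intf sqf; rewrite /Rintegral fine_le//.
- by apply: integrable_fin_num => //; exact: integrable_spectrum.
- by apply: integrable_fin_num => //; exact: sqf.2.
- exact: spectrum_le.
Qed.

(** The reverse inequality in dual form.  In the limit of vanishing damping the
    pairing of the transforms of f and g tends to the integral of f g; the
    inequality 2 (a c + d k) <= (a^2 + d^2) + (c^2 + k^2) between transforms and
    the upper bound for the spectrum of g then suffice. *)
Lemma spectrum_ge_test (f g : R -> R) (M : R) :
  mu.-integrable setT (EFin \o f) -> sqintegrable f ->
  mu.-integrable setT (EFin \o g) -> sqintegrable g ->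
  continuous g -> (forall x, `|g x| <= M) ->
  \int[mu]_t (2 * (f t * g t)) <= \int[mu]_w spectrum f w + \int[mu]_t g t ^+ 2.
Proof.
move=> intf sqf intg sqg cg gM.
rewrite RintegralZl//; last exact: sqintegrable_mul.
have cv : 2 * \int[mu]_t (f t * \int[mu]_s (poisson (n.+1%:R^-1) (t - s) * g s)) @[n --> \oo] -->
    2 * \int[mu]_t (f t * g t).
  by apply: cvgM; [exact: cvg_cst|exact: poisson_mollify gM].
rewrite -(cvg_lim _ cv)//; apply: limr_le; first by apply/cvg_ex; eexists; exact: cv.
apply: nearW => n.
have b0 : 0 < n.+1%:R^-1 :> R by rewrite invr_gt0.
have [intE <-] := integral_regularized b0 intf intg.
rewrite (le_trans _ (lerD (lexx _) (spectrum_le_Rintegral intg sqg)))//.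
rewrite -RintegralZl// -RintegralD//; [|exact: integrable_spectrum|exact: integrable_spectrum].
apply: le_Rintegral => //.
- exact: (integrableZl measurableT 2 intE).
- exact: (integrableD measurableT (integrable_spectrum intf sqf) (integrable_spectrum intg sqg)).
move=> w _; rewrite /spectrum.
have : expR (- (2 * pi * n.+1%:R^-1 * `|w|)) <= 1.
  by rewrite expR_le1 oppr_le0 !mulr_ge0// ?pi_ge0// ltW.
have := expR_ge0 (- (2 * pi * n.+1%:R^-1 * `|w|)).
move: (expR _) (cosT f w) (cosT g w) (sinT f w) (sinT g w) => e a c d k e0 e1.
have := sqr_ge0 (a - c); have := sqr_ge0 (d - k).
have := sqr_ge0 (a + c); have := sqr_ge0 (d + k).
nra.
Qed.

Definition sqdist (f g : R -> R) : R := \int[mu]_t (f t - g t) ^+ 2.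

(** The factors 2 replace the square root of the triangle inequality. *)
Lemma sqdist_le (f g h : R -> R) : sqintegrable f -> sqintegrable g -> sqintegrable h ->
  sqdist f h <= 2 * sqdist f g + 2 * sqdist g h.
Proof.
move=> sf sg sh; have [_ fg] := sqintegrableB sf sg; have [_ gh] := sqintegrableB sg sh.
have [_ fh] := sqintegrableB sf sh.
rewrite /sqdist -!RintegralZl// -RintegralD//; last 2 first.
- exact: (integrableZl measurableT 2 fg).
- exact: (integrableZl measurableT 2 gh).
apply: le_Rintegral => //.
  exact: (integrableD measurableT (integrableZl measurableT 2 fg) (integrableZl measurableT 2 gh)).
move=> t _; have := sqr_ge0 ((f t - g t) - (g t - h t)); nra.
Qed.

(** Bounded by N and vanishing outside [- N, N]: such functions are both
    integrable and square-integrable. *)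
Definition tame_bounded (N : R) (h : R -> R) :=
  measurable_fun setT h /\ forall t, `|h t| <= N * (`|t| <= N)%R%:R.

Lemma integrable_box (N : R) : mu.-integrable setT (fun t => (N * (`|t| <= N)%R%:R)%:E).
Proof.
rewrite (_ : (fun t => _) = (fun t => N%:E * (\1_(`[- N, N]%classic) t)%:E)%E); last first.
  apply/funext => t; rewrite indicE -EFinM; congr (_ * _)%:E.
  congr (_%:R); congr nat_of_bool.
  by apply/idP/idP => [h|/set_mem]; rewrite /= ?in_itv/= -?ler_norml//;
    apply/mem_set; rewrite /= in_itv/= -ler_norml.
by apply: integrableZl => //; exact: integrable_indic_itv.
Qed.

Lemma tame_bounded_integrable (N : R) (h : R -> R) : 0 <= N -> tame_bounded N h ->
  mu.-integrable setT (EFin \o h) /\ sqintegrable h.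
Proof.
move=> N0 [mh hN].
have hN1 t : `|h t| <= N.
  by rewrite (le_trans (hN t))//; case: (`|t| <= N)%R; rewrite ?mulr1 ?mulr0.
have inth : mu.-integrable setT (EFin \o h).
  apply: le_integrable (integrable_box N) => //; first by apply/measurable_EFinP.
  by move=> t _; rewrite lee_fin (le_trans (hN t))// ler_norm.
split => //; split => //.
by apply: eq_integrable (integrable_bounded_mul inth mh hN1) => // t _; rewrite expr2.
Qed.

Lemma sqintegrable_truncate (f : R -> R) (d : R) : sqintegrable f -> 0 < d ->
  exists N h, [/\ 0 < N, tame_bounded N h & sqdist f h <= d].
Proof.
move=> [mf f2] d0.
pose h (n : nat) t := f t * ((`|t| <= n%:R) && (`|f t| <= n%:R))%R%:R.
have mh n : measurable_fun setT (h n).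
  apply: measurable_funM => //.
  rewrite (_ : (fun t => _) = \1_([set t : R | `|t| <= n%:R] `&` [set t : R | `|f t| <= n%:R])); last first.
    apply/funext => t; rewrite indicE; congr (_%:R); congr nat_of_bool.
    by rewrite in_setI; congr (_ && _); apply/idP/idP => [|/set_mem//]; exact: mem_set.
  apply/measurable_indicP; apply: measurableI.
    rewrite -[X in measurable X]setTI.
    by apply: measurable_fun_ler => //; exact: measurableT_comp.
  rewrite -[X in measurable X]setTI.
  by apply: measurable_fun_ler => //; exact: measurableT_comp.
have [|||||_] := @dominated_Rintegral R _ _ mu (fun n t => (f t - h n t) ^+ 2) (fun=> 0) (fun t => f t ^+ 2).
- by move=> n; apply: measurable_funX; exact: (measurable_funB mf (mh n)).
- by [].
- apply: aeW => t; apply: cvg_near_cst; near=> n.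
  rewrite /h (_ : _ && _ = true) ?mulr1 ?subrr ?expr0n//.
  by apply/andP; split; near: n; exact: nbhs_infty_ger.
- by [].
- move=> n t; rewrite /h ger0_norm ?sqr_ge0//.
  by case: (_ && _); rewrite ?mulr1 ?mulr0 ?subr0// subrr expr0n sqr_ge0.
rewrite Rintegral_cst// mul0r => /cvgr0_norm_le /(_ _ d0) [n _ hn].
have {}hn := hn n.+1 (leqnSn n).
exists n.+1%:R, (h n.+1); split => //.
- split => // t; rewrite /h normrM normr_nat.
  case: (`|t| <= n.+1%:R)%R; rewrite ?mulr0//= mulr1.
  by case: (boolP (`|f t| <= n.+1%:R)%R) => [h1|_]; rewrite ?mulr1// mulr0.
- by rewrite (le_trans (ler_norm _)).
Unshelve. all: by end_near. Qed.

Definition clip (N y : R) : R := Num.max (- N) (Num.min N y).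

Lemma clip_cases (N y : R) : 0 <= N ->
  [\/ clip N y = y /\ `|y| <= N, clip N y = N /\ N <= y | clip N y = - N /\ y <= - N].
Proof.
move=> N0; rewrite /clip; case: (leP N y) => Ny.
  by apply: Or32; rewrite max_r//; lra.
case: (leP (- N) y) => h; first by apply: Or31; rewrite ler_norml h ltW.
by apply: Or33; split => //; exact: ltW.
Qed.

Lemma clip_norm (N y : R) : 0 <= N -> `|clip N y| <= N /\ `|clip N y| <= `|y|.
Proof.
move=> N0; case: (clip_cases y N0) => -[-> h]; rewrite ?normrN ?(ger0_norm N0) ?lexx//.
  by split => //; rewrite (le_trans h)// ler_norm.
by split => //; rewrite -normrN (le_trans _ (ler_norm _))//; lra.
Qed.

Lemma clip_dist (N x y : R) : `|x| <= N -> `|x - clip N y| <= `|x - y|.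
Proof.
move=> xN; have N0 : 0 <= N := le_trans (normr_ge0 x) xN.
move: xN; rewrite ler_norml => /andP[h1 h2].
case: (clip_cases y N0) => -[-> h] //.
  rewrite ler0_norm; last lra.
  by rewrite [leRHS]distrC (le_trans _ (ler_norm _))//; lra.
rewrite ger0_norm; last lra.
by rewrite (le_trans _ (ler_norm _))//; lra.
Qed.

(** An L^1 approximation g_ by continuous functions is turned into an L^2 one by
    clipping its values to [- N, N], where h lives: then
    (h - g)^2 <= 2 N |h - g_|.  The factor [chi] is a continuous cut-off that
    makes the support bounded again. *)
Lemma tame_bounded_approx (N : R) (h : R -> R) (d : R) : 0 < N ->
  tame_bounded N h -> 0 < d ->
  exists g, [/\ continuous g, tame_bounded (N + 1) g & sqdist h g <= d].
Proof.
move=> N0 th d0; have [mh hN] := th; have [inth sqh] := tame_bounded_integrable (ltW N0) th.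
pose E : set (measurableTypeR R) := `[- (N + 1), N + 1]%classic.
have mE : measurable E by exact: measurable_itv.
have Efin : (mu E < +oo)%E.
  by rewrite /E lebesgue_measure_itv/=; case: ifP => _; rewrite ltry.
have [g_ [cg intg lim]] := approximation_continuous_integrable mE Efin
  (integrableS measurableT mE (@subsetT _ _) inth).
have e0 : 0 < d / (2 * N) by rewrite divr_gt0// mulr_gt0.
(* With |h - g_| of integral at most d / (2 N), the bound 2 N |h - g_| on
   (h - g)^2 has integral at most d. *)
have [n hn] : exists n, (\int[mu]_(z in E) `|(h z - g_ n z)%:E| < (d / (2 * N))%:E)%E.
  case/fine_cvgP: lim => fin /cvgr0_norm_lt /(_ _ e0) small.
  near \oo => n; exists n.
  rewrite -[X in (X < _)%E]fineK; last by near: n.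
  by rewrite lte_fin (le_lt_trans (ler_norm _))//; near: n.
pose chi (t : R) : R := Num.max 0 (Num.min 1 (N + 1 - `|t|)).
have chi01 t : 0 <= chi t <= 1.
  by rewrite /chi le_max lexx/= ge_max ler01/= ge_min lexx.
have chi1 t : `|t| <= N -> chi t = 1.
  by move=> tN; rewrite /chi min_l ?max_r//; lra.
have chi0 t : N + 1 <= `|t| -> chi t = 0.
  by move=> tN; rewrite /chi min_r ?max_l//; lra.
pose g (t : R) := chi t * clip N (g_ n t).
have cgg : continuous g.
  have cc (c : R) : continuous ((fun=> c) : R -> R) by move=> ?; exact: cvg_cst.
  have cchi : continuous chi.
    move=> t; apply: (@continuous_max R R^o (fun=> 0) (fun t : R => Num.min 1 (N + 1 - `|t|))).
      exact: cc.
    apply: (@continuous_min R R^o (fun=> 1) (fun t : R => N + 1 - `|t|)); first exact: cc.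
    by apply: cvgB; [exact: cvg_cst|exact: norm_continuous].
  move=> t; apply: cvgM; first exact: cchi.
  apply: (@continuous_max R R^o (fun=> - N) (fun t : R => Num.min N (g_ n t))).
    exact: cc.
  by apply: (@continuous_min R R^o (fun=> N) (g_ n)); [exact: cc|exact: cg].
have N1 : 0 <= N by exact: ltW.
have gn t : `|g t| <= `|clip N (g_ n t)|.
  have /andP[c0 c1] := chi01 t.
  by rewrite normrM ger0_norm// ler_piMl.
have tg : tame_bounded (N + 1) g.
  split; first exact: continuous_measurable_fun.
  move=> t; have [tN|tN] := leP `|t| (N + 1); last by rewrite /g chi0 ?mul0r ?normr0 ?mulr0// ltW.
  rewrite mulr1 (le_trans (gn t))// (le_trans (clip_norm _ N1).1)//; lra.
exists g; split => //.
have [_ [mg g2]] := tame_bounded_integrable (addr_ge0 N1 ler01) tg.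
have [_ hg2] := sqintegrableB sqh (conj mg g2).
have key t : (h t - g t) ^+ 2 <= ((fun z => 2 * N * `|h z - g_ n z|) \_ E) t.
  rewrite patchE; case: ifPn => tE; last first.
    have tN : N + 1 <= `|t|.
      rewrite leNgt; apply/negP => tN; move/negP: tE; apply; apply/mem_set.
      by rewrite /E /= in_itv/= -ler_norml ltW.
    have -> : h t = 0.
      apply/eqP; rewrite -normr_le0 (le_trans (hN t))//.
      by rewrite (_ : (`|t| <= N) = false) ?mulr0//; apply/negbTE; rewrite -ltNge; lra.
    by rewrite /g chi0// mul0r subr0 expr0n.
  have hgn : `|h t - g t| <= `|h t - g_ n t|.
    have [tN|tN] := leP `|t| N.
      rewrite /g chi1// mul1r clip_dist// (le_trans (hN t))// tN mulr1//.
    have -> : h t = 0.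
      apply/eqP; rewrite -normr_le0 (le_trans (hN t))//.
      by rewrite (lt_geF tN) mulr0.
    by rewrite !sub0r !normrN (le_trans (gn t))// (clip_norm _ N1).2.
  have hgN : `|h t - g t| <= 2 * N.
    rewrite (le_trans (ler_normB _ _))// mulr_natl mulr2n lerD//.
      by rewrite (le_trans (hN t))//; case: (`|t| <= N)%R; rewrite ?mulr1 ?mulr0.
    by rewrite (le_trans (gn t))// (clip_norm _ N1).1.
  by rewrite -real_normK ?num_real// expr2 ler_pM.
have intE : mu.-integrable E (EFin \o (fun z => `|h z - g_ n z|)).
  apply: integrable_norm.
  exact: (integrableB mE (integrableS measurableT mE (@subsetT _ _) inth) (intg n)).
have intE2 : mu.-integrable E (EFin \o (fun z => 2 * N * `|h z - g_ n z|)).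
  exact: (integrableZl mE (2 * N) intE).
rewrite /sqdist; apply: (@le_trans _ _ (\int[mu]_t ((fun z => 2 * N * `|h z - g_ n z|) \_ E) t)).
  apply: le_Rintegral => //.
  by rewrite -restrict_EFin; apply/integrable_restrict => //; rewrite setTI.
rewrite -Rintegral_mkcond RintegralZl// -ler_pdivlMl ?mulr_gt0// mulrC.
rewrite /Rintegral -lee_fin fineK ?ltW//; exact: integrable_fin_num.
Unshelve. all: by end_near. Qed.

(** Testing against g close to f in L^2 in [spectrum_ge_test] gives
    int f^2 + int g^2 - int (f - g)^2 <= int (spectrum f) + int g^2. *)
Theorem plancherel (f : R -> R) :
  mu.-integrable setT (EFin \o f) -> sqintegrable f ->
  (\int[mu]_w (spectrum f w)%:E = \int[mu]_t (f t ^+ 2)%:E)%E.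
Proof.
move=> intf sqf; apply/eqP; rewrite eq_le spectrum_le//=.
have [mf f2] := sqf.
rewrite -(fineK (integrable_fin_num _ f2))// -(fineK (integrable_fin_num _ (integrable_spectrum intf sqf)))// lee_fin.
apply/ler_addgt0Pr => e e0.
have e4 : 0 < e / 4 by rewrite divr_gt0.
have [N [h [N0 th dh]]] := sqintegrable_truncate sqf e4.
have [g [cg tg dg]] := tame_bounded_approx N0 th e4.
have [inth sqh] := tame_bounded_integrable (ltW N0) th.
have N10 : 0 <= N + 1 by rewrite addr_ge0// ltW.
have [intg sqg] := tame_bounded_integrable N10 tg.
have dfg : sqdist f g <= e.
  rewrite (le_trans (sqdist_le sqf sqh sqg))//; lra.
have gM x : `|g x| <= N + 1.
  by rewrite (le_trans (tg.2 x))//; case: (`|x| <= N + 1)%R; rewrite ?mulr1 ?mulr0.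
have := spectrum_ge_test intf sqf intg sqg cg gM.
have -> : \int[mu]_t (2 * (f t * g t)) = \int[mu]_t f t ^+ 2 + \int[mu]_t g t ^+ 2 - sqdist f g.
  have [_ fg2] := sqintegrableB sqf sqg; have [_ g2] := sqg.
  rewrite /sqdist -RintegralD// -RintegralB//; last exact: (integrableD measurableT f2 g2).
  by apply: eq_Rintegral => t _; ring.
move: dfg; rewrite /Rintegral /=; move: (fine _) (sqdist _ _) => A B; lra.
Qed.

End PlancherelIdentity.

(** * Exponential growth and Gaussian domination *)
Section Growth.
Variable R : realType.
Local Notation mu := (@lebesgue_measure R).

Section ExpGrowth.
Variables (T : Type) (D : T -> Prop) (rho : T -> R).
Hypothesis rho_ge0 : forall x, 0 <= rho x.

(** At most exponential growth in [rho], uniformly on D.  The class is closed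
    under products and sums, which makes the bounds on polynomials and on the
    derivatives of the kernel inductive; Gaussian factors absorb it
    ([gauss_absorb]). *)
Definition expgrowth (h : T -> R) : Prop :=
  exists2 K, 0 <= K & forall x, D x -> `|h x| <= expR (K * (1 + rho x)).

Lemma expgrowth_cst (c : R) : expgrowth (fun=> c).
Proof.
exists `|c| => // x _; rewrite (le_trans _ (expR_ge1Dx _))//.
by rewrite mulrDr mulr1 addrA ler_wpDr ?mulr_ge0// lerDr.
Qed.

Lemma expgrowth_rho (h : T -> R) (c : R) : 0 <= c ->
  (forall x, D x -> `|h x| <= c * (1 + rho x)) -> expgrowth h.
Proof.
move=> c0 hc; exists c => // x Dx; rewrite (le_trans (hc x Dx))//.
by rewrite (le_trans _ (expR_ge1Dx _))// lerDr.
Qed.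

Lemma expgrowthM (h k : T -> R) : expgrowth h -> expgrowth k ->
  expgrowth (fun x => h x * k x).
Proof.
move=> [K K0 hK] [L L0 kL]; exists (K + L); first exact: addr_ge0.
by move=> x Dx; rewrite normrM mulrDl expRD ler_pM// ?hK ?kL.
Qed.

Lemma expgrowthD (h k : T -> R) : expgrowth h -> expgrowth k ->
  expgrowth (fun x => h x + k x).
Proof.
move=> [K K0 hK] [L L0 kL]; exists (K + L + 1); first by rewrite !addr_ge0.
move=> x Dx; rewrite (le_trans (ler_normD _ _))//.
rewrite (le_trans (lerD (hK x Dx) (kL x Dx)))//.
have r0 : 0 <= 1 + rho x by rewrite addr_ge0.
set a := K * (1 + rho x); set b := L * (1 + rho x).
have a1 : 1 <= expR a by rewrite -expR0 ler_expR mulr_ge0.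
have b1 : 1 <= expR b by rewrite -expR0 ler_expR mulr_ge0.
have e2 : 2 <= expR (1 * (1 + rho x)).
  by rewrite (le_trans _ (expR_ge1Dx _))// mul1r; have := rho_ge0 x; lra.
rewrite !mulrDl !expRD -/a -/b.
have ab0 : 0 <= expR a * expR b by rewrite mulr_ge0 ?expR_ge0.
apply: (le_trans _ (ler_wpM2l ab0 e2)).
move: a1 b1; move: (expR a) (expR b) => u v; nra.
Qed.

Lemma expgrowthZ (c : R) (h : T -> R) : expgrowth h -> expgrowth (fun x => c * h x).
Proof. by move=> hh; apply: expgrowthM => //; exact: expgrowth_cst. Qed.

Lemma expgrowthN (h : T -> R) : expgrowth h -> expgrowth (fun x => - h x).
Proof.
by move=> [K K0 hK]; exists K => // x Dx; rewrite normrN hK.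
Qed.

End ExpGrowth.

(** The Gaussian of parameter pi leaves room for the parameter 1 of
    [gauss_fun], as pi >= 2 and K s <= K^2 + s^2 / 4. *)
Lemma gauss_absorb (K t : R) : 0 <= K ->
  expR (K * (1 + `|t|)) * expR (- (pi * t ^+ 2)) <= expR (K + K ^+ 2) * gauss_fun t.
Proof.
move=> K0; rewrite /gauss_fun -!expRD ler_expR.
have := pi_ge2 R; move: (pi : R) => P P2.
rewrite -(real_normK (num_real t)); have := normr_ge0 t; move: `|t| => s s0.
have := sqr_ge0 (K - s / 2); have := sqr_ge0 s.
nra.
Qed.

Lemma gauss_fun_Rint : \int[mu]_x gauss_fun x = Num.sqrt pi.
Proof. by rewrite /Rintegral integralT_gauss. Qed.

Lemma integrable_gauss_bounded (h : R -> R) (C : R) : measurable_fun setT h ->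
  (forall t, `|h t| <= C * gauss_fun t) -> mu.-integrable setT (EFin \o h).
Proof.
move=> mh hC; have := integrableZl measurableT C (@integrableT_gauss R).
apply: le_integrable => //; first by apply/measurable_EFinP.
by move=> t _; rewrite lee_fin (le_trans (hC t))// ler_norm.
Qed.

Lemma sqintegrable_gauss_bounded (h : R -> R) (C : R) : measurable_fun setT h ->
  (forall t, `|h t| <= C * gauss_fun t) -> sqintegrable h.
Proof.
move=> mh hC; split => //.
have inth := integrable_gauss_bounded mh hC.
have hC' t : `|h t| <= `|C|.
  rewrite (le_trans (hC t))// (le_trans (ler_wpM2r _ (ler_norm C)))//.
    exact: gauss_fun_ge0.
  by rewrite ler_piMr// gauss_fun_le1.
by apply: eq_integrable (integrable_bounded_mul inth mh hC') => // t _; rewrite expr2.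
Qed.

Lemma gauss_integral_scaled (c : R) : 0 < c ->
  \int[mu]_x expR (- (c * x ^+ 2)) = Num.sqrt (pi / c).
Proof.
move=> c0; have sc0 : 0 < Num.sqrt c by rewrite sqrtr_gt0.
have sq : Num.sqrt c ^+ 2 = c by rewrite sqr_sqrtr// ltW.
have := (@integral_affine R (Num.sqrt c) 0 gauss_fun sc0 (@integrableT_gauss R)).2.
rewrite gauss_fun_Rint sqrtrM ?pi_ge0// sqrtrV ?ltW// => ->.
rewrite mulrC mulKf ?gt_eqF//; apply: eq_Rintegral => x _.
by rewrite /gauss_fun addr0 exprMn sq.
Qed.

Lemma poly_expgrowth (p : {poly R}) :
  expgrowth (fun _ : R => True) (fun x : R => `|x|) (horner p).
Proof.
have nn (x : R) : 0 <= `|x| by exact: normr_ge0.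
have idg : expgrowth (fun _ : R => True) (fun x : R => `|x|) (fun x : R => x).
  by apply: (@expgrowth_rho R (fun _ => True) (fun x => `|x|) (fun x => x) 1 ler01) => x _;
    rewrite mul1r lerDr.
elim/poly_ind: p => [|p c IH].
  have [K K0 h] := expgrowth_cst (fun _ : R => True) nn 0.
  by exists K => // x _; rewrite horner0; exact: (h x).
have [K K0 h] := expgrowthD nn (expgrowthM IH idg) (expgrowth_cst _ nn c).
by exists K => // x _; rewrite hornerMXaddC; exact: (h x).
Qed.

Lemma poly_gauss_bound (p : {poly R}) : exists C : R,
  forall t, `|p.[t] * expR (- (pi * t ^+ 2))| <= C * gauss_fun t.
Proof.
have [K K0 hK] := poly_expgrowth p.
exists (expR (K + K ^+ 2)) => t.
rewrite normrM (ger0_norm (expR_ge0 _)) (le_trans _ (gauss_absorb t K0))//.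
by rewrite ler_wpM2r ?expR_ge0// hK.
Qed.

End Growth.

(** * Hermite polynomials and their orthogonality *)
Section Hermite.
Variable R : realType.
Local Notation mu := (@lebesgue_measure R).

(** The polynomials H_n with H_0 = 1 and
    H_(n+1) = 2 pi sqrt 2 X H_n - 2 pi n H_(n-1), that is 2^(- n/2) times the
    Hermite polynomials of the weight exp (- 2 pi t^2).  The pair carries
    H_(n-1) along, to make the recursion structural. *)
Fixpoint hermite_pair (n : nat) : {poly R} * {poly R} :=
  if n is m.+1 then
    let: (p, q) := hermite_pair m in
    ((2 * pi * Num.sqrt 2) *: ('X * p) - (2 * pi * m%:R) *: q, p)
  else (1, 0).

Definition hermite n := (hermite_pair n).1.

Lemma hermite0 : hermite 0 = 1. Proof. by []. Qed.

Lemma hermite_pairE n : (hermite_pair n.+1).2 = hermite n.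
Proof. by rewrite /hermite /=; case: (hermite_pair n). Qed.

Lemma hermiteS n : hermite n.+1 =
  (2 * pi * Num.sqrt 2) *: ('X * hermite n) - (2 * pi * n%:R) *: hermite n.-1.
Proof.
case: n => [|n]; last first.
  by rewrite -[in X in _ - X]hermite_pairE /hermite /=; case: (hermite_pair n).
by rewrite /hermite/= !mulr0 scaler0 scale0r.
Qed.

Lemma deriv_one : (1 : {poly R})^`() = 0.
Proof. by rewrite -polyC1 derivC. Qed.

(** The lowering relation.  With the three-term recurrence it shows that the
    adjoint of differentiation for the weight exp (- 2 pi y^2) maps H_n to a
    multiple of H_(n+1). *)
Lemma deriv_hermite n : (hermite n)^`() = (2 * pi * Num.sqrt 2 * n%:R) *: hermite n.-1.
Proof.
elim/ltn_ind: n => -[|n] IH.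
  by rewrite hermite0 deriv_one mulr0 scale0r.
rewrite hermiteS derivB !derivZ derivM derivX mul1r IH// succnK.
case: n IH => [|n] IH.
  by rewrite !mulr0 !scale0r mulr0 addr0 subr0 hermite0 mulr1.
rewrite /= IH// [in RHS]hermiteS /= [hermite n.+1]hermiteS.
rewrite -(natr1 n.+1) -(natr1 n) -!mul_polyC !polyCM !polyCD polyC1.
by ring.
Qed.

Definition hermite_form (p : {poly R}) : R := \int[mu]_y (p.[y] * expR (- (2 * pi * y ^+ 2))).

Lemma continuous_gauss (c : R) : continuous (fun y : R => expR (- (c * y ^+ 2))).
Proof.
move=> y; apply: continuous_comp; last exact: continuous_expR.
apply: cvgN; apply: cvgM; [exact: cvg_cst|exact: exprn_continuous].
Qed.

Lemma poly_gauss2_bound (p : {poly R}) : exists C : R,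
  forall t, `|p.[t] * expR (- (2 * pi * t ^+ 2))| <= C * gauss_fun t.
Proof.
have [C hC] := poly_gauss_bound p; exists C => t.
rewrite (le_trans _ (hC t))// !normrM ler_wpM2l// !ger0_norm ?expR_ge0//.
by rewrite ler_expR lerN2 ler_wpM2r ?sqr_ge0// ler_peMl ?pi_ge0// ler1n.
Qed.

Lemma integrable_poly_gauss (p : {poly R}) :
  mu.-integrable setT (EFin \o (fun y => p.[y] * expR (- (2 * pi * y ^+ 2)))).
Proof.
have [C hC] := poly_gauss2_bound p; apply: integrable_gauss_bounded hC.
apply: measurable_funM; apply: continuous_measurable_fun.
  exact: continuous_horner.
exact: continuous_gauss.
Qed.

Lemma hermite_formD p q : hermite_form (p + q) = hermite_form p + hermite_form q.
Proof.
rewrite /hermite_form -RintegralD//; [|exact: integrable_poly_gauss|exact: integrable_poly_gauss].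
by apply: eq_Rintegral => y _; rewrite hornerD mulrDl.
Qed.

Lemma hermite_formZ c p : hermite_form (c *: p) = c * hermite_form p.
Proof.
rewrite /hermite_form -RintegralZl//; last exact: integrable_poly_gauss.
by apply: eq_Rintegral => y _; rewrite hornerZ -mulrA.
Qed.

Lemma hermite_form1 : hermite_form 1 = Num.sqrt 2^-1.
Proof.
rewrite /hermite_form; under eq_Rintegral do rewrite hornerC mul1r.
rewrite gauss_integral_scaled ?mulr_gt0 ?pi_gt0//; congr Num.sqrt.
by have := pi_gt0 R; move: (pi : R) => P P0; field; rewrite gt_eqF.
Qed.

Lemma is_derive_poly_gauss (p : {poly R}) (x : R) :
  is_derive x 1 (fun y => p.[y] * expR (- (2 * pi * y ^+ 2)))
    ((p^`() - (4 * pi) *: ('X * p)).[x] * expR (- (2 * pi * x ^+ 2))).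
Proof.
have d2 : is_derive x 1 (fun y : R => - (2 * pi * y ^+ 2)) (- (4 * pi * x)).
  rewrite (_ : (fun y : R => _) = (fun y => - (2 * pi) * y * y)); last first.
    by apply/funext => y; ring.
  have := is_derive_mul (is_derive_lin (- (2 * pi)) x) (is_derive_id x 1).
  by move=> /is_derive_eq; apply; ring.
have := is_derive_mul (is_derive_poly p x) (is_derive_expR_comp d2).
move=> /is_derive_eq; apply.
by rewrite hornerD hornerN hornerZ hornerM hornerX; ring.
Qed.

Lemma cvg_poly_gauss (p : {poly R}) :
  (fun y => p.[y] * expR (- (2 * pi * y ^+ 2))) y @[y --> +oo] --> 0.
Proof.
have [C hC] := poly_gauss2_bound p; apply: norm_cvg0.
apply: (@squeeze_cvgr _ _ _ _ (fun=> 0) (fun y => C * gauss_fun y)).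
- by apply: nearW => y; rewrite normr_ge0 hC.
- exact: cvg_cst.
- by rewrite -(mulr0 C); apply: cvgM; [exact: cvg_cst|exact: cvg_gauss_fun].
Qed.

(** The integrand is the derivative of p exp (- 2 pi y^2), which vanishes at
    both ends. *)
Lemma hermite_form_ibp (p : {poly R}) : hermite_form (p^`() - (4 * pi) *: ('X * p)) = 0.
Proof.
set q := p^`() - _; pose F y := p.[y] * expR (- (2 * pi * y ^+ 2)).
pose f y := q.[y] * expR (- (2 * pi * y ^+ 2)).
have intf : mu.-integrable setT (EFin \o f) := integrable_poly_gauss q.
have FN y : F (- y) = (p \Po (- 'X)).[y] * expR (- (2 * pi * y ^+ 2)).
  by rewrite /F sqrrN horner_comp hornerN hornerX.
have dG (x : R) : is_derive x 1 (fun y => F y - F (- y)) (f x + f (- x)).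
  have d1 : is_derive x 1 (fun y => F (- y)) (- f (- x)).
    have dN : is_derive x 1 (fun y : R => - y) (-1).
      by have := is_derive_lin (-1) x; under [in X in X -> _]eq_fun do rewrite mulN1r.
    have := is_derive1_comp (is_derive_poly_gauss p (- x)) dN.
    by move=> /is_derive_eq; apply; rewrite mulrN1.
  have := is_derive_add (is_derive_poly_gauss p x) (is_derive_mul (is_derive_const (-1) x) d1).
  under [in X in X -> _]eq_fun do rewrite mulN1r.
  by move=> /is_derive_eq; apply; rewrite /f -/q; ring.
rewrite /hermite_form integral_fold//.
rewrite (@integral_halfline_FTC _ _ (fun y => F y - F (- y)) 0)//.
- by rewrite oppr0 subrr subr0.
- have cf : continuous f.
    move=> x; apply: cvgM; [exact: continuous_horner|exact: continuous_gauss].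
  move=> x; apply: cvgD; first exact: cf.
  apply: (@continuous_comp _ _ _ (fun y : R => - y) f); first exact: opp_continuous.
  exact: cf.
- have intg := integrableD measurableT intf (integral_reflect intf).1.
  by apply: integrableS intg => //; exact: measurable_itv.
- rewrite -[0]subr0; apply: cvgB; first exact: cvg_poly_gauss.
  by under eq_cvg do rewrite FN; exact: cvg_poly_gauss.
Qed.

(** Integration by parts: the difference of the two sides is the integral of
    the derivative of a multiple of q H_n exp (- 2 pi y^2). *)
Lemma hermite_form_step (q : {poly R}) n :
  hermite_form (q * hermite n.+1) = (Num.sqrt 2)^-1 * hermite_form (q^`() * hermite n).
Proof.
have s2 : Num.sqrt 2 ^+ 2 = 2 :> R by rewrite sqr_sqrtr.
have s0 : Num.sqrt 2 != 0 :> R by rewrite sqrtr_eq0 -ltNge.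
have E : q * hermite n.+1 = (Num.sqrt 2)^-1 *: (q^`() * hermite n) +
    (- (Num.sqrt 2)^-1) *: ((q * hermite n)^`() - (4 * pi) *: ('X * (q * hermite n))).
  rewrite hermiteS derivM deriv_hermite -!mul_polyC.
  have e1 : 2 * pi * Num.sqrt 2 = 4 * pi * (Num.sqrt 2)^-1 :> R.
    rewrite (_ : 4 = 2 * Num.sqrt 2 ^+ 2); last by rewrite s2 -natrM.
    by field.
  have e2 : 2 * pi * n%:R = (Num.sqrt 2)^-1 * (2 * pi * Num.sqrt 2 * n%:R) :> R.
    by field.
  rewrite e2 [X in X%:P * ('X * hermite n)]e1 !polyCM polyCN; ring.
rewrite {}E hermite_formD !hermite_formZ hermite_form_ibp mulr0 addr0//.
Qed.

Lemma hermite_orthogonal m n :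
  hermite_form (hermite m * hermite n) =
  if m == n then (2 * pi) ^+ n * n`!%:R * Num.sqrt 2^-1 else 0.
Proof.
have s0 : Num.sqrt 2 != 0 :> R by rewrite sqrtr_eq0 -ltNge.
elim: n m => [|n IH] [|m].
- by rewrite hermite0 mulr1 hermite_form1 eqxx expr0 fact0 !mul1r.
- rewrite mulrC hermite_form_step hermite0 deriv_one mul0r.
  by rewrite -(scale0r (0 : {poly R})) hermite_formZ mul0r mulr0.
- rewrite hermite_form_step hermite0 deriv_one mul0r.
  by rewrite -(scale0r (0 : {poly R})) hermite_formZ mul0r mulr0.
rewrite hermite_form_step deriv_hermite -scalerAl hermite_formZ IH eqSS /=.
case: eqVneq => [->|_]; last by rewrite !mulr0.
by rewrite factS natrM exprS; move: s0; move: (Num.sqrt 2 : R) => s s0; field.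
Qed.

(** The normalization of the true polyanalytic transform of order n + 1. *)
Definition window_coef n : R := (-1) ^+ n * Num.sqrt (((2 * pi) ^+ n * n`!%:R)^-1).

(** Up to the sign (-1)^n, sqrt 2 times the normalized weighted Hermite function
    psi_n.  The constants are those that the Bargmann transforms produce, which
    explains the norm 2 in [window_orthogonal]. *)
Definition window n (y : R) : R :=
  2 `^ (3 / 4) * window_coef n * ((hermite n).[y] * expR (- (pi * y ^+ 2))).

Lemma continuous_window n : continuous (window n).
Proof.
move=> y; apply: cvgM; first exact: cvg_cst.
by apply: cvgM; [exact: continuous_horner|exact: continuous_gauss].
Qed.

Lemma window_bound n : exists C : R, forall t, `|window n t| <= C * gauss_fun t.
Proof.
have [C hC] := poly_gauss_bound (hermite n).
exists (`|2 `^ (3 / 4) * window_coef n| * C) => t.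
by rewrite /window normrM -mulrA ler_wpM2l.
Qed.

Lemma window_orthogonal m n :
  \int[mu]_y (window m y * window n y) = if m == n then 2 else 0.
Proof.
transitivity (2 `^ (3 / 4) ^+ 2 * (window_coef m * window_coef n) *
    hermite_form (hermite m * hermite n)).
  rewrite /hermite_form -RintegralZl//; last exact: integrable_poly_gauss.
  apply: eq_Rintegral => y _; rewrite /window hornerM.
  have -> : expR (- (2 * pi * y ^+ 2)) = expR (- (pi * y ^+ 2)) * expR (- (pi * y ^+ 2)).
    by rewrite -expRD; congr expR; ring.
  by ring.
rewrite hermite_orthogonal; case: eqVneq => [->|_]; last by rewrite mulr0.
have p0 := pi_gt0 R.
have D0 : 0 < (2 * pi) ^+ n * n`!%:R :> R.
  by rewrite mulr_gt0 ?exprn_gt0 ?mulr_gt0// ltr0n fact_gt0.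
have -> : window_coef n * window_coef n = ((2 * pi) ^+ n * n`!%:R)^-1.
  rewrite /window_coef mulrACA -expr2 sqrr_sign mul1r -expr2 sqr_sqrtr//.
  by rewrite invr_ge0 ltW.
(* 2^(3/2) = 2 sqrt 2 against the norm 1 / sqrt 2 of the Gaussian. *)
have -> : (2 `^ (3 / 4) ^+ 2 : R) = 2 * Num.sqrt 2.
  rewrite -powR_mulrn ?powR_ge0// -powRrM -[in RHS]powR12_sqrt// -[X in _ = X * _]powRr1//.
  by rewrite -powRD ?pnatr_eq0 ?implybT//; congr (_ `^ _); field.
rewrite sqrtrV//.
have s0 : Num.sqrt 2 != 0 :> R by rewrite sqrtr_eq0 -ltNge.
move: D0 s0; move: (_ * _) (Num.sqrt 2 : R) => D s D0 s0.
by field; rewrite s0 gt_eqF.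
Qed.

End Hermite.

(** * The quaternionic exponential on a slice *)
Section QExp.
Variable R : realType.

(** Real and imaginary parts of (x + i y)^n, computed without complex numbers:
    the same recursion gives the powers of x + y J for every imaginary unit J. *)
Fixpoint cpow (x y : R) (n : nat) : R * R :=
  if n is m.+1 then
    let: (r, i) := cpow x y m in (x * r - y * i, y * r + x * i)
  else (1, 0).

Definition recoef x y n : R := (cpow x y n).1 / n`!%:R.
Definition imcoef x y n : R := (cpow x y n).2 / n`!%:R.

Lemma cpow_bound x y n :
  `|(cpow x y n).1| <= (`|x| + `|y|) ^+ n /\ `|(cpow x y n).2| <= (`|x| + `|y|) ^+ n.
Proof.
have pn (m : nat) : 0 <= (`|x| + `|y|) ^+ m by rewrite exprn_ge0// addr_ge0.
elim: n => [|n] /=; first by rewrite normr1 normr0 expr0.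
case: (cpow x y n) => r i /= [hr hi]; rewrite exprS mulrDl; split.
  by rewrite (le_trans (ler_normB _ _))// !normrM lerD// ler_wpM2l.
by rewrite addrC (le_trans (ler_normD _ _))// !normrM lerD// ler_wpM2l.
Qed.

Lemma diffs_recoef x y : pseries_diffs (recoef x y) = (fun n => x * recoef x y n - y * imcoef x y n).
Proof.
apply/funext => n; rewrite /pseries_diffs /recoef /imcoef factS natrM /=.
case: (cpow x y n) => r i /=.
have f0 : n`!%:R != 0 :> R by rewrite pnatr_eq0 -lt0n fact_gt0.
have n0 : n.+1%:R != 0 :> R by rewrite pnatr_eq0.
by move: f0 n0; move: (n`!%:R : R) (n.+1%:R : R) => f m f0 m0; field; rewrite f0 m0.
Qed.

Lemma diffs_imcoef x y : pseries_diffs (imcoef x y) = (fun n => y * recoef x y n + x * imcoef x y n).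
Proof.
apply/funext => n; rewrite /pseries_diffs /recoef /imcoef factS natrM /=.
case: (cpow x y n) => r i /=.
have f0 : n`!%:R != 0 :> R by rewrite pnatr_eq0 -lt0n fact_gt0.
have n0 : n.+1%:R != 0 :> R by rewrite pnatr_eq0.
by move: f0 n0; move: (n`!%:R : R) (n.+1%:R : R) => f m f0 m0; field; rewrite f0 m0.
Qed.

(** Domination by the exponential series gives infinite radius of convergence. *)
Lemma cvg_pseries_exp_dominated (c : nat -> R) (rho K : R) : 0 <= rho ->
  (forall n, `|c n| <= rho ^+ n / n`!%:R) -> cvgn (pseries c K).
Proof.
move=> r0 hc; apply: normed_cvg.
apply: (@series_le_cvg _ _ (exp_coeff (rho * `|K|))).
- by move=> n; exact: normr_ge0.
- by move=> n; rewrite /exp_coeff/= divr_ge0// exprn_ge0// mulr_ge0.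
- move=> n; rewrite /exp_coeff/= normrM normrX exprMn mulrAC ler_wpM2r ?exprn_ge0//.
- exact: is_cvg_series_exp_coeff.
Qed.

Lemma cvg_recoef x y K : cvgn (pseries (recoef x y) K).
Proof.
apply: (@cvg_pseries_exp_dominated _ (`|x| + `|y|)); first by rewrite addr_ge0.
move=> n; rewrite /recoef normrM normfV normr_nat ler_wpM2r ?invr_ge0//.
exact: (cpow_bound x y n).1.
Qed.

Lemma cvg_imcoef x y K : cvgn (pseries (imcoef x y) K).
Proof.
apply: (@cvg_pseries_exp_dominated _ (`|x| + `|y|)); first by rewrite addr_ge0.
move=> n; rewrite /imcoef normrM normfV normr_nat ler_wpM2r ?invr_ge0//.
exact: (cpow_bound x y n).2.
Qed.

Lemma pseries_lin (a b : nat -> R) (u v K : R) :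
  cvgn (pseries a K) -> cvgn (pseries b K) ->
  pseries (fun n => u * a n + v * b n) K @ \oo -->
    u * limn (pseries a K) + v * limn (pseries b K).
Proof.
move=> ca cb.
rewrite (_ : pseries _ K = (fun n => u * pseries a K n + v * pseries b K n)).
  by apply: cvgD; apply: cvgM => //; exact: cvg_cst.
apply/funext => n; rewrite /pseries /series /= !mulr_sumr -big_split/=.
by apply: eq_bigr => i _; ring.
Qed.

Lemma pseries_derive_lin (c a b : nat -> R) (u v s : R) :
  (forall K, cvgn (pseries c K)) ->
  (forall K, cvgn (pseries a K)) -> (forall K, cvgn (pseries b K)) ->
  (forall K, cvgn (pseries (pseries_diffs a) K)) ->
  (forall K, cvgn (pseries (pseries_diffs b) K)) ->
  pseries_diffs c = (fun n => u * a n + v * b n) ->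
  is_derive s 1 (fun s => limn (pseries c s)) (u * limn (pseries a s) + v * limn (pseries b s)).
Proof.
move=> cc ca cb cda cdb E.
have dd : pseries_diffs (pseries_diffs c) = (fun n => u * pseries_diffs a n + v * pseries_diffs b n).
  by rewrite E; apply/funext => n; rewrite /pseries_diffs; ring.
have lin K : cvgn (pseries (pseries_diffs c) K).
  by rewrite E; apply/cvg_ex; eexists; exact: pseries_lin.
have lin2 K : cvgn (pseries (pseries_diffs (pseries_diffs c)) K).
  by rewrite dd; apply/cvg_ex; eexists; exact: pseries_lin.
have K1 : `|s| < `| `|s| + 1| by rewrite [ltRHS]ger0_norm ?addr_ge0// ltrDl.
have := pseries_snd_diffs (cc _) (lin _) (lin2 _) K1.
move=> /is_derive_eq; apply; rewrite E.
by apply/cvg_lim => //; exact: pseries_lin.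
Qed.

Lemma cvg_diffs_recoef x y K : cvgn (pseries (pseries_diffs (recoef x y)) K).
Proof.
rewrite diffs_recoef (_ : (fun n => _) = (fun n => x * recoef x y n + (- y) * imcoef x y n)).
  by apply/cvg_ex; eexists; apply: pseries_lin; [exact: cvg_recoef|exact: cvg_imcoef].
by apply/funext => n; rewrite mulNr.
Qed.

Lemma cvg_diffs_imcoef x y K : cvgn (pseries (pseries_diffs (imcoef x y)) K).
Proof.
rewrite diffs_imcoef.
by apply/cvg_ex; eexists; apply: pseries_lin; [exact: cvg_recoef|exact: cvg_imcoef].
Qed.

Lemma pseries_at0 (c : nat -> R) : limn (pseries c 0) = c 0%N.
Proof.
apply/cvg_lim => //; apply: cvg_near_cst; near=> n.
have n0 : (0 < n)%N by near: n; exact: nbhs_infty_gt.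
rewrite -(prednK n0) /pseries /series/= big_nat_recl// expr0 mulr1.
by rewrite big1 ?addr0// => i _; rewrite expr0n /= mulr0.
Unshelve. all: by end_near. Qed.

(** As functions of s, the power series with coefficients [recoef] and [imcoef]
    satisfy the linear system c' = x c - y d, d' = y c + x d, like
    exp (s x) cos (s y) and exp (s x) sin (s y).  Undoing the rotation and the
    growth yields two functions P and Q with zero derivative, hence equal to
    their values at s = 0. *)
Lemma expcos_series x y :
  limn (pseries (recoef x y) 1) = expR x * cos y /\
  limn (pseries (imcoef x y) 1) = expR x * sin y.
Proof.
pose c (s : R) : R := limn (pseries (recoef x y) s); pose d (s : R) : R := limn (pseries (imcoef x y) s).
have dc (s : R) : is_derive s 1 c (x * c s + (- y) * d s).
  apply: pseries_derive_lin; [exact: cvg_recoef|exact: cvg_recoef|exact: cvg_imcoef|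
    exact: cvg_diffs_recoef|exact: cvg_diffs_imcoef|].
  by rewrite diffs_recoef; apply/funext => n; rewrite mulNr.
have dd (s : R) : is_derive s 1 d (y * c s + x * d s).
  apply: pseries_derive_lin; [exact: cvg_imcoef|exact: cvg_recoef|exact: cvg_imcoef|
    exact: cvg_diffs_recoef|exact: cvg_diffs_imcoef|].
  by rewrite diffs_imcoef.
have c0 : c 0 = 1 by rewrite /c pseries_at0 /recoef /= fact0 divr1.
have d0 : d 0 = 0 by rewrite /d pseries_at0 /imcoef /= mul0r.
(* P + i Q is exp (- (x + i y) s) (c + i d). *)
pose P s := expR (- (x * s)) * (c s * cos (y * s) + d s * sin (y * s)).
pose Q s := expR (- (x * s)) * (d s * cos (y * s) + - c s * sin (y * s)).
have dP (s : R) : is_derive s 1 P 0.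
  have d1 := is_derive_mul (dc s) (is_derive_cos_comp (is_derive_lin y s)).
  have d2 := is_derive_mul (dd s) (is_derive_sin_comp (is_derive_lin y s)).
  have := is_derive_mul (is_derive_exp_lin x s) (is_derive_add d1 d2).
  by move=> /is_derive_eq; apply; ring.
have dQ (s : R) : is_derive s 1 Q 0.
  have dN : is_derive s 1 (fun t => - c t) (- (x * c s + (- y) * d s)).
    have := is_derive_mul (is_derive_const (-1) s) (dc s).
    under [in X in X -> _]eq_fun do rewrite mulN1r.
    by move=> /is_derive_eq; apply; ring.
  have d1 := is_derive_mul (dd s) (is_derive_cos_comp (is_derive_lin y s)).
  have d2 := is_derive_mul dN (is_derive_sin_comp (is_derive_lin y s)).
  have := is_derive_mul (is_derive_exp_lin x s) (is_derive_add d1 d2).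
  by move=> /is_derive_eq; apply; ring.
have := is_derive_0_is_cst 1 0 dP; have := is_derive_0_is_cst 1 0 dQ.
rewrite /P /Q c0 d0 !mulr0 !mulr1 oppr0 expR0 cos0 sin0 !mul1r !mulr0 mul0r !addr0.
move=> hQ hP.
have e0 : expR (- x) * expR x = 1 by rewrite -expRD addNr expR0.
have sc := cos2Dsin2 y.
rewrite -/(c 1) -/(d 1).
move: hQ hP e0 sc; move: (expR (- x)) (expR x) (cos y) (sin y) (c 1) (d 1) => e f C S u v hQ hP e0 sc.
split.
  transitivity (f * (C * (e * (u * C + v * S)) - S * (e * (v * C + - u * S)))).
    by rewrite -[LHS]mul1r -[X in X * _]mulr1 -{1}e0 -sc; ring.
  by rewrite hP hQ; ring.
transitivity (f * (S * (e * (u * C + v * S)) + C * (e * (v * C + - u * S)))).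
  by rewrite -[LHS]mul1r -[X in X * _]mulr1 -{1}e0 -sc; ring.
by rewrite hP hQ; ring.
Qed.

Local Notation H := (quat R).

Lemma qpowE (J : H) x y n : J * J = -1 ->
  (x%:A + y *: J) ^+ n = (cpow x y n).1%:A + (cpow x y n).2 *: J.
Proof.
move=> hJ; elim: n => [|n IH] /=; first by rewrite expr0 scale1r scale0r addr0.
rewrite exprS IH; case: (cpow x y n) => r i /=.
rewrite mulrDl !mulrDr -!scalerAl -!scalerAr !mul1r !mulr1 hJ !scalerA.
by apply: quat_ext => /=; ring.
Qed.

Lemma qexpE (J : H) x y : J * J = -1 ->
  qexp (x%:A + y *: J) = (expR x * cos y)%:A + (expR x * sin y) *: J.
Proof.
move=> hJ; rewrite /qexp.
have [cr ci] := expcos_series x y.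
have Cr : pseries (recoef x y) 1 @ \oo --> expR x * cos y by rewrite -cr; exact: cvg_recoef.
have Ci : pseries (imcoef x y) 1 @ \oo --> expR x * sin y by rewrite -ci; exact: cvg_imcoef.
have E n : \sum_(0 <= k < n) (k`!%:R)^-1 *: (x%:A + y *: J) ^+ k =
    (pseries (recoef x y) 1 n)%:A + (pseries (imcoef x y) 1 n) *: J.
  rewrite /pseries /series /= !scaler_suml -big_split/=; apply: eq_bigr => k _.
  rewrite qpowE// !expr1n !mulr1 scalerDr !scalerA /recoef /imcoef.
  by rewrite ![_ / _]mulrC.
have lin (p q : R) : (fun n => pseries (recoef x y) 1 n * p + pseries (imcoef x y) 1 n * q) n @[n --> \oo]
   --> expR x * cos y * p + expR x * sin y * q.
  by apply: cvgD; apply: cvgM => //; exact: cvg_cst.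
by apply: quat_ext => /=; apply/cvg_lim => //; under eq_cvg do rewrite E; exact: lin.
Qed.

End QExp.

(** * Integration of quaternion-valued functions *)
Section QuatBasics.
Variable R : realType.
Local Notation H := (quat R).
Implicit Types p q : H.

Lemma qreM p q : qre (p * q) = qre p * qre q - qi p * qi q - qj p * qj q - qk p * qk q.
Proof. by case: p => ? ? ? ?; case: q. Qed.
Lemma qiM p q : qi (p * q) = qre p * qi q + qi p * qre q + qj p * qk q - qk p * qj q.
Proof. by case: p => ? ? ? ?; case: q. Qed.
Lemma qjM p q : qj (p * q) = qre p * qj q - qi p * qk q + qj p * qre q + qk p * qi q.
Proof. by case: p => ? ? ? ?; case: q. Qed.
Lemma qkM p q : qk (p * q) = qre p * qk q + qi p * qj q - qj p * qi q + qk p * qre q.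
Proof. by case: p => ? ? ? ?; case: q. Qed.
Definition qME := (qreM, qiM, qjM, qkM).

Lemma qre_sum (I : Type) (s : seq I) (P : pred I) (f : I -> H) :
  qre (\sum_(i <- s | P i) f i) = \sum_(i <- s | P i) qre (f i).
Proof. by elim/big_rec2: _ => //= i x y _ <-. Qed.
Lemma qi_sum (I : Type) (s : seq I) (P : pred I) (f : I -> H) :
  qi (\sum_(i <- s | P i) f i) = \sum_(i <- s | P i) qi (f i).
Proof. by elim/big_rec2: _ => //= i x y _ <-. Qed.
Lemma qj_sum (I : Type) (s : seq I) (P : pred I) (f : I -> H) :
  qj (\sum_(i <- s | P i) f i) = \sum_(i <- s | P i) qj (f i).
Proof. by elim/big_rec2: _ => //= i x y _ <-. Qed.
Lemma qk_sum (I : Type) (s : seq I) (P : pred I) (f : I -> H) :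
  qk (\sum_(i <- s | P i) f i) = \sum_(i <- s | P i) qk (f i).
Proof. by elim/big_rec2: _ => //= i x y _ <-. Qed.

Lemma qnormsq_ge0 q : 0 <= qnormsq q.
Proof. by rewrite /qnormsq !addr_ge0// sqr_ge0. Qed.

Lemma qnorm_sq q : qnorm q ^+ 2 = qnormsq q.
Proof. by rewrite /qnorm sqr_sqrtr// qnormsq_ge0. Qed.

(** If the real part a were nonzero, the imaginary part of J^2, which is 2 a
    times that of J, would force J to be real. *)
Lemma imag_unitP (J : H) : J * J = -1 -> qre J = 0 /\ qnormsq J = 1.
Proof.
case: J => a b c d h.
have e1 := congr1 (@qre R) h; have e2 := congr1 (@qi R) h.
have e3 := congr1 (@qj R) h; have e4 := congr1 (@qk R) h.
move: e1 e2 e3 e4; rewrite /qnormsq /= => e1 e2 e3 e4.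
have ab : a * b = 0 by lra.
have ac : a * c = 0 by lra.
have ad : a * d = 0 by lra.
have [a0|a0] := eqVneq a 0.
  by split => //; rewrite a0 expr0n /=; rewrite a0 mul0r -!expr2 in e1; lra.
have b0 : b = 0 by apply: (mulfI a0); rewrite mulr0.
have c0 : c = 0 by apply: (mulfI a0); rewrite mulr0.
have d0 : d = 0 by apply: (mulfI a0); rewrite mulr0.
exfalso; move: e1; rewrite b0 c0 d0 !mulr0 !subr0 => e1.
have := sqr_ge0 a; rewrite expr2 e1; lra.
Qed.

Lemma qnormsqM p q : qnormsq (p * q) = qnormsq p * qnormsq q.
Proof. by rewrite /qnormsq !qME; ring. Qed.

End QuatBasics.

Section QIntegral.
Context d (T : measurableType d) (R : realType) (nu : {measure set T -> \bar R}).
Local Notation H := (quat R).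

Definition qintegrable (f : T -> H) : Prop :=
  [/\ nu.-integrable setT (fun x => (qre (f x))%:E),
      nu.-integrable setT (fun x => (qi (f x))%:E),
      nu.-integrable setT (fun x => (qj (f x))%:E) &
      nu.-integrable setT (fun x => (qk (f x))%:E)].

Lemma eq_qintegral (f g : T -> H) : f =1 g -> qintegral nu f = qintegral nu g.
Proof. by move=> fg; have -> : f = g by apply/funext. Qed.

Lemma qintegrable0 : qintegrable (fun=> 0).
Proof. by split; exact: integrable0. Qed.

Lemma qintegral0 : qintegral nu (fun=> 0) = 0.
Proof. by rewrite /qintegral /= /Rintegral !integral0. Qed.

Lemma qintegrableD (f g : T -> H) : qintegrable f -> qintegrable g ->
  qintegrable (fun x => f x + g x).
Proof.
move=> [f1 f2 f3 f4] [g1 g2 g3 g4].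
split.
- exact: (integrableD measurableT f1 g1).
- exact: (integrableD measurableT f2 g2).
- exact: (integrableD measurableT f3 g3).
- exact: (integrableD measurableT f4 g4).
Qed.

Lemma qintegralD (f g : T -> H) : qintegrable f -> qintegrable g ->
  qintegral nu (fun x => f x + g x) = qintegral nu f + qintegral nu g.
Proof.
move=> [f1 f2 f3 f4] [g1 g2 g3 g4].
by apply: quat_ext => /=; rewrite -RintegralD.
Qed.

Lemma integrable_lin4 (a b c e : R) (f1 f2 f3 f4 : T -> R) :
  nu.-integrable setT (EFin \o f1) -> nu.-integrable setT (EFin \o f2) ->
  nu.-integrable setT (EFin \o f3) -> nu.-integrable setT (EFin \o f4) ->
  nu.-integrable setT (fun x => (a * f1 x + b * f2 x + c * f3 x + e * f4 x)%:E) /\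
  \int[nu]_x (a * f1 x + b * f2 x + c * f3 x + e * f4 x) =
  a * \int[nu]_x f1 x + b * \int[nu]_x f2 x + c * \int[nu]_x f3 x + e * \int[nu]_x f4 x.
Proof.
move=> i1 i2 i3 i4.
have j1 := integrableZl measurableT a i1; have j2 := integrableZl measurableT b i2.
have j3 := integrableZl measurableT c i3; have j4 := integrableZl measurableT e i4.
have j12 := integrableD measurableT j1 j2.
have j123 := integrableD measurableT j12 j3.
split; first exact: (integrableD measurableT j123 j4).
by rewrite -!RintegralZl// -RintegralD// -RintegralD// -RintegralD.
Qed.

Lemma qintegralMl (c : H) (f : T -> H) : qintegrable f ->
  qintegrable (fun x => c * f x) /\
  qintegral nu (fun x => c * f x) = c * qintegral nu f.
Proof.
case: c => c1 c2 c3 c4 [i1 i2 i3 i4].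
have [a1 b1] := integrable_lin4 c1 (- c2) (- c3) (- c4) i1 i2 i3 i4.
have [a2 b2] := integrable_lin4 c2 c1 (- c4) c3 i1 i2 i3 i4.
have [a3 b3] := integrable_lin4 c3 c4 c1 (- c2) i1 i2 i3 i4.
have [a4 b4] := integrable_lin4 c4 (- c3) c2 c1 i1 i2 i3 i4.
split.
  split.
  - by apply: eq_integrable a1 => // x _; rewrite qreM /=; congr EFin; ring.
  - by apply: eq_integrable a2 => // x _; rewrite qiM /=; congr EFin; ring.
  - by apply: eq_integrable a3 => // x _; rewrite qjM /=; congr EFin; ring.
  - by apply: eq_integrable a4 => // x _; rewrite qkM /=; congr EFin; ring.
apply: quat_ext; rewrite qME.
- rewrite [RHS](_ : _ = \int[nu]_x (c1 * qre (f x) + - c2 * qi (f x) + - c3 * qj (f x) + - c4 * qk (f x))).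
    by apply: eq_Rintegral => x _; rewrite qreM /=; ring.
  by rewrite b1 /=; ring.
- rewrite [RHS](_ : _ = \int[nu]_x (c2 * qre (f x) + c1 * qi (f x) + - c4 * qj (f x) + c3 * qk (f x))).
    by apply: eq_Rintegral => x _; rewrite qiM /=; ring.
  by rewrite b2 /=; ring.
- rewrite [RHS](_ : _ = \int[nu]_x (c3 * qre (f x) + c4 * qi (f x) + c1 * qj (f x) + - c2 * qk (f x))).
    by apply: eq_Rintegral => x _; rewrite qjM /=; ring.
  by rewrite b3 /=; ring.
- rewrite [RHS](_ : _ = \int[nu]_x (c4 * qre (f x) + - c3 * qi (f x) + c2 * qj (f x) + c1 * qk (f x))).
    by apply: eq_Rintegral => x _; rewrite qkM /=; ring.
  by rewrite b4 /=; ring.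
Qed.

Lemma qintegralMr (c : H) (f : T -> H) : qintegrable f ->
  qintegrable (fun x => f x * c) /\
  qintegral nu (fun x => f x * c) = qintegral nu f * c.
Proof.
case: c => c1 c2 c3 c4 [i1 i2 i3 i4].
have [a1 b1] := integrable_lin4 c1 (- c2) (- c3) (- c4) i1 i2 i3 i4.
have [a2 b2] := integrable_lin4 c2 c1 c4 (- c3) i1 i2 i3 i4.
have [a3 b3] := integrable_lin4 c3 (- c4) c1 c2 i1 i2 i3 i4.
have [a4 b4] := integrable_lin4 c4 c3 (- c2) c1 i1 i2 i3 i4.
split.
  split.
  - by apply: eq_integrable a1 => // x _; rewrite qreM /=; congr EFin; ring.
  - by apply: eq_integrable a2 => // x _; rewrite qiM /=; congr EFin; ring.
  - by apply: eq_integrable a3 => // x _; rewrite qjM /=; congr EFin; ring.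
  - by apply: eq_integrable a4 => // x _; rewrite qkM /=; congr EFin; ring.
apply: quat_ext; rewrite qME.
- rewrite [RHS](_ : _ = \int[nu]_x (c1 * qre (f x) + - c2 * qi (f x) + - c3 * qj (f x) + - c4 * qk (f x))).
    by apply: eq_Rintegral => x _; rewrite qreM /=; ring.
  by rewrite b1 /=; ring.
- rewrite [RHS](_ : _ = \int[nu]_x (c2 * qre (f x) + c1 * qi (f x) + c4 * qj (f x) + - c3 * qk (f x))).
    by apply: eq_Rintegral => x _; rewrite qiM /=; ring.
  by rewrite b2 /=; ring.
- rewrite [RHS](_ : _ = \int[nu]_x (c3 * qre (f x) + - c4 * qi (f x) + c1 * qj (f x) + c2 * qk (f x))).
    by apply: eq_Rintegral => x _; rewrite qjM /=; ring.
  by rewrite b3 /=; ring.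
- rewrite [RHS](_ : _ = \int[nu]_x (c4 * qre (f x) + c3 * qi (f x) + - c2 * qj (f x) + c1 * qk (f x))).
    by apply: eq_Rintegral => x _; rewrite qkM /=; ring.
  by rewrite b4 /=; ring.
Qed.

Lemma qintegralZ (c : R) (f : T -> H) : qintegrable f ->
  qintegrable (fun x => c *: f x) /\
  qintegral nu (fun x => c *: f x) = c *: qintegral nu f.
Proof.
move=> intf; have [h1 h2] := qintegralMl (c%:A) intf.
have E : (fun x => c *: f x) = (fun x => c%:A * f x).
  by apply/funext => x; rewrite -scalerAl mul1r.
by rewrite E; split => //; rewrite h2 -scalerAl mul1r.
Qed.

Lemma qintegral_sum (I : Type) (s : seq I) (f : I -> T -> H) :
  (forall i, qintegrable (f i)) ->
  qintegrable (fun x => \sum_(i <- s) f i x) /\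
  qintegral nu (fun x => \sum_(i <- s) f i x) = \sum_(i <- s) qintegral nu (f i).
Proof.
move=> intf; elim: s => [|i s [IH1 IH2]].
  have -> : (fun x => \sum_(i <- [::]) f i x) = (fun=> 0).
    by apply/funext => x; rewrite big_nil.
  by rewrite big_nil qintegral0; split => //; exact: qintegrable0.
have -> : (fun x => \sum_(j <- i :: s) f j x) = (fun x => f i x + \sum_(j <- s) f j x).
  by apply/funext => x; rewrite big_cons.
by rewrite big_cons qintegralD// IH2; split => //; exact: qintegrableD.
Qed.

End QIntegral.

(** * The derivatives of the Bargmann kernel *)
Section Kernel.
Variable R : realType.
Local Notation mu := (@lebesgue_measure R).

(** Writing z = u + i v, the Bargmann kernel is
    exp (- pi (z^2 + t^2) + 2 pi sqrt 2 z t), and its logarithmic derivative in z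
    is [slope_re u t] + i [slope_im v]. *)
Definition slope_re (u t : R) : R := 2 * pi * Num.sqrt 2 * t - 2 * pi * u.
Definition slope_im (v : R) : R := - (2 * pi * v).

Definition kernel0 (u v t : R) : R * R :=
  let r := expR (- pi * (u ^+ 2 - v ^+ 2 + t ^+ 2) + 2 * pi * Num.sqrt 2 * t * u) in
  let th := v * slope_re u t in (r * cos th, r * sin th).

(** The complex derivatives k_m of the kernel in z, as pairs of real and
    imaginary parts: k_(m+1) = s k_m - 2 pi m k_(m-1) with s the logarithmic
    derivative of k_0, whose own derivative is - 2 pi.  Each step carries
    (k_m, k_(m-1)). *)
Fixpoint kernel_pair (u v t : R) (m : nat) : (R * R) * (R * R) :=
  if m is k.+1 then
    let: ((a, b), (a', b')) := kernel_pair u v t k in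
    ((slope_re u t * a - slope_im v * b - 2 * pi * k%:R * a',
      slope_re u t * b + slope_im v * a - 2 * pi * k%:R * b'), (a, b))
  else (kernel0 u v t, (0, 0)).

Definition kre m (u v t : R) : R := (kernel_pair u v t m).1.1.
Definition kim m (u v t : R) : R := (kernel_pair u v t m).1.2.

Lemma kernel_prev u v t m : (kernel_pair u v t m.+1).2 = (kre m u v t, kim m u v t).
Proof. by rewrite /kre /kim /=; case: (kernel_pair u v t m) => -[a b] []. Qed.

Lemma kreS m u v t : kre m.+1 u v t =
  slope_re u t * kre m u v t - slope_im v * kim m u v t - 2 * pi * m%:R * kre m.-1 u v t.
Proof.
case: m => [|m].
  by rewrite /kre /kim /= !mulr0 !mul0r.
rewrite [LHS]/kre [kernel_pair _ _ _ _.+2]/= -/(kernel_pair u v t m.+1).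
rewrite [in LHS](surjective_pairing (kernel_pair u v t m.+1)) kernel_prev.
by rewrite [in LHS](surjective_pairing (kernel_pair u v t m.+1).1).
Qed.

Lemma kimS m u v t : kim m.+1 u v t =
  slope_re u t * kim m u v t + slope_im v * kre m u v t - 2 * pi * m%:R * kim m.-1 u v t.
Proof.
case: m => [|m].
  by rewrite /kre /kim /= !mulr0 !mul0r.
rewrite [LHS]/kim [kernel_pair _ _ _ _.+2]/= -/(kernel_pair u v t m.+1).
rewrite [in LHS](surjective_pairing (kernel_pair u v t m.+1)) kernel_prev.
by rewrite [in LHS](surjective_pairing (kernel_pair u v t m.+1).1).
Qed.

(** With the convention 0.-1 = 0, this is the induction suited to recurrences in
    which the term of index n.-1 has coefficient n. *)
Lemma nat_ind2 (P : nat -> Prop) :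
  P 0%N -> (forall n, P n -> P n.-1 -> P n.+1) -> forall n, P n.
Proof.
move=> P0 PS n; suff : P n /\ P n.-1 by case.
by elim: n => [|n [h1 h2]]; split => //; exact: PS.
Qed.

(** Complex conjugation of the kernel, its parameter t being real. *)
Lemma kernelN m u v t : kre m u (- v) t = kre m u v t /\ kim m u (- v) t = - kim m u v t.
Proof.
elim/nat_ind2: m => [|m [h1 h2] [h3 h4]].
  by rewrite /kre /kim /= !sqrrN !mulNr cosN sinN mulrN.
rewrite !kreS !kimS h1 h2 h3 h4 /slope_im; split; ring.
Qed.

(** The four derivatives are the Cauchy-Riemann equations of k_m together with
    d k_m / d z = k_(m+1). *)
Lemma is_derive_kernel m (u v t : R) :
  [/\ is_derive u 1 (fun x => kre m x v t) (kre m.+1 u v t),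
      is_derive u 1 (fun x => kim m x v t) (kim m.+1 u v t),
      is_derive v 1 (fun y => kre m u y t) (- kim m.+1 u v t) &
      is_derive v 1 (fun y => kim m u y t) (kre m.+1 u v t)].
Proof.
have dslu : is_derive u 1 (fun x => slope_re x t) (- (2 * pi)).
  rewrite /slope_re (_ : (fun x : R => _) = (fun x => 2 * pi * Num.sqrt 2 * t + - (2 * pi) * x)).
    have := is_derive_add (is_derive_const (2 * pi * Num.sqrt 2 * t) u) (is_derive_lin (- (2 * pi)) u).
    by move=> /is_derive_eq; apply; ring.
  by apply/funext => x; rewrite mulNr.
have dslv : is_derive v 1 slope_im (- (2 * pi)).
  rewrite (_ : slope_im = (fun x => - (2 * pi) * x)); first exact: is_derive_lin.
  by apply/funext => x; rewrite mulNr.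
elim/nat_ind2: m => [|m [a1 a2 a3 a4] [b1 b2 b3 b4]].
  have dru : is_derive u 1 (fun x => - pi * (x ^+ 2 - v ^+ 2 + t ^+ 2) + 2 * pi * Num.sqrt 2 * t * x)
      (slope_re u t).
    pose q := (- pi)%:P * ('X ^+ 2 - (v ^+ 2)%:P + (t ^+ 2)%:P) + (2 * pi * Num.sqrt 2 * t)%:P * 'X : {poly R}.
    rewrite (_ : (fun x : R => _) = horner q); last by apply/funext => x; rewrite /q !hornerE.
    have := is_derive_poly q u; move=> /is_derive_eq; apply.
    rewrite /q derivD !derivM !derivC derivD derivB derivXn !derivC derivX.
    rewrite /slope_re !hornerE /=; ring.
  have drv : is_derive v 1 (fun x => - pi * (u ^+ 2 - x ^+ 2 + t ^+ 2) + 2 * pi * Num.sqrt 2 * t * u)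
      (- slope_im v).
    pose q := (- pi)%:P * ((u ^+ 2)%:P - 'X ^+ 2 + (t ^+ 2)%:P) + (2 * pi * Num.sqrt 2 * t * u)%:P : {poly R}.
    rewrite (_ : (fun x : R => _) = horner q); last by apply/funext => x; rewrite /q !hornerE.
    have := is_derive_poly q v; move=> /is_derive_eq; apply.
    rewrite /q derivD !derivM !derivC derivD derivB derivXn !derivC.
    rewrite /slope_im !hornerE /=; ring.
  have dtu : is_derive u 1 (fun x => v * slope_re x t) (slope_im v).
    have := is_derive_mul (is_derive_const v u) dslu.
    by move=> /is_derive_eq; apply; rewrite /slope_im; ring.
  have dtv : is_derive v 1 (fun y => y * slope_re u t) (slope_re u t).
    have := is_derive_mul (is_derive_id v 1) (is_derive_const (slope_re u t) v).
    by move=> /is_derive_eq; apply; ring.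
  rewrite !kreS !kimS !mulr0 !mul0r !subr0 /kre /kim /=.
  split.
  - have := is_derive_mul (is_derive_expR_comp dru) (is_derive_cos_comp dtu).
    by move=> /is_derive_eq; apply; ring.
  - have := is_derive_mul (is_derive_expR_comp dru) (is_derive_sin_comp dtu).
    by move=> /is_derive_eq; apply; ring.
  - have := is_derive_mul (is_derive_expR_comp drv) (is_derive_cos_comp dtv).
    by move=> /is_derive_eq; apply; ring.
  - have := is_derive_mul (is_derive_expR_comp drv) (is_derive_sin_comp dtv).
    by move=> /is_derive_eq; apply; ring.
have c1 (w : R) := is_derive_const (- (2 * pi * m%:R)) w.
have cu := is_derive_const (- slope_im v) u.
have cu' := is_derive_const (slope_im v) u.
have cv := is_derive_const (slope_re u t) v.
have dslvN : is_derive v 1 (fun y => - slope_im y) (2 * pi).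
  rewrite (_ : (fun y => _) = (fun x => 2 * pi * x)); first exact: is_derive_lin.
  by apply/funext => x; rewrite /slope_im opprK.
have pm : 2 * pi * m%:R * kre m.-1.+1 u v t = 2 * pi * m%:R * kre m u v t.
  by case: m {a1 a2 a3 a4 b1 b2 b3 b4 c1} => // ; rewrite !mulr0 !mul0r.
have pm' : 2 * pi * m%:R * kim m.-1.+1 u v t = 2 * pi * m%:R * kim m u v t.
  by case: m {a1 a2 a3 a4 b1 b2 b3 b4 c1 pm} => // ; rewrite !mulr0 !mul0r.
have nk1 : - (2 * pi * m%:R) * kre m.-1.+1 u v t = - (2 * pi * m%:R * kre m u v t).
  by rewrite mulNr pm.
have nk2 : - (2 * pi * m%:R) * kim m.-1.+1 u v t = - (2 * pi * m%:R * kim m u v t).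
  by rewrite mulNr pm'.
have nk3 : - (2 * pi * m%:R) * - kim m.-1.+1 u v t = 2 * pi * m%:R * kim m u v t.
  by rewrite mulrNN pm'.
split.
- rewrite (_ : (fun x => kre m.+1 x v t) = (fun x => slope_re x t * kre m x v t + - slope_im v * kim m x v t + - (2 * pi * m%:R) * kre m.-1 x v t)); last first.
    by apply/funext => x; rewrite kreS; ring.
  have := is_derive_add (is_derive_add (is_derive_mul dslu a1) (is_derive_mul cu a2)) (is_derive_mul (c1 u) b1).
  move=> /is_derive_eq; apply; rewrite nk1 (kreS m.+1) -[m.+1%:R]natr1 succnK; ring.
- rewrite (_ : (fun x => kim m.+1 x v t) = (fun x => slope_re x t * kim m x v t + slope_im v * kre m x v t + - (2 * pi * m%:R) * kim m.-1 x v t)); last first.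
    by apply/funext => x; rewrite kimS; ring.
  have := is_derive_add (is_derive_add (is_derive_mul dslu a2) (is_derive_mul cu' a1)) (is_derive_mul (c1 u) b2).
  move=> /is_derive_eq; apply; rewrite nk2 (kimS m.+1) -[m.+1%:R]natr1 succnK; ring.
- rewrite (_ : (fun x => kre m.+1 u x t) = (fun x => slope_re u t * kre m u x t + - slope_im x * kim m u x t + - (2 * pi * m%:R) * kre m.-1 u x t)); last first.
    by apply/funext => x; rewrite kreS; ring.
  have := is_derive_add (is_derive_add (is_derive_mul cv a3) (is_derive_mul dslvN a4)) (is_derive_mul (c1 v) b3).
  move=> /is_derive_eq; apply; rewrite nk3 (kimS m.+1) -[m.+1%:R]natr1 succnK; ring.
- rewrite (_ : (fun x => kim m.+1 u x t) = (fun x => slope_re u t * kim m u x t + slope_im x * kre m u x t + - (2 * pi * m%:R) * kim m.-1 u x t)); last first.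
    by apply/funext => x; rewrite kimS; ring.
  have := is_derive_add (is_derive_add (is_derive_mul cv a4) (is_derive_mul dslv a3)) (is_derive_mul (c1 v) b4).
  move=> /is_derive_eq; apply; rewrite nk1 (kreS m.+1) -[m.+1%:R]natr1 succnK; ring.
Qed.

Lemma measurable_bargmann_kernel m u v : measurable_fun setT (kre m u v) /\ measurable_fun setT (kim m u v).
Proof.
have msl : measurable_fun setT (slope_re u) by apply: measurable_funB => //; exact: measurable_funM.
elim/nat_ind2: m => [|m [h1 h2] [h3 h4]].
  have mth : measurable_fun setT (fun t => v * slope_re u t) by exact: measurable_funM.
  have mr : measurable_fun setT (fun t : R => expR (- pi * (u ^+ 2 - v ^+ 2 + t ^+ 2) + 2 * pi * Num.sqrt 2 * t * u)).
    apply: measurable_expR_comp; apply: measurable_funD.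
      by apply: measurable_funM => //; apply: measurable_funD => //; exact: measurable_funX.
    by apply: measurable_funM => //; exact: measurable_funM.
  split; apply: (measurable_funM mr); [exact: measurable_cos_comp|exact: measurable_sin_comp].
split.
  rewrite (_ : kre m.+1 u v = fun t => slope_re u t * kre m u v t - slope_im v * kim m u v t - 2 * pi * m%:R * kre m.-1 u v t).
    apply: measurable_funB; last exact: measurable_funM.
    by apply: measurable_funB; exact: measurable_funM.
  by apply/funext => t; rewrite kreS.
rewrite (_ : kim m.+1 u v = fun t => slope_re u t * kim m u v t + slope_im v * kre m u v t - 2 * pi * m%:R * kim m.-1 u v t).
  apply: measurable_funB; last exact: measurable_funM.
  by apply: measurable_funD; exact: measurable_funM.
by apply/funext => t; rewrite kimS.
Qed.

(** Locally uniform in (u, v), as needed to differentiate under the integral: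
    after removal of the factor exp (- pi t^2), the kernel and its derivatives
    grow at most exponentially in t. *)
Lemma kernel_bound (M : R) m : 0 <= M -> exists2 C : R, 0 <= C &
  forall u v t, `|u| <= M -> `|v| <= M ->
    `|kre m u v t| <= C * gauss_fun t /\ `|kim m u v t| <= C * gauss_fun t.
Proof.
move=> M0.
pose D (z : R * R * R) := `|z.1.1| <= M /\ `|z.1.2| <= M.
pose rho (z : R * R * R) := `|z.2|.
have r0 z : 0 <= rho z by exact: normr_ge0.
pose G (k : R -> R -> R -> R) (z : R * R * R) := k z.1.1 z.1.2 z.2 * expR (pi * z.2 ^+ 2).
have pi0 : 0 <= pi :> R by exact: pi_ge0.
have gsr : expgrowth D rho (fun z => slope_re z.1.1 z.2).
  pose c := 2 * pi * Num.sqrt 2 + 2 * pi * M : R.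
  have s0 : 0 <= 2 * pi * Num.sqrt 2 :> R by rewrite !mulr_ge0.
  have p20 : 0 <= 2 * pi :> R by rewrite mulr_ge0.
  apply: (@expgrowth_rho _ _ _ _ _ c); first by rewrite addr_ge0// mulr_ge0.
  move=> [[u v] t] [/= hu hv]; rewrite /slope_re (le_trans (ler_normB _ _))//.
  rewrite (normrM (2 * pi * Num.sqrt 2)) (ger0_norm s0) (normrM (2 * pi)) (ger0_norm p20).
  have -> : rho (u, v, t) = `|t| by [].
  have h1 : 2 * pi * `|u| <= 2 * pi * M by exact: ler_wpM2l.
  have h2 : 0 <= 2 * pi * M * `|t| by rewrite !mulr_ge0.
  rewrite /c; move: s0 h1 h2; move: (Num.sqrt 2 : R) (pi : R) => A B; lra.
have gsi : expgrowth D rho (fun z => slope_im z.1.2).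
  have p20 : 0 <= 2 * pi :> R by rewrite mulr_ge0.
  apply: (@expgrowth_rho _ _ _ _ _ (2 * pi * M)); first by rewrite mulr_ge0.
  move=> [[u v] t] [/= hu hv]; rewrite /slope_im normrN normrM (ger0_norm p20).
  have -> : rho (u, v, t) = `|t| by [].
  rewrite -mulrA ler_wpM2l// (le_trans hv)// ler_peMr// lerDl//.
have key : expgrowth D rho (G (kre m)) /\ expgrowth D rho (G (kim m)).
  elim/nat_ind2: m => [|m [h1 h2] [h3 h4]].
    pose K := pi * M ^+ 2 + 2 * pi * Num.sqrt 2 * M.
    have K0 : 0 <= K by rewrite addr_ge0 ?mulr_ge0// ?sqr_ge0// mulr_ge0.
    have kb u v t c : `|u| <= M -> `|v| <= M -> `|c| <= 1 ->
      `|expR (- pi * (u ^+ 2 - v ^+ 2 + t ^+ 2) + 2 * pi * Num.sqrt 2 * t * u) * c * expR (pi * t ^+ 2)| <=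
        expR (K * (1 + `|t|)).
      move=> hu hv hc; rewrite mulrAC -expRD normrM ger0_norm ?expR_ge0//.
      rewrite (le_trans (ler_wpM2l (expR_ge0 _) hc))// mulr1 ler_expR.
      have p20 : 0 <= 2 * pi * Num.sqrt 2 :> R by rewrite !mulr_ge0.
      have tu : t * u <= M * `|t|.
        by rewrite (le_trans (ler_norm _))// normrM mulrC ler_wpM2r.
      have h2 := ler_wpM2l p20 tu.
      have v2 : v ^+ 2 <= M ^+ 2 by rewrite -(real_normK (num_real v)) lerXn2r// nnegrE.
      have h3 := ler_wpM2l pi0 v2.
      have h4 : 0 <= pi * u ^+ 2 by rewrite mulr_ge0 ?sqr_ge0.
      have h5 : 0 <= pi * M ^+ 2 * `|t| by rewrite !mulr_ge0 ?sqr_ge0.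
      have h6 : 0 <= 2 * pi * Num.sqrt 2 * M by rewrite mulr_ge0.
      by rewrite /K; lra.
    split; exists K => // -[[u v] t] [/= hu hv]; apply: kb => //.
      exact: norm_cos_le1.
    exact: norm_sin_le1.
  split.
    rewrite (_ : G (kre m.+1) = fun z => slope_re z.1.1 z.2 * G (kre m) z + - (slope_im z.1.2 * G (kim m) z) + - (2 * pi * m%:R) * G (kre m.-1) z).
      apply: expgrowthD => //; last exact: expgrowthZ.
      apply: expgrowthD => //; first exact: expgrowthM.
      by apply: expgrowthN; exact: expgrowthM.
    by apply/funext => z; rewrite /G kreS; ring.
  rewrite (_ : G (kim m.+1) = fun z => slope_re z.1.1 z.2 * G (kim m) z + (slope_im z.1.2 * G (kre m) z) + - (2 * pi * m%:R) * G (kim m.-1) z).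
    apply: expgrowthD => //; last exact: expgrowthZ.
    by apply: expgrowthD => //; exact: expgrowthM.
  by apply/funext => z; rewrite /G kimS; ring.
have [[K K0 hK] [L L0 hL]] := key.
have e1 (t x : R) : x * expR (pi * t ^+ 2) * expR (- (pi * t ^+ 2)) = x.
  by rewrite -mulrA -expRD addrN expR0 mulr1.
exists (expR (K + K ^+ 2) + expR (L + L ^+ 2)); first by rewrite addr_ge0 ?expR_ge0.
move=> u v t hu hv; have Dz : D ((u, v), t) by [].
split.
  rewrite -(e1 t (kre m u v t)) normrM (ger0_norm (expR_ge0 (- (pi * t ^+ 2)))).
  rewrite (le_trans (ler_wpM2r (expR_ge0 _) (hK _ Dz)))//.
  rewrite (le_trans (gauss_absorb t K0))// ler_wpM2r ?gauss_fun_ge0//.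
  by rewrite lerDl expR_ge0.
rewrite -(e1 t (kim m u v t)) normrM (ger0_norm (expR_ge0 (- (pi * t ^+ 2)))).
rewrite (le_trans (ler_wpM2r (expR_ge0 _) (hL _ Dz)))//.
rewrite (le_trans (gauss_absorb t L0))// ler_wpM2r ?gauss_fun_ge0//.
by rewrite lerDr expR_ge0.
Qed.

End Kernel.

(** * Slice derivatives of the Bargmann transform *)
Section Bargmann.
Variable R : realType.
Local Notation mu := (@lebesgue_measure R).
Local Notation H := (quat R).

(** Only a bound on a neighbourhood ]- M, M[ of u is required, as the bound on
    the kernel is locally uniform. *)
Lemma is_derive_integral (F dF : R -> R -> R) (G : R -> R) (u M : R) : `|u| < M ->
  (forall x, mu.-integrable setT (EFin \o F x)) ->
  (forall x t : R, is_derive x 1 (F^~ t) (dF x t)) ->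
  (forall x t : R, `|x| < M -> `|dF x t| <= G t) ->
  (forall t, 0 <= G t) -> mu.-integrable setT (EFin \o G) ->
  is_derive u 1 (fun x => \int[mu]_t F x t) (\int[mu]_t dF u t).
Proof.
move=> uM intF dFE bF G0 intG.
have Iu : `]- M, M[%classic u by rewrite /= in_itv/= -ltr_norml.
have h1 (x : R) : `]- M, M[%classic x -> mu.-integrable setT (EFin \o F x) by [].
have h2 (x t : R) : `]- M, M[%classic x -> [set: measurableTypeR R] t -> derivable (F^~ t) x 1.
  by move=> _ _; exact: ex_derive.
have pE x t : partial1of2 F x t = dF x t.
  by rewrite /partial1of2 derive1E; exact: derive_val.
have h3 (x t : R) : `]- M, M[%classic x -> [set: measurableTypeR R] t ->
    `|partial1of2 F x t| <= G t.
  by rewrite /= in_itv/= -ltr_norml => xM _; rewrite pE; exact: bF.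
have d1 := derivable_under_integral measurableT Iu h1 h2 G0 intG h3.
apply: DeriveDef => //; rewrite -derive1E.
rewrite (differentiation_under_integral measurableT Iu h1 h2 G0 intG h3).
by apply: eq_Rintegral => t _; rewrite pE.
Qed.

Lemma sqintegrable_gauss : sqintegrable (@gauss_fun R).
Proof.
apply: (@sqintegrable_gauss_bounded _ _ 1); first exact: measurable_gauss_fun.
by move=> t; rewrite mul1r ger0_norm// gauss_fun_ge0.
Qed.

Lemma sqintegrable_kernel m (u v : R) : sqintegrable (kre m u v) /\ sqintegrable (kim m u v).
Proof.
have M0 : 0 <= `|u| + `|v| by rewrite addr_ge0.
have [C C0 hC] := kernel_bound m M0.
have hu : `|u| <= `|u| + `|v| by rewrite lerDl.
have hv : `|v| <= `|u| + `|v| by rewrite lerDr.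
have [m1 m2] := measurable_bargmann_kernel m u v.
split; apply: sqintegrable_gauss_bounded => //.
  by move=> t; exact: (hC u v t hu hv).1.
by move=> t; exact: (hC u v t hu hv).2.
Qed.

Lemma integrable_kernel_pairing m (u v : R) (g h : R -> R) : sqintegrable g -> sqintegrable h ->
  mu.-integrable setT (EFin \o (fun t => kre m u v t * g t + kim m u v t * h t)).
Proof.
move=> sg sh; have [s1 s2] := sqintegrable_kernel m u v.
exact: (integrableD measurableT (sqintegrable_mul s1 sg) (sqintegrable_mul s2 sh)).
Qed.

Lemma is_derive_kernel_pairing m (u v : R) (g h : R -> R) : sqintegrable g -> sqintegrable h ->
  is_derive u 1 (fun x => \int[mu]_t (kre m x v t * g t + kim m x v t * h t))
    (\int[mu]_t (kre m.+1 u v t * g t + kim m.+1 u v t * h t)) /\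
  is_derive v 1 (fun y => \int[mu]_t (kre m u y t * g t + kim m u y t * h t))
    (\int[mu]_t (- kim m.+1 u v t * g t + kre m.+1 u v t * h t)).
Proof.
move=> sg sh.
pose M := `|u| + `|v| + 1.
have M0 : 0 <= M by rewrite !addr_ge0.
have uM : `|u| < M by rewrite /M; have := normr_ge0 v; lra.
have vM : `|v| < M by rewrite /M; have := normr_ge0 u; lra.
have [C C0 hC] := kernel_bound m.+1 M0.
pose G t := C * (`|gauss_fun t * g t| + `|gauss_fun t * h t|).
have G0 t : 0 <= G t by rewrite mulr_ge0// addr_ge0.
have intG : mu.-integrable setT (EFin \o G).
  have i1 := integrable_norm (sqintegrable_mul sqintegrable_gauss sg).
  have i2 := integrable_norm (sqintegrable_mul sqintegrable_gauss sh).
  exact: (integrableZl measurableT C (integrableD measurableT i1 i2)).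
have bnd (a b g' h' t : R) : `|a| <= C * gauss_fun t -> `|b| <= C * gauss_fun t ->
    `|a * g' + b * h'| <= C * (`|gauss_fun t * g'| + `|gauss_fun t * h'|).
  move=> ha hb; rewrite (le_trans (ler_normD _ _))// mulrDr !normrM.
  by rewrite !(ger0_norm (gauss_fun_ge0 _)) !mulrA lerD// ler_wpM2r.
split.
- apply: (@is_derive_integral (fun x t => kre m x v t * g t + kim m x v t * h t)
    (fun x t => kre m.+1 x v t * g t + kim m.+1 x v t * h t) G u M uM _ _ _ G0 intG).
  + by move=> x; exact: integrable_kernel_pairing.
  + move=> x t; have [d1 d2 _ _] := is_derive_kernel m x v t.
    have := is_derive_add (is_derive_mul d1 (is_derive_const (g t) x))
      (is_derive_mul d2 (is_derive_const (h t) x)).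
    by move=> /is_derive_eq; apply; ring.
  + by move=> x t xM; have [h1 h2] := hC x v t (ltW xM) (ltW vM); exact: bnd.
- apply: (@is_derive_integral (fun y t => kre m u y t * g t + kim m u y t * h t)
    (fun y t => - kim m.+1 u y t * g t + kre m.+1 u y t * h t) G v M vM _ _ _ G0 intG).
  + by move=> x; exact: integrable_kernel_pairing.
  + move=> x t; have [_ _ d1 d2] := is_derive_kernel m u x t.
    have := is_derive_add (is_derive_mul d1 (is_derive_const (g t) x))
      (is_derive_mul d2 (is_derive_const (h t) x)).
    by move=> /is_derive_eq; apply; ring.
  + move=> x t xM; have [h1 h2] := hC u x t (ltW uM) (ltW xM).
    by apply: bnd; rewrite ?normrN.
Qed.

(** The kernel of the slice of J: the complex number k_m read in R + R J. *)
Definition qkernel m (u v : R) (J : H) (t : R) : H := (kre m u v t)%:A + kim m u v t *: J.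

Definition qkernel_int m (u v : R) (J : H) (phi : R -> H) : H :=
  qintegral leb1 (fun t => qkernel m u v J t * phi t).

Definition qsqintegrable (phi : R -> H) : Prop :=
  [/\ sqintegrable (fun t => qre (phi t)), sqintegrable (fun t => qi (phi t)),
      sqintegrable (fun t => qj (phi t)) & sqintegrable (fun t => qk (phi t))].

Lemma sqintegrable_lin4 (a b c e : R) (f1 f2 f3 f4 : R -> R) :
  sqintegrable f1 -> sqintegrable f2 -> sqintegrable f3 -> sqintegrable f4 ->
  sqintegrable (fun x => a * f1 x + b * f2 x + c * f3 x + e * f4 x).
Proof.
move=> s1 s2 s3 s4.
exact: (sqintegrableD (sqintegrableD (sqintegrableD (sqintegrableZ a s1) (sqintegrableZ b s2))
  (sqintegrableZ c s3)) (sqintegrableZ e s4)).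
Qed.

Lemma eq_sqintegrable (f g : R -> R) : f =1 g -> sqintegrable f -> sqintegrable g.
Proof. by move=> /funext ->. Qed.

Lemma qsqintegrableMl (c : H) (phi : R -> H) : qsqintegrable phi ->
  qsqintegrable (fun t => c * phi t).
Proof.
case: c => c1 c2 c3 c4 [i1 i2 i3 i4]; split.
- apply: eq_sqintegrable (sqintegrable_lin4 c1 (- c2) (- c3) (- c4) i1 i2 i3 i4).
  by move=> x; rewrite qreM /=; ring.
- apply: eq_sqintegrable (sqintegrable_lin4 c2 c1 (- c4) c3 i1 i2 i3 i4).
  by move=> x; rewrite qiM /=; ring.
- apply: eq_sqintegrable (sqintegrable_lin4 c3 c4 c1 (- c2) i1 i2 i3 i4).
  by move=> x; rewrite qjM /=; ring.
- apply: eq_sqintegrable (sqintegrable_lin4 c4 (- c3) c2 c1 i1 i2 i3 i4).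
  by move=> x; rewrite qkM /=; ring.
Qed.

(** The values of phi do not commute with J, so phi and J * phi enter the real
    components of the product as two independent functions. *)
Lemma qkernelE m u v J t (q : H) :
  qkernel m u v J t * q = kre m u v t *: q + kim m u v t *: (J * q).
Proof. by rewrite /qkernel mulrDl -!scalerAl mul1r. Qed.

Lemma qintegrable_qkernel m u v J phi : qsqintegrable phi ->
  qintegrable leb1 (fun t => qkernel m u v J t * phi t).
Proof.
move=> hp; have [p1 p2 p3 p4] := hp; have [j1 j2 j3 j4] := qsqintegrableMl J hp.
split; under eq_fun do rewrite qkernelE /=; exact: integrable_kernel_pairing.
Qed.

Lemma qkernel_int_comp m u v J phi :
  qkernel_int m u v J phi =
  Quat (\int[mu]_t (kre m u v t * qre (phi t) + kim m u v t * qre (J * phi t)))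
       (\int[mu]_t (kre m u v t * qi (phi t) + kim m u v t * qi (J * phi t)))
       (\int[mu]_t (kre m u v t * qj (phi t) + kim m u v t * qj (J * phi t)))
       (\int[mu]_t (kre m u v t * qk (phi t) + kim m u v t * qk (J * phi t))).
Proof.
by apply: quat_ext => /=; apply: eq_Rintegral => t _; rewrite qkernelE.
Qed.

Lemma derive1_scaled (c a : R) (f h : R -> R) (x : R) : h =1 f -> is_derive x 1 f a ->
  derive1 (fun y => c * h y) x = c * a.
Proof.
move=> /funext -> df; have := is_derive_mul (is_derive_const c x) df.
rewrite mul0r add0r => d1; rewrite derive1E; exact: derive_val.
Qed.

Lemma qderive_qkernel_int (c : R) m u v J phi : J * J = -1 -> qsqintegrable phi ->
  qderive (fun x => c *: qkernel_int m x v J phi) u = c *: qkernel_int m.+1 u v J phi /\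
  qderive (fun y => c *: qkernel_int m u y J phi) v = c *: (J * qkernel_int m.+1 u v J phi).
Proof.
move=> hJ hp; have [p1 p2 p3 p4] := hp; have [j1 j2 j3 j4] := qsqintegrableMl J hp.
have [a1 b1] := is_derive_kernel_pairing m u v p1 j1.
have [a2 b2] := is_derive_kernel_pairing m u v p2 j2.
have [a3 b3] := is_derive_kernel_pairing m u v p3 j3.
have [a4 b4] := is_derive_kernel_pairing m u v p4 j4.
split.
  have E x := qkernel_int_comp m x v J phi.
  rewrite qkernel_int_comp; apply: quat_ext; rewrite /qderive /=.
  - by apply: (@derive1_scaled c _ _ (fun x => qre (qkernel_int m x v J phi)) u _ a1) => x; rewrite E.
  - by apply: (@derive1_scaled c _ _ (fun x => qi (qkernel_int m x v J phi)) u _ a2) => x; rewrite E.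
  - by apply: (@derive1_scaled c _ _ (fun x => qj (qkernel_int m x v J phi)) u _ a3) => x; rewrite E.
  - by apply: (@derive1_scaled c _ _ (fun x => qk (qkernel_int m x v J phi)) u _ a4) => x; rewrite E.
have Ey y := qkernel_int_comp m u y J phi.
rewrite /qkernel_int -(qintegralMl J (qintegrable_qkernel m.+1 u v J hp)).2.
have E t : J * (qkernel m.+1 u v J t * phi t) =
    - kim m.+1 u v t *: phi t + kre m.+1 u v t *: (J * phi t).
  rewrite mulrA /qkernel mulrDr -!scalerAr mulr1 hJ mulrDl -!scalerAl mulN1r.
  by rewrite scalerN scaleNr addrC.
rewrite [RHS](_ : _ = c *: qintegral leb1 (fun t => - kim m.+1 u v t *: phi t +
    kre m.+1 u v t *: (J * phi t))); last first.
  by congr (_ *: _); apply: eq_qintegral => t; exact: E.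
apply: quat_ext; rewrite /qderive /=.
- by apply: (@derive1_scaled c _ _ (fun y => qre (qkernel_int m u y J phi)) v _ b1) => y; rewrite Ey.
- by apply: (@derive1_scaled c _ _ (fun y => qi (qkernel_int m u y J phi)) v _ b2) => y; rewrite Ey.
- by apply: (@derive1_scaled c _ _ (fun y => qj (qkernel_int m u y J phi)) v _ b3) => y; rewrite Ey.
- by apply: (@derive1_scaled c _ _ (fun y => qk (qkernel_int m u y J phi)) v _ b4) => y; rewrite Ey.
Qed.

(** The unit attached to q by [slice_unit] is J or - J, paired with |v|, except
    on the real axis, where v = 0 makes every unit suitable. *)
Lemma slice_decomposition (u v : R) (J : H) : J * J = -1 ->
  let q := u%:A + v *: J in let J' := slice_unit q in
  [/\ J' * J' = -1, qre q = u, qnorm (qim q) = `|v| & `|v| *: J' = v *: J].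
Proof.
move=> hJ q J'; have [J0 J1] := imag_unitP hJ.
have qr : qre q = u by rewrite /q /= J0 mulr0 addr0 mulr1.
have qm : qim q = v *: J.
  by rewrite /q /qim; apply: quat_ext; rewrite /= ?J0 ?mulr0 ?add0r.
have nv : qnorm (qim q) = `|v|.
  rewrite qm /qnorm (_ : qnormsq _ = v ^+ 2 * qnormsq J); last by rewrite /qnormsq /=; ring.
  by rewrite J1 mulr1 sqrtr_sqr.
split => //; rewrite /J' /slice_unit nv qm; case: ifPn => [/eqP h|h].
- by apply: quat_ext => /=; ring.
- have v0 : v != 0 by apply: contra h => /eqP ->; rewrite scale0r.
  rewrite -!scalerAl -!scalerAr hJ !scalerA.
  have -> : `|v|^-1 * v * (`|v|^-1 * v) = 1.
    by rewrite mulrACA -invfM -expr2 real_normK ?num_real// -expr2 mulVf// sqrf_eq0.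
  by rewrite scale1r.
- have -> : v = 0.
    have := congr1 (@qnormsq R) h; rewrite (_ : qnormsq _ = v ^+ 2 * qnormsq J).
      by rewrite J1 mulr1 /qnormsq /= expr0n /= !addr0 => /eqP; rewrite sqrf_eq0 => /eqP.
    by rewrite /qnormsq /=; ring.
  by rewrite normr0 !scale0r.
- have v0 : v != 0 by apply: contra h => /eqP ->; rewrite scale0r.
  by rewrite !scalerA mulfV ?normr_eq0// mul1r.
Qed.

(** Replacing (v, J) by (- v, - J) conjugates the kernel and the unit, so the
    value depends only on the point u + v J. *)
Lemma qkernel_slice m (u v : R) (J J' : H) t : `|v| *: J' = v *: J ->
  qkernel m u `|v| J' t = qkernel m u v J t.
Proof.
move=> hv; have [v0|v0] := eqVneq v 0.
  have k0 : kim m u 0 t = 0.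
    by have [_] := kernelN m u 0 t; rewrite oppr0; lra.
  by rewrite v0 normr0 /qkernel k0 !scale0r.
have -> : J' = (`|v|^-1 * v) *: J.
  by rewrite -scalerA -hv scalerA mulVf ?normr_eq0// scale1r.
rewrite /qkernel; have [vp|vn] := ger0P v.
  by rewrite mulVf// scale1r.
have [k1 k2] := kernelN m u v t.
by rewrite k1 k2 invrN mulNr mulVf// scaleN1r scalerN scaleNr opprK.
Qed.

Lemma bargmann_slice (phi : R -> H) (u v : R) (J : H) : J * J = -1 ->
  bargmann phi (u%:A + v *: J) = (2 `^ (3 / 4)) *: qkernel_int 0 u v J phi.
Proof.
move=> hJ; rewrite /bargmann /qkernel_int; congr (_ *: _); apply: eq_qintegral => t.
congr (_ * _).
pose al := - pi * (u ^+ 2 - v ^+ 2 + t ^+ 2) + 2 * pi * Num.sqrt 2 * t * u.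
have sq : (u%:A + v *: J) ^+ 2 = (u ^+ 2 - v ^+ 2)%:A + (2 * u * v) *: J.
  rewrite qpowE//=; apply: quat_ext => /=; ring.
have -> : - (pi *: ((u%:A + v *: J) ^+ 2 + (t ^+ 2)%:A)) +
    (2 * pi * Num.sqrt 2 * t) *: (u%:A + v *: J) = al%:A + (v * slope_re u t) *: J.
  by rewrite sq /al /slope_re; apply: quat_ext => /=; ring.
by rewrite qexpE.
Qed.

(** By induction, since d/du and - J d/dv both turn k_m into k_(m+1): the
    average of the two in the slice derivative is again the integral against
    k_(m+1). *)
Lemma iter_slice_derive_bargmann m (phi : R -> H) (u v : R) (J : H) :
  qsqintegrable phi -> J * J = -1 ->
  iter m (@slice_derive R) (bargmann phi) (u%:A + v *: J) =
  (2 `^ (3 / 4)) *: qkernel_int m u v J phi.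
Proof.
move=> hp; elim: m u v J => [|m IH] u v J hJ; first exact: bargmann_slice.
have [hJ' qr nv hv] := slice_decomposition u v hJ.
rewrite iterS {1}/slice_derive qr nv.
set J' := slice_unit _ in hJ' hv *.
have -> : (fun u0 : R => iter m (@slice_derive R) (bargmann phi) (u0%:A + `|v| *: J')) =
   (fun x => (2 `^ (3 / 4)) *: qkernel_int m x `|v| J' phi).
  by apply/funext => x; rewrite IH.
have -> : (fun v0 : R => iter m (@slice_derive R) (bargmann phi) (u%:A + v0 *: J')) =
   (fun y => (2 `^ (3 / 4)) *: qkernel_int m u y J' phi).
  by apply/funext => x; rewrite IH.
have [-> ->] := qderive_qkernel_int (2 `^ (3 / 4)) m u `|v| hJ' hp.
rewrite -scalerAr mulrA hJ' mulN1r scalerN opprK.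
rewrite (_ : 2^-1 *: (_ + _) = (2 `^ (3 / 4)) *: qkernel_int m.+1 u `|v| J' phi); last first.
  by apply: quat_ext => /=; field.
congr (_ *: _).
by apply: eq_qintegral => t; rewrite (qkernel_slice _ _ _ hv).
Qed.

End Bargmann.

(** * The transform as a windowed Fourier transform *)
Section Windowed.
Variable R : realType.
Local Notation mu := (@lebesgue_measure R).
Local Notation H := (quat R).

Lemma slice_mul (a b c d : R) (J : H) : J * J = -1 ->
  (a%:A + b *: J) * (c%:A + d *: J) = (a * c - b * d)%:A + (a * d + b * c) *: J.
Proof.
move=> hJ; rewrite mulrDl !mulrDr -!scalerAl -!scalerAr !mul1r !mulr1 hJ.
by apply: quat_ext => /=; ring.
Qed.

Lemma slice_comm (a b c d : R) (J : H) : J * J = -1 ->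
  (a%:A + b *: J) * (c%:A + d *: J) = (c%:A + d *: J) * (a%:A + b *: J).
Proof.
by move=> hJ; rewrite (slice_mul a b c d hJ) (slice_mul c d a b hJ); congr (_%:A + _ *: _); ring.
Qed.

Lemma gather_scalars (E X p : H) (a r e : R) :
  E * (a *: ((r *: X) * p)) * e%:A = (a * (r * e)) *: (E * X * p).
Proof.
by case: E X p => [? ? ? ?] [? ? ? ?] [? ? ? ?]; apply: quat_ext => /=; ring.
Qed.

Lemma split_rotation (J p : H) (a c s : R) :
  a *: ((c%:A - s *: J) * p) = c *: (a *: p) + - J * (s *: (a *: p)).
Proof.
by case: J p => [? ? ? ?] [? ? ? ?]; apply: quat_ext => /=; ring.
Qed.

(** Abstractly, D m is the family of derivatives of the kernel, [lambda] its
    logarithmic derivative and [m0] = - 2 pi conj(q).  The sum lambda + m0 is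
    real: this is why the polyanalytic combination of derivatives has a real
    Hermite polynomial in front of the kernel. *)
Section BinomialHermite.
Variables (lambda m0 : H) (D : nat -> H) (y : R).
Hypothesis comm_ml : m0 * lambda = lambda * m0.
Hypothesis sum_ml : lambda + m0 = (2 * pi * Num.sqrt 2 * y)%:A.
Hypothesis D_rec : forall m, D m.+1 = lambda * D m - (2 * pi * m%:R) *: D m.-1.

Let S j := \sum_(k < j.+1) 'C(j, k)%:R *: (m0 ^+ k * D (j - k)).

(** Pascal's rule splits S (j+1); the recurrence of D produces the lower term,
    as (j - k) C(j, k) = j C(j - 1, k). *)
Lemma binomial_sum_rec j : S j.+1 = (lambda + m0) * S j - (2 * pi * j%:R) *: S j.-1.
Proof.
have comm k : m0 ^+ k * lambda = lambda * m0 ^+ k.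
  by apply/esym; apply: commrX; exact: esym.
have -> : S j.+1 = (\sum_(k < j.+1) 'C(j, k)%:R *: (m0 ^+ k * D (j.+1 - k)))
    + \sum_(k < j.+1) 'C(j, k)%:R *: (m0 ^+ k.+1 * D (j - k)).
  rewrite {1}/S big_ord_recl bin0 expr0 subn0.
  under eq_bigr => k _ do rewrite /= /bump /= add1n binS natrD scalerDl subSS.
  rewrite big_split /= addrA; congr (_ + _).
  rewrite [in RHS]big_ord_recl bin0 expr0 subn0; congr (_ + _).
  rewrite big_ord_recr /= bin_small// scale0r addr0.
  by apply: eq_bigr => k _; rewrite /= /bump /= add1n subSS.
rewrite mulrDl addrAC; congr (_ + _); last first.
  rewrite /S mulr_sumr; apply: eq_bigr => k _.
  by rewrite -scalerAr exprS mulrA.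
have -> : \sum_(k < j.+1) 'C(j, k)%:R *: (m0 ^+ k * D (j.+1 - k)) =
   \sum_(k < j.+1) ('C(j, k)%:R *: (lambda * (m0 ^+ k * D (j - k)))) -
   \sum_(k < j.+1) ((2 * pi * ((j - k) * 'C(j, k))%:R) *: (m0 ^+ k * D (j - k).-1)).
  rewrite -sumrB; apply: eq_bigr => k _.
  have kj : (k <= j)%N by rewrite -ltnS.
  rewrite subSn// D_rec mulrBr (mulrA (m0 ^+ k)) comm -mulrA -scalerAr scalerBr scalerA.
  by congr (_ - _ *: _); rewrite natrM; ring.
congr (_ - _).
  by rewrite /S mulr_sumr; apply: eq_bigr => k _; rewrite -scalerAr.
case: j => [|j].
  by rewrite big_ord_recl big_ord0 subnn mul0n !mulr0 !scale0r addr0.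
rewrite big_ord_recr /= subnn mul0n !mulr0 scale0r addr0 /S scaler_sumr.
apply: eq_bigr => k _; rewrite -mul_bin_down scalerA natrM mulrA; congr (_ *: (_ * D _)).
by rewrite subSn ?succnK// -ltnS.
Qed.

Lemma binomial_sum_hermite j : S j = (hermite R j).[y] *: D 0.
Proof.
elim/nat_ind2: j => [|j IH1 IH2].
  by rewrite /S big_ord_recl big_ord0 bin0 expr0 mul1r addr0 hermite0 hornerC.
rewrite binomial_sum_rec sum_ml IH1 IH2 hermiteS !hornerE -scalerAl mul1r !scalerA.
by rewrite -scalerBl; congr (_ *: _); ring.
Qed.

End BinomialHermite.

Lemma true_poly_bargmann_slice j (phi : R -> H) (u v : R) (J : H) :
  qsqintegrable phi -> J * J = -1 ->
  qintegrable leb1 (fun t => (2 `^ (3 / 4) * window_coef R j * (hermite R j).[t - Num.sqrt 2 * u]) *: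
    (qkernel 0 u v J t * phi t)) /\
  true_poly_bargmann j phi (u%:A + v *: J) =
  qintegral leb1 (fun t => (2 `^ (3 / 4) * window_coef R j * (hermite R j).[t - Num.sqrt 2 * u]) *:
    (qkernel 0 u v J t * phi t)).
Proof.
move=> hp hJ; have [J0 _] := imag_unitP hJ.
pose m0 : H := (- (2 * pi) * u)%:A + (2 * pi * v) *: J.
(* - 2 pi conj(q) lies in the same slice as q, hence commutes with the kernel. *)
have m0E : - (2 * pi) *: qconj (u%:A + v *: J) = m0.
  by apply: quat_ext; rewrite /m0 /= ?J0; ring.
have intk (k : 'I_j.+1) := qintegrable_qkernel (j - k) u v J hp.
pose f (k : 'I_j.+1) t := 'C(j, k)%:R *: (m0 ^+ k * (qkernel (j - k) u v J t * phi t)).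
have intf k : qintegrable leb1 (f k).
  exact: (qintegralZ _ (qintegralMl (m0 ^+ k) (intk k)).1).1.
have [s1 s2] := qintegral_sum (index_enum 'I_j.+1) intf.
have E t : (2 `^ (3 / 4) * window_coef R j) *: (\sum_k f k t) =
   (2 `^ (3 / 4) * window_coef R j * (hermite R j).[t - Num.sqrt 2 * u]) *: (qkernel 0 u v J t * phi t).
  rewrite -[in RHS]scalerA; congr (_ *: _).
  rewrite scalerAl -(@binomial_sum_hermite ((slope_re u t)%:A + slope_im v *: J) m0
    (fun m => qkernel m u v J t)).
  - by rewrite mulr_suml; apply: eq_bigr => k _; rewrite /f -scalerAl mulrA.
  - exact: slice_comm.
  - have s2' : Num.sqrt 2 * Num.sqrt 2 = 2 :> R by rewrite -expr2 sqr_sqrtr.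
    rewrite /m0 /slope_re /slope_im mulrBr.
    rewrite (_ : 2 * pi * Num.sqrt 2 * (Num.sqrt 2 * u) = 2 * pi * 2 * u); last first.
      by transitivity (2 * pi * (Num.sqrt 2 * Num.sqrt 2) * u); [ring|rewrite s2'].
    by apply: quat_ext => /=; ring.
  - move=> m; rewrite /qkernel kreS kimS (slice_mul _ _ _ _ hJ).
    by apply: quat_ext => /=; ring.
have [z1 z2] := qintegralZ (2 `^ (3 / 4) * window_coef R j) s1.
have Ef : (fun t => (2 `^ (3 / 4) * window_coef R j) *: (\sum_k f k t)) =
   (fun t => (2 `^ (3 / 4) * window_coef R j * (hermite R j).[t - Num.sqrt 2 * u]) *: (qkernel 0 u v J t * phi t)).
  by apply/funext => t; exact: E.
rewrite -Ef; split => //; rewrite z2 s2 /true_poly_bargmann -/(window_coef R j).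
rewrite [2 `^ _ * _]mulrC -[RHS]scalerA; congr (_ *: _). rewrite scaler_sumr; apply: eq_bigr => k _.
rewrite m0E iter_slice_derive_bargmann// -scalerAr scalerA mulrC -scalerA; congr (_ *: _).
by rewrite (qintegralZ _ (qintegralMl (m0 ^+ k) (intk k)).1).2 (qintegralMl (m0 ^+ k) (intk k)).2.
Qed.

(** The function whose Fourier transform in t is the value at x of the
    transform. *)
Definition windowed n (phi : 'I_n.+1 -> R -> H) (x t : R) : H :=
  \sum_(j < n.+1) window j (t - x) *: phi j t.

Definition qcosT (F : R -> H) (w : R) : H := qintegral leb1 (fun t => cos (2 * pi * w * t) *: F t).
Definition qsinT (F : R -> H) (w : R) : H := qintegral leb1 (fun t => sin (2 * pi * w * t) *: F t).

Lemma sqintegrable_window j (x : R) : sqintegrable (fun t => window j (t - x)).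
Proof.
have [C hC] := window_bound R j.
have [m1 i1] := @sqintegrable_gauss_bounded R _ C (continuous_measurable_fun (@continuous_window R j)) hC.
have mx : measurable_fun setT (fun t : R => window j (t - x)).
  apply: (measurableT_comp m1); exact: measurable_funB.
split => //.
have [] := @integral_affine R 1 (- x) (fun y => window j y ^+ 2) ltr01 i1.
by under eq_fun do rewrite mul1r.
Qed.

Lemma bounded_window j : exists M, forall t : R, `|window j t| <= M.
Proof.
have [C hC] := window_bound R j; exists `|C| => t.
rewrite (le_trans (hC t))// (le_trans (ler_wpM2r (gauss_fun_ge0 _) (ler_norm C)))//.
by rewrite ler_piMr// gauss_fun_le1.
Qed.

Lemma sqintegrable_bounded_mul (f h : R -> R) (M : R) : sqintegrable f ->
  measurable_fun setT h -> (forall x, `|h x| <= M) -> sqintegrable (fun x => h x * f x).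
Proof.
move=> [mf f2] mh hM; split; first exact: measurable_funM.
have h2M x : `|h x ^+ 2| <= M ^+ 2.
  by rewrite normrX lerXn2r ?nnegrE// (le_trans _ (hM x)).
have := integrable_bounded_mul f2 (measurable_funX 2 mh) h2M.
by apply: eq_integrable => // x _; rewrite exprMn.
Qed.

Lemma sqintegrable_sum (I : Type) (s : seq I) (f : I -> R -> R) :
  (forall i, sqintegrable (f i)) -> sqintegrable (fun x => \sum_(i <- s) f i x).
Proof.
move=> sf; elim: s => [|i s IH].
  apply: (@eq_sqintegrable _ (fun=> 0)); first by move=> x; rewrite big_nil.
  by split => //; under eq_fun do rewrite expr0n; exact: integrable0.
by apply: eq_sqintegrable (sqintegrableD (sf i) IH) => x; rewrite big_cons.
Qed.

Lemma integrable_sum_real (I : Type) (s : seq I) (f : I -> R -> R) :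
  (forall i, mu.-integrable setT (EFin \o f i)) ->
  mu.-integrable setT (EFin \o (fun x => \sum_(i <- s) f i x)).
Proof.
move=> sf; elim: s => [|i s IH].
  by rewrite /comp; under eq_fun do rewrite big_nil; exact: integrable0.
rewrite /comp; under eq_fun do rewrite big_cons.
exact: (integrableD measurableT (sf i) IH).
Qed.

Lemma windowed_real_integrable n (f : 'I_n.+1 -> R -> R) (x : R) : (forall j, sqintegrable (f j)) ->
  mu.-integrable setT (EFin \o (fun t => \sum_(j < n.+1) window j (t - x) * f j t)) /\
  sqintegrable (fun t => \sum_(j < n.+1) window j (t - x) * f j t).
Proof.
move=> sf; split.
  apply: integrable_sum_real => j.
  exact: (sqintegrable_mul (sqintegrable_window j x) (sf j)).
apply: sqintegrable_sum => j; have [M hM] := bounded_window j.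
apply: sqintegrable_bounded_mul (fun t => hM (t - x)) => //.
exact: (sqintegrable_window j x).1.
Qed.

Lemma windowed_comp n (phi : 'I_n.+1 -> R -> H) (x t : R) :
  windowed phi x t = Quat (\sum_(j < n.+1) window j (t - x) * qre (phi j t))
    (\sum_(j < n.+1) window j (t - x) * qi (phi j t))
    (\sum_(j < n.+1) window j (t - x) * qj (phi j t))
    (\sum_(j < n.+1) window j (t - x) * qk (phi j t)).
Proof.
by apply: quat_ext; rewrite /= ?qre_sum ?qi_sum ?qj_sum ?qk_sum.
Qed.

Lemma qcosT_comp n (phi : 'I_n.+1 -> R -> H) (x w : R) :
  qcosT (windowed phi x) w =
  Quat (cosT (fun t => \sum_(j < n.+1) window j (t - x) * qre (phi j t)) w)
       (cosT (fun t => \sum_(j < n.+1) window j (t - x) * qi (phi j t)) w)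
       (cosT (fun t => \sum_(j < n.+1) window j (t - x) * qj (phi j t)) w)
       (cosT (fun t => \sum_(j < n.+1) window j (t - x) * qk (phi j t)) w).
Proof.
by apply: quat_ext => /=; rewrite /cosT; apply: eq_Rintegral => t _; rewrite windowed_comp.
Qed.

Lemma qsinT_comp n (phi : 'I_n.+1 -> R -> H) (x w : R) :
  qsinT (windowed phi x) w =
  Quat (sinT (fun t => \sum_(j < n.+1) window j (t - x) * qre (phi j t)) w)
       (sinT (fun t => \sum_(j < n.+1) window j (t - x) * qi (phi j t)) w)
       (sinT (fun t => \sum_(j < n.+1) window j (t - x) * qj (phi j t)) w)
       (sinT (fun t => \sum_(j < n.+1) window j (t - x) * qk (phi j t)) w).
Proof.
by apply: quat_ext => /=; rewrite /sinT; apply: eq_Rintegral => t _; rewrite windowed_comp.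
Qed.

Lemma qintegrable_cos_sin n (phi : 'I_n.+1 -> R -> H) (x w : R) :
  (forall j, qsqintegrable (phi j)) ->
  qintegrable leb1 (fun t => cos (2 * pi * w * t) *: windowed phi x t) /\
  qintegrable leb1 (fun t => sin (2 * pi * w * t) *: windowed phi x t).
Proof.
move=> hp.
have h1 j : sqintegrable (fun t => qre (phi j t)) by case: (hp j).
have [i1 _] := windowed_real_integrable x h1.
have h2 j : sqintegrable (fun t => qi (phi j t)) by case: (hp j).
have [i2 _] := windowed_real_integrable x h2.
have h3 j : sqintegrable (fun t => qj (phi j t)) by case: (hp j).
have [i3 _] := windowed_real_integrable x h3.
have h4 j : sqintegrable (fun t => qk (phi j t)) by case: (hp j).
have [i4 _] := windowed_real_integrable x h4.
split; split; under eq_fun do rewrite windowed_comp /=.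
- exact: (integrable_cosT w i1).
- exact: (integrable_cosT w i2).
- exact: (integrable_cosT w i3).
- exact: (integrable_cosT w i4).
- exact: (integrable_sinT w i1).
- exact: (integrable_sinT w i2).
- exact: (integrable_sinT w i3).
- exact: (integrable_sinT w i4).
Qed.

(** Evaluating at u + v I with u = x / sqrt 2 and v = - w / sqrt 2, the point
    conj(q) / sqrt 2, the moduli combine to exp (- pi (t - x)^2) and the phase
    of the kernel with the prefactor to exp (- 2 pi w t I). *)
Lemma full_poly_qstft_windowed (I : H) n (phi : 'I_n.+1 -> R -> H) (x w : R) :
  I * I = -1 -> (forall j, qsqintegrable (phi j)) ->
  full_poly_qstft I phi (x, w) =
  qcosT (windowed phi x) w - I * qsinT (windowed phi x) w.
Proof.
move=> hI hp; have [I0 I1] := imag_unitP hI.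
pose u := (Num.sqrt 2)^-1 * x; pose v := - ((Num.sqrt 2)^-1 * w).
have s0 : Num.sqrt 2 != 0 :> R by rewrite sqrtr_eq0 -ltNge.
have s2 : Num.sqrt 2 * Num.sqrt 2 = 2 :> R by rewrite -expr2 sqr_sqrtr.
have qE : (Num.sqrt 2)^-1 *: qconj (x%:A + w *: I) = u%:A + v *: I.
  by apply: quat_ext; rewrite /u /v /= ?I0; ring.
have nq : qnorm (x%:A + w *: I) ^+ 2 = x ^+ 2 + w ^+ 2.
  rewrite qnorm_sq -[w ^+ 2]mulr1 -I1 /qnormsq /= I0; ring.
rewrite /full_poly_qstft /= nq qE /full_poly_bargmann.
pose g (j : 'I_n.+1) t := (2 `^ (3 / 4) * window_coef R j * (hermite R j).[t - Num.sqrt 2 * u]) *: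
    (qkernel 0 u v I t * phi j t).
have intg j : qintegrable leb1 (g j).
  exact: (true_poly_bargmann_slice j u v (hp j) hI).1.
have -> : \sum_(j < n.+1) true_poly_bargmann j (phi j) (u%:A + v *: I) = qintegral leb1 (fun t => \sum_(j < n.+1) g j t).
  rewrite (qintegral_sum (index_enum 'I_n.+1) intg).2; apply: eq_bigr => j _.
  exact: (true_poly_bargmann_slice j u v (hp j) hI).2.
have intsum := (qintegral_sum (index_enum 'I_n.+1) intg).1.
have [ic iS] := qintegrable_cos_sin x w hp.
have [iIs eIs] := qintegralMl (- I) iS.
have -> : qcosT (windowed phi x) w - I * qsinT (windowed phi x) w =
   qintegral leb1 (fun t => cos (2 * pi * w * t) *: windowed phi x t + - I * (sin (2 * pi * w * t) *: windowed phi x t)).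
  by rewrite qintegralD// eIs mulNr.
set E1 := qexp _; set e2 := expR _.
have [l1 l2] := qintegralMl E1 intsum.
rewrite -l2 -(qintegralMr (e2%:A) l1).2; apply: eq_qintegral => t.
have E1E : E1 = (cos (pi * x * w))%:A + (- sin (pi * x * w)) *: I.
  have := qexpE 0 (- (pi * x * w)) hI.
  by rewrite scale0r add0r expR0 !mul1r cosN sinN.
have key (j : 'I_n.+1) : E1 * g j t * e2%:A =
    window j (t - x) *: (((cos (2 * pi * w * t))%:A - sin (2 * pi * w * t) *: I) * phi j t).
  pose r := expR (- pi * (u ^+ 2 - v ^+ 2 + t ^+ 2) + 2 * pi * Num.sqrt 2 * t * u).
  have re2 : r * e2 = expR (- (pi * (t - x) ^+ 2)).
    rewrite /r /e2 -expRD; congr expR.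
    have i2 : (Num.sqrt 2)^-1 * (Num.sqrt 2)^-1 = 2^-1 :> R by rewrite -invfM s2.
    have u2 : u ^+ 2 = x ^+ 2 / 2 by rewrite /u expr2 mulrACA i2 mulrC -expr2.
    have v2 : v ^+ 2 = w ^+ 2 / 2 by rewrite /v sqrrN expr2 mulrACA i2 mulrC -expr2.
    have su : Num.sqrt 2 * t * u = x * t by rewrite /u; field.
    rewrite u2 v2 -!mulrA [Num.sqrt 2 * _]mulrA su.
    by move: (pi : R) => P; field.
  have hx : Num.sqrt 2 * u = x by rewrite /u; field.
  have th : v * slope_re u t = pi * x * w - 2 * pi * w * t.
    rewrite /v /slope_re /u.
    have -> : - ((Num.sqrt 2)^-1 * w) * (2 * pi * Num.sqrt 2 * t - 2 * pi * ((Num.sqrt 2)^-1 * x)) =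
      - (2 * pi * w * t) + 2 * pi * w * x / (Num.sqrt 2 * Num.sqrt 2).
      by move: (pi : R) s0; move: (Num.sqrt 2 : R) => s P s0'; field.
    by rewrite s2; move: (pi : R) => P; field.
  have K0 : qkernel 0 u v I t = r *: ((cos (v * slope_re u t))%:A + sin (v * slope_re u t) *: I).
    by rewrite /qkernel /kre /kim /= -/r scalerDr !scalerA.
  have tr : E1 * ((cos (v * slope_re u t))%:A + sin (v * slope_re u t) *: I) =
      (cos (2 * pi * w * t))%:A - sin (2 * pi * w * t) *: I.
    have c2 : 2 * pi * w * t = pi * x * w - v * slope_re u t by rewrite th; ring.
    rewrite E1E c2 cosB sinB (slice_mul _ _ _ _ hI).
    by apply: quat_ext => /=; ring.
  rewrite -tr /window -re2 /g K0 hx.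
  by rewrite (mulrA (2 `^ (3 / 4) * window_coef R j)); exact: gather_scalars.
rewrite mulr_sumr mulr_suml; under eq_bigr do rewrite key.
rewrite /windowed !scaler_sumr mulr_sumr -big_split /=; apply: eq_bigr => j _.
exact: split_rotation.
Qed.

End Windowed.

(** * The isometry and its polarization *)
Section Isometry.
Variable R : realType.
Local Notation mu := (@lebesgue_measure R).
Local Notation RR := (measurableTypeR R).
Local Notation H := (quat R).

Lemma measurable_windowed_real n (f : 'I_n.+1 -> R -> R) (d : measure_display)
    (T : measurableType d) (x t : T -> RR) :
  (forall j, sqintegrable (f j)) -> measurable_fun setT x -> measurable_fun setT t ->
  measurable_fun setT (fun z => \sum_(j < n.+1) window j (t z - x z) * f j (t z)).
Proof.
move=> sf mx mt; apply: measurable_sum => j.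
have mw : measurable_fun setT (window j : RR -> RR).
  exact: continuous_measurable_fun (@continuous_window R j).
have mtx : measurable_fun setT (fun z => t z - x z : RR).
  exact: measurable_funB.
have m1 := measurableT_comp mw mtx.
have m2 := measurableT_comp (sf j).1 mt.
exact: (measurable_funM m1 m2).
Qed.

(** Joint measurability in (x, w), which Tonelli's theorem requires. *)
Lemma measurable_windowed_cosT n (f : 'I_n.+1 -> R -> R) :
  (forall j, sqintegrable (f j)) ->
  measurable_fun setT (fun z : RR * RR =>
    cosT (fun t => \sum_(j < n.+1) window j (t - z.1) * f j t) z.2) /\
  measurable_fun setT (fun z : RR * RR =>
    sinT (fun t => \sum_(j < n.+1) window j (t - z.1) * f j t) z.2).
Proof.
move=> sf.
have m1 : measurable_fun setT (fun z : (RR * RR) * RR => z.1.1).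
  exact: (measurableT_comp measurable_fst measurable_fst).
have m2 : measurable_fun setT (fun z : (RR * RR) * RR => z.1.2).
  exact: (measurableT_comp measurable_snd measurable_fst).
have m3 : measurable_fun setT (fun z : (RR * RR) * RR => z.2).
  exact: measurable_snd.
have mF := measurable_windowed_real sf m1 m3.
have ma : measurable_fun setT (fun z : (RR * RR) * RR => 2 * pi * z.1.2 * z.2).
  have mc : measurable_fun setT (fun z : (RR * RR) * RR => 2 * pi * z.1.2).
    exact: (measurable_funM (measurable_cst _) m2).
  exact: (measurable_funM mc m3).
split.
  apply: (@measurable_integral_param R _ (RR * RR)%type (fun (z : RR * RR) (t : R) =>
    cos (2 * pi * z.2 * t) * \sum_(j < n.+1) window j (t - z.1) * f j t)).
  exact: (measurable_funM (measurable_cos_comp ma) mF).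
apply: (@measurable_integral_param R _ (RR * RR)%type (fun (z : RR * RR) (t : R) =>
    sin (2 * pi * z.2 * t) * \sum_(j < n.+1) window j (t - z.1) * f j t)).
exact: (measurable_funM (measurable_sin_comp ma) mF).
Qed.

Lemma window_correlation i j (t : R) :
  mu.-integrable setT (fun x => (window i (t - x) * window j (t - x))%:E) /\
  \int[mu]_x (window i (t - x) * window j (t - x)) = if i == j then 2 else 0.
Proof.
have sw k : sqintegrable (@window R k).
  have [C hC] := window_bound R k.
  exact: sqintegrable_gauss_bounded (continuous_measurable_fun (@continuous_window R k)) hC.
have iw := sqintegrable_mul (sw i) (sw j).
have [a1 a2] := @integral_affine R 1 t (fun y => window i y * window j y) ltr01 iw.
have [b1 b2] := integral_reflect a1.
have E x : 1 * - x + t = t - x by rewrite mul1r addrC.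
split; first by move: b1; under eq_fun do rewrite E.
rewrite -window_orthogonal a2 mul1r b2.
by apply: eq_Rintegral => x _; rewrite E.
Qed.

Lemma Rintegral_sum_real (J : Type) (s : seq J) (f : J -> R -> R) :
  (forall i, mu.-integrable setT (EFin \o f i)) ->
  \int[mu]_x (\sum_(i <- s) f i x) = \sum_(i <- s) \int[mu]_x f i x.
Proof.
move=> sf; elim: s => [|i s IH].
  by rewrite big_nil /Rintegral; under eq_integral do rewrite big_nil; rewrite integral0.
rewrite big_cons -IH; under eq_Rintegral do rewrite big_cons.
by rewrite RintegralD//; exact: integrable_sum_real.
Qed.

(** For fixed t the translates x |-> window j (t - x) are orthogonal of squared
    norm 2. *)
Lemma window_parseval_real n (a : 'I_n.+1 -> R) (t : R) :
  mu.-integrable setT (fun x => ((\sum_(j < n.+1) window j (t - x) * a j) ^+ 2)%:E) /\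
  \int[mu]_x (\sum_(j < n.+1) window j (t - x) * a j) ^+ 2 = 2 * \sum_j a j ^+ 2.
Proof.
pose g (i j : 'I_n.+1) (x : R) := a i * a j * (window i (t - x) * window j (t - x)).
have ig i j : mu.-integrable setT (EFin \o g i j).
  exact: (integrableZl measurableT (a i * a j) (window_correlation i j t).1).
have E (x : R) : (\sum_(j < n.+1) window j (t - x) * a j) ^+ 2 = \sum_i \sum_j g i j x.
  rewrite expr2 mulr_suml; apply: eq_bigr => i _; rewrite mulr_sumr.
  by apply: eq_bigr => j _; rewrite /g; ring.
have ii i : mu.-integrable setT (EFin \o (fun x => \sum_j g i j x)).
  exact: (integrable_sum_real _ (ig i)).
split.
  under eq_fun do rewrite E.
  exact: (integrable_sum_real _ ii).
under eq_Rintegral do rewrite E.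
rewrite Rintegral_sum_real//; under eq_bigr do rewrite Rintegral_sum_real//.
rewrite mulr_sumr; apply: eq_bigr => i _.
rewrite (bigD1 i)//= big1 => [|j ji].
  rewrite /g RintegralZl//; last exact: (window_correlation i i t).1.
  by rewrite (window_correlation i i t).2 eqxx addr0 mulrC expr2.
rewrite /g RintegralZl//; last exact: (window_correlation i j t).1.
rewrite (window_correlation i j t).2 ifF ?mulr0//.
by apply/negbTE; rewrite eq_sym.
Qed.

Lemma integral_sum4 (d : measure_display) (T : measurableType d)
    (nu : {measure set T -> \bar R}) (f1 f2 f3 f4 : T -> R) :
  measurable_fun setT f1 -> measurable_fun setT f2 ->
  measurable_fun setT f3 -> measurable_fun setT f4 ->
  (forall x, 0 <= f1 x) -> (forall x, 0 <= f2 x) -> (forall x, 0 <= f3 x) -> (forall x, 0 <= f4 x) ->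
  (\int[nu]_x (f1 x + f2 x + f3 x + f4 x)%:E =
   \int[nu]_x (f1 x)%:E + \int[nu]_x (f2 x)%:E + \int[nu]_x (f3 x)%:E + \int[nu]_x (f4 x)%:E)%E.
Proof.
move=> m1 m2 m3 m4 p1 p2 p3 p4.
have add (f g : T -> R) : measurable_fun setT f -> measurable_fun setT g ->
   (forall x, 0 <= f x) -> (forall x, 0 <= g x) ->
   (\int[nu]_x (f x + g x)%:E = \int[nu]_x (f x)%:E + \int[nu]_x (g x)%:E)%E.
  move=> mf mg f0 g0; under eq_integral do rewrite EFinD.
  rewrite ge0_integralD//.
  - by move=> x _; rewrite lee_fin.
  - by apply/measurable_EFinP; exact: mf.
  - by move=> x _; rewrite lee_fin.
  - by apply/measurable_EFinP; exact: mg.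
have m12 := measurable_funD m1 m2; have m123 := measurable_funD m12 m3.
have p12 x : 0 <= f1 x + f2 x by rewrite addr_ge0.
have p123 x : 0 <= f1 x + f2 x + f3 x by rewrite addr_ge0.
by rewrite (add _ _ m123 m4 p123 p4) (add _ _ m12 m3 p12 p3) (add _ _ m1 m2 p1 p2).
Qed.

Lemma double_ereal (A B : \bar R) : (A + A = B + B -> A = B)%E.
Proof.
case: A => [a| |]; case: B => [b| |] //=.
by rewrite -!EFinD => -[h]; congr (_%:E); lra.
Qed.

(** Doubling avoids halving an integral that may be infinite. *)
Lemma double_integral_reflect (f : R -> R) : measurable_fun setT f -> (forall x, 0 <= f x) ->
  (\int[mu]_x (f x)%:E + \int[mu]_x (f x)%:E = \int[mu]_x (f x + f (- x))%:E)%E.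
Proof.
move=> mf f0; have mfE : measurable_fun setT (EFin \o f) by apply/measurable_EFinP.
have f0E x : (0 <= (EFin \o f) x)%E by rewrite lee_fin.
have mfN : measurable_fun setT (fun x : R => (EFin \o f) (- x)).
  by apply: (measurableT_comp mfE); exact: oppr_measurable.
rewrite [X in (_ + X)%E](ge0_integral_reflect mfE f0E).
by rewrite -(ge0_integralD mu measurableT (fun x _ => f0E x) mfE (fun x _ => f0E (- x)) mfN).
Qed.

(** The parallelogram identity, left multiplication by J being an isometry. *)
Lemma qnormsq_rotation (J p q : H) : J * J = -1 ->
  qnormsq (p - J * q) + qnormsq (p + J * q) = 2 * (qnormsq p + qnormsq q).
Proof.
move=> hJ; have [_ J1] := imag_unitP hJ.
have par (a b : H) : qnormsq (a - b) + qnormsq (a + b) = 2 * (qnormsq a + qnormsq b).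
  by rewrite /qnormsq /=; ring.
by rewrite par qnormsqM J1 mul1r.
Qed.

Section Energy.
Variables (I : H) (n : nat) (phi : 'I_n.+1 -> R -> H).
Hypothesis hI : I * I = -1.
Hypothesis sq_phi : forall j, qsqintegrable (phi j).

Let sq1 j : sqintegrable (fun t => qre (phi j t)). Proof. by case: (sq_phi j). Qed.
Let sq2 j : sqintegrable (fun t => qi (phi j t)). Proof. by case: (sq_phi j). Qed.
Let sq3 j : sqintegrable (fun t => qj (phi j t)). Proof. by case: (sq_phi j). Qed.
Let sq4 j : sqintegrable (fun t => qk (phi j t)). Proof. by case: (sq_phi j). Qed.

Lemma qmeasurable_stft :
  @qmeasurable R _ (RR * RR)%type (full_poly_qstft I phi).
Proof.
have [c1 s1] := measurable_windowed_cosT sq1; have [c2 s2] := measurable_windowed_cosT sq2.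
have [c3 s3] := measurable_windowed_cosT sq3; have [c4 s4] := measurable_windowed_cosT sq4.
have lin (a b c e : R) (f0 f1 f2 f3 f4 : RR * RR -> R) :
    measurable_fun setT f0 -> measurable_fun setT f1 -> measurable_fun setT f2 ->
    measurable_fun setT f3 -> measurable_fun setT f4 ->
    measurable_fun setT (fun z => f0 z + a * f1 z + b * f2 z + c * f3 z + e * f4 z).
  move=> m0 m1 m2 m3 m4.
  have k1 := measurable_funM (measurable_cst a) m1.
  have k2 := measurable_funM (measurable_cst b) m2.
  have k3 := measurable_funM (measurable_cst c) m3.
  have k4 := measurable_funM (measurable_cst e) m4.
  exact: (measurable_funD (measurable_funD (measurable_funD (measurable_funD m0 k1) k2) k3) k4).
have E z : full_poly_qstft I phi z = qcosT (windowed phi z.1) z.2 - I * qsinT (windowed phi z.1) z.2.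
  by case: z => x w; exact: full_poly_qstft_windowed.
split; under eq_fun do rewrite E qcosT_comp qsinT_comp /=.
- have := lin (- qre I) (qi I) (qj I) (qk I) _ _ _ _ _ c1 s1 s2 s3 s4.
  by apply: eq_measurable_fun => z _; rewrite qreM /=; ring.
- have := lin (- qre I) (- qi I) (- qj I) (qk I) _ _ _ _ _ c2 s2 s1 s4 s3.
  by apply: eq_measurable_fun => z _; rewrite qiM /=; ring.
- have := lin (- qre I) (qi I) (- qj I) (- qk I) _ _ _ _ _ c3 s3 s4 s1 s2.
  by apply: eq_measurable_fun => z _; rewrite qjM /=; ring.
- have := lin (- qre I) (- qi I) (qj I) (- qk I) _ _ _ _ _ c4 s4 s3 s2 s1.
  by apply: eq_measurable_fun => z _; rewrite qkM /=; ring.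
Qed.

Lemma measurable_qnormsq (d : measure_display) (T : measurableType d) (f : T -> H) :
  qmeasurable f -> measurable_fun setT (fun x => qnormsq (f x)).
Proof.
move=> [m1 m2 m3 m4].
exact: (measurable_funD (measurable_funD (measurable_funD (measurable_funX 2 m1)
  (measurable_funX 2 m2)) (measurable_funX 2 m3)) (measurable_funX 2 m4)).
Qed.

(** The cosine transform is even and the sine transform odd in w, so the cross
    terms of the two squared norms cancel. *)
Lemma stft_reflect_energy (x w : R) :
  qnormsq (full_poly_qstft I phi (x, w)) + qnormsq (full_poly_qstft I phi (x, - w)) =
  2 * (spectrum (fun t => \sum_(j < n.+1) window j (t - x) * qre (phi j t)) w +
       spectrum (fun t => \sum_(j < n.+1) window j (t - x) * qi (phi j t)) w +
       spectrum (fun t => \sum_(j < n.+1) window j (t - x) * qj (phi j t)) w +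
       spectrum (fun t => \sum_(j < n.+1) window j (t - x) * qk (phi j t)) w).
Proof.
rewrite !full_poly_qstft_windowed//.
have -> : qcosT (windowed phi x) (- w) = qcosT (windowed phi x) w.
  by apply: eq_qintegral => t; rewrite mulrN mulNr cosN.
have -> : qsinT (windowed phi x) (- w) = - qsinT (windowed phi x) w.
  have [_ si] := qintegrable_cos_sin x w sq_phi.
  transitivity (-1 *: qsinT (windowed phi x) w); last by rewrite scaleN1r.
  rewrite -(qintegralZ (- 1) si).2; apply: eq_qintegral => t.
  by rewrite mulrN mulNr sinN scalerA mulN1r.
rewrite mulrN opprK qnormsq_rotation// qcosT_comp qsinT_comp /qnormsq /spectrum /=; ring.
Qed.

Lemma windowed_qmeasurable :
  qmeasurable (fun z : RR * RR => windowed phi z.1 z.2).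
Proof.
have m1 : measurable_fun setT (fun z : RR * RR => z.1) by exact: measurable_fst.
have m2 : measurable_fun setT (fun z : RR * RR => z.2) by exact: measurable_snd.
split; under eq_fun do rewrite windowed_comp /=.
- exact: (measurable_windowed_real sq1 m1 m2).
- exact: (measurable_windowed_real sq2 m1 m2).
- exact: (measurable_windowed_real sq3 m1 m2).
- exact: (measurable_windowed_real sq4 m1 m2).
Qed.

Lemma stft_energy_slice (x : R) :
  (\int[mu]_w (qnormsq (full_poly_qstft I phi (x, w)))%:E =
   \int[mu]_t (qnormsq (windowed phi x t))%:E)%E.
Proof.
have [i1 q1] := windowed_real_integrable x sq1; have [i2 q2] := windowed_real_integrable x sq2.
have [i3 q3] := windowed_real_integrable x sq3; have [i4 q4] := windowed_real_integrable x sq4.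
have mV : measurable_fun setT (fun w : RR => qnormsq (full_poly_qstft I phi (x, w))).
  exact: (measurableT_comp (measurable_qnormsq qmeasurable_stft) (measurable_pair1 x)).
apply: double_ereal.
rewrite (double_integral_reflect mV (fun w => qnormsq_ge0 (full_poly_qstft I phi (x, w)))).
pose S w := spectrum (fun t => \sum_(j < n.+1) window j (t - x) * qre (phi j t)) w +
       spectrum (fun t => \sum_(j < n.+1) window j (t - x) * qi (phi j t)) w +
       spectrum (fun t => \sum_(j < n.+1) window j (t - x) * qj (phi j t)) w +
       spectrum (fun t => \sum_(j < n.+1) window j (t - x) * qk (phi j t)) w.
have m1 := measurable_spectrum q1.1; have m2 := measurable_spectrum q2.1.
have m3 := measurable_spectrum q3.1; have m4 := measurable_spectrum q4.1.
have mS : measurable_fun setT (fun w : RR => (S w)%:E).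
  apply/measurable_EFinP.
  exact: (measurable_funD (measurable_funD (measurable_funD m1 m2) m3) m4).
have S0 (w : RR) : setT w -> (0 <= (S w)%:E)%E.
  move=> _; rewrite lee_fin; apply: addr_ge0; last exact: spectrum_ge0.
  by apply: addr_ge0; [apply: addr_ge0|]; exact: spectrum_ge0.
have SE : (\int[mu]_w (S w)%:E = \int[mu]_t (qnormsq (windowed phi x t))%:E)%E.
  rewrite /S integral_sum4//; try exact: spectrum_ge0.
  rewrite (plancherel i1 q1) (plancherel i2 q2) (plancherel i3 q3) (plancherel i4 q4).
  rewrite -integral_sum4; try (by move=> t; rewrite sqr_ge0).
  - by apply: eq_integral => t _; rewrite windowed_comp.
  - exact: (measurable_funX 2 q1.1).
  - exact: (measurable_funX 2 q2.1).
  - exact: (measurable_funX 2 q3.1).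
  - exact: (measurable_funX 2 q4.1).
rewrite -SE -(ge0_integralD _ measurableT S0 mS S0 mS); apply: eq_integral => w _.
by rewrite -EFinD stft_reflect_energy -/(S w) mulr_natl mulr2n.
Qed.

Lemma window_parseval (p : 'I_n.+1 -> H) (t : R) :
  (\int[mu]_x (qnormsq (\sum_(j < n.+1) window j (t - x) *: p j))%:E =
   (2 * \sum_j qnormsq (p j))%:E)%E.
Proof.
have E x : qnormsq (\sum_(j < n.+1) window j (t - x) *: p j) =
    (\sum_(j < n.+1) window j (t - x) * qre (p j)) ^+ 2 +
    (\sum_(j < n.+1) window j (t - x) * qi (p j)) ^+ 2 +
    (\sum_(j < n.+1) window j (t - x) * qj (p j)) ^+ 2 +
    (\sum_(j < n.+1) window j (t - x) * qk (p j)) ^+ 2.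
  by rewrite /qnormsq qre_sum qi_sum qj_sum qk_sum.
under eq_integral do rewrite E.
have [i1 e1] := window_parseval_real (fun j => qre (p j)) t.
have [i2 e2] := window_parseval_real (fun j => qi (p j)) t.
have [i3 e3] := window_parseval_real (fun j => qj (p j)) t.
have [i4 e4] := window_parseval_real (fun j => qk (p j)) t.
rewrite integral_sum4; try (exact: integrable_measurable) ; try (by move=> x; rewrite sqr_ge0).
have fin (f : R -> R) c : mu.-integrable setT (EFin \o f) -> \int[mu]_x f x = c ->
    (\int[mu]_x (f x)%:E = c%:E)%E.
  by move=> fi <-; rewrite /Rintegral fineK// integrable_fin_num.
rewrite (fin _ _ i1 e1) (fin _ _ i2 e2) (fin _ _ i3 e3) (fin _ _ i4 e4) -!EFinD.
by rewrite -!mulrDr -!big_split.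
Qed.

Lemma stft_energy :
  (\int[@leb2 R]_z (qnormsq (full_poly_qstft I phi z))%:E =
   \int[mu]_t (2 * \sum_j qnormsq (phi j t))%:E)%E.
Proof.
have mV : measurable_fun setT (fun z : RR * RR => (qnormsq (full_poly_qstft I phi z))%:E).
  by apply/measurable_EFinP; exact: (measurable_qnormsq qmeasurable_stft).
rewrite [LHS](@fubini_tonelli1 _ _ _ _ _ mu mu _ mV); last by move=> z; rewrite lee_fin qnormsq_ge0.
have mW : measurable_fun setT (fun z : RR * RR => (qnormsq (windowed phi z.1 z.2))%:E).
  by apply/measurable_EFinP; exact: (measurable_qnormsq windowed_qmeasurable).
transitivity (\int[mu]_x \int[mu]_t (qnormsq (windowed phi x t))%:E)%E.
  by apply: eq_integral => x _; exact: stft_energy_slice.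
rewrite (@fubini_tonelli _ _ _ _ _ mu mu _ mW); last by move=> z; rewrite lee_fin qnormsq_ge0.
apply: eq_integral => t _; rewrite -(window_parseval (phi^~ t) t).
by apply: eq_integral => x _.
Qed.

End Energy.

Lemma qL2_qsqintegrable (phi : R -> H) : qL2 leb1 phi -> qsqintegrable phi.
Proof.
move=> [[m1 m2 m3 m4] fin].
have sq (f : R -> R) : measurable_fun setT (f : RR -> R) ->
    (forall t, f t ^+ 2 <= qnormsq (phi t)) -> sqintegrable f.
  move=> mf fle; split => //; apply/integrableP; split.
    by apply/measurable_EFinP; exact: (measurable_funX 2 mf).
  apply: le_lt_trans fin; apply: ge0_le_integral => //.
  - by apply/measurable_EFinP; apply: measurableT_comp => //; exact: (measurable_funX 2 mf).
  - under eq_fun do rewrite qnorm_sq.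
    by apply/measurable_EFinP; exact: (measurable_qnormsq (And4 m1 m2 m3 m4)).
  - by move=> t _; rewrite lee_fin qnorm_sq ger0_norm ?sqr_ge0.
have p2 (x : R) := sqr_ge0 x.
split; apply: sq => // t; rewrite /qnormsq.
- by rewrite -!addrA lerDl !addr_ge0.
- by rewrite -addrA [X in _ <= X + _]addrC -addrA lerDl !addr_ge0.
- by rewrite [X in _ <= X + _]addrC -addrA lerDl !addr_ge0.
- by rewrite lerDr !addr_ge0.
Qed.

Lemma qsqintegrableD (phi psi : R -> H) : qsqintegrable phi -> qsqintegrable psi ->
  qsqintegrable (fun t => phi t + psi t).
Proof.
by move=> [p1 p2 p3 p4] [q1 q2 q3 q4]; split; exact: sqintegrableD.
Qed.

Lemma qsqintegrableMr (c : H) (phi : R -> H) : qsqintegrable phi ->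
  qsqintegrable (fun t => phi t * c).
Proof.
case: c => c1 c2 c3 c4 [i1 i2 i3 i4]; split.
- apply: eq_sqintegrable (sqintegrable_lin4 c1 (- c2) (- c3) (- c4) i1 i2 i3 i4).
  by move=> x; rewrite qreM /=; ring.
- apply: eq_sqintegrable (sqintegrable_lin4 c2 c1 c4 (- c3) i1 i2 i3 i4).
  by move=> x; rewrite qiM /=; ring.
- apply: eq_sqintegrable (sqintegrable_lin4 c3 (- c4) c1 c2 i1 i2 i3 i4).
  by move=> x; rewrite qjM /=; ring.
- apply: eq_sqintegrable (sqintegrable_lin4 c4 c3 (- c2) c1 i1 i2 i3 i4).
  by move=> x; rewrite qkM /=; ring.
Qed.

Lemma integrable_qnormsq (phi : R -> H) : qsqintegrable phi ->
  mu.-integrable setT (fun t => (qnormsq (phi t))%:E).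
Proof.
move=> [[_ i1] [_ i2] [_ i3] [_ i4]].
exact: (integrableD measurableT (integrableD measurableT (integrableD measurableT i1 i2) i3) i4).
Qed.

(** The real part of conj(b) a is the Euclidean scalar product of a and b. *)
Lemma integral_polarization (d : measure_display) (T : measurableType d)
    (nu : {measure set T -> \bar R}) (f g : T -> H) :
  nu.-integrable setT (fun x => (qnormsq (f x))%:E) ->
  nu.-integrable setT (fun x => (qnormsq (g x))%:E) ->
  nu.-integrable setT (fun x => (qnormsq (f x + g x))%:E) ->
  \int[nu]_x qre (qconj (g x) * f x) =
  2^-1 * (\int[nu]_x qnormsq (f x + g x) - \int[nu]_x qnormsq (f x) - \int[nu]_x qnormsq (g x)).
Proof.
move=> jf jg jfg.
have i1 := integrableB measurableT jfg jf.
have i2 := integrableB measurableT i1 jg.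
rewrite -(RintegralB measurableT jfg jf) -(RintegralB measurableT i1 jg).
rewrite -(RintegralZl _ measurableT i2).
by apply: eq_Rintegral => x _; rewrite qreM /qnormsq /=; field.
Qed.

Section Inner.
Variables (I : H) (n : nat).
Hypothesis hI : I * I = -1.
Implicit Types phi psi : 'I_n.+1 -> R -> H.

Lemma stft_energy_real phi : (forall j, qsqintegrable (phi j)) ->
  (@leb2 R).-integrable setT (fun z => (qnormsq (full_poly_qstft I phi z))%:E) /\
  \int[@leb2 R]_z qnormsq (full_poly_qstft I phi z) =
  2 * \sum_j \int[mu]_t qnormsq (phi j t).
Proof.
move=> sp; have E := stft_energy hI sp.
have ij j := integrable_qnormsq (sp j).
have isum := integrable_sum_real (index_enum 'I_n.+1) ij.
have i2 := integrableZl measurableT 2 isum.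
have RE : \int[mu]_t (2 * \sum_j qnormsq (phi j t)) = 2 * \sum_j \int[mu]_t qnormsq (phi j t).
  by rewrite RintegralZl// Rintegral_sum_real.
split.
  apply/integrableP; split.
    by apply/measurable_EFinP; exact: (measurable_qnormsq (qmeasurable_stft hI sp)).
  under eq_integral do rewrite gee0_abs ?lee_fin ?qnormsq_ge0//.
  by rewrite E; have /integrable_fin_num := i2; rewrite fin_numElt => /(_ measurableT)/andP[].
by rewrite -RE /Rintegral E.
Qed.

Lemma stftD phi psi z : (forall j, qsqintegrable (phi j)) -> (forall j, qsqintegrable (psi j)) ->
  full_poly_qstft I (fun j t => phi j t + psi j t) z =
  full_poly_qstft I phi z + full_poly_qstft I psi z.
Proof.
case: z => x w sp sq.
have W t : windowed (fun j t => phi j t + psi j t) x t = windowed phi x t + windowed psi x t.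
  by rewrite /windowed -big_split; apply: eq_bigr => j _; exact: scalerDr.
rewrite !full_poly_qstft_windowed//; last by move=> j; exact: qsqintegrableD.
have [a1 a2] := qintegrable_cos_sin x w sp; have [b1 b2] := qintegrable_cos_sin x w sq.
have -> : qcosT (windowed (fun j t => phi j t + psi j t) x) w =
    qcosT (windowed phi x) w + qcosT (windowed psi x) w.
  by rewrite -qintegralD//; apply: eq_qintegral => t; rewrite W scalerDr.
have -> : qsinT (windowed (fun j t => phi j t + psi j t) x) w =
    qsinT (windowed phi x) w + qsinT (windowed psi x) w.
  by rewrite -qintegralD//; apply: eq_qintegral => t; rewrite W scalerDr.
by rewrite mulrDr opprD addrACA.
Qed.

(** The unit I and the kernel act from the left, so right multiplication by a
    constant passes through the transform. *)
Lemma stftMr phi (c : H) z : (forall j, qsqintegrable (phi j)) ->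
  full_poly_qstft I (fun j t => phi j t * c) z = full_poly_qstft I phi z * c.
Proof.
case: z => x w sp.
have W t : windowed (fun j t => phi j t * c) x t = windowed phi x t * c.
  by rewrite /windowed mulr_suml; apply: eq_bigr => j _; rewrite scalerAl.
rewrite !full_poly_qstft_windowed//; last by move=> j; exact: qsqintegrableMr.
have [a1 a2] := qintegrable_cos_sin x w sp.
have -> : qcosT (windowed (fun j t => phi j t * c) x) w = qcosT (windowed phi x) w * c.
  by rewrite -(qintegralMr c a1).2; apply: eq_qintegral => t; rewrite W scalerAl.
have -> : qsinT (windowed (fun j t => phi j t * c) x) w = qsinT (windowed phi x) w * c.
  by rewrite -(qintegralMr c a2).2; apply: eq_qintegral => t; rewrite W scalerAl.
by rewrite mulrBl mulrA.
Qed.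

Lemma stft_inner_real phi psi :
  (forall j, qsqintegrable (phi j)) -> (forall j, qsqintegrable (psi j)) ->
  \int[@leb2 R]_z qre (qconj (full_poly_qstft I psi z) * full_poly_qstft I phi z) =
  2 * \sum_j \int[mu]_t qre (qconj (psi j t) * phi j t).
Proof.
move=> sp sq.
have spq j : qsqintegrable (fun t => phi j t + psi j t) by exact: qsqintegrableD.
have [i1 e1] := stft_energy_real sp; have [i2 e2] := stft_energy_real sq.
have [i3 e3] := stft_energy_real spq.
have D : full_poly_qstft I (fun j t => phi j t + psi j t) =
  (fun z => full_poly_qstft I phi z + full_poly_qstft I psi z).
  by apply/funext => z; exact: stftD.
rewrite D in i3 e3.
rewrite (integral_polarization i1 i2 i3) e1 e2 e3.
under [in RHS]eq_bigr => j _ do rewrite (integral_polarization (integrable_qnormsq (sp j))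
  (integrable_qnormsq (sq j)) (integrable_qnormsq (spq j))).
by rewrite -mulr_sumr !sumrB; ring.
Qed.

(** The imaginary components as real parts of right multiples, which reduces an
    identity of quaternions to identities of real parts. *)
Lemma qre_units (q : H) : [/\ qi q = qre (q * Quat 0 (-1) 0 0),
  qj q = qre (q * Quat 0 0 (-1) 0) & qk q = qre (q * Quat 0 0 0 (-1))].
Proof. by rewrite !qreM /=; split; ring. Qed.

Lemma stft_inner phi psi :
  (forall j, qsqintegrable (phi j)) -> (forall j, qsqintegrable (psi j)) ->
  qinner leb2 (full_poly_qstft I phi) (full_poly_qstft I psi) = 2 *: qvinner phi psi.
Proof.
move=> sp sq.
have comp (c : H) : \int[@leb2 R]_z qre (qconj (full_poly_qstft I psi z) * full_poly_qstft I phi z * c) =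
    2 * \sum_j \int[mu]_t qre (qconj (psi j t) * phi j t * c).
  have spc j : qsqintegrable (fun t => phi j t * c) by exact: qsqintegrableMr.
  under eq_Rintegral do rewrite -mulrA -stftMr//.
  rewrite (stft_inner_real spc sq); congr (_ * _); apply: eq_bigr => j _.
  by apply: eq_Rintegral => t _; rewrite mulrA.
apply: quat_ext.
- by rewrite /= qre_sum; exact: stft_inner_real.
- rewrite /= qi_sum.
  transitivity (\int[@leb2 R]_z qre (qconj (full_poly_qstft I psi z) * full_poly_qstft I phi z * Quat 0 (-1) 0 0)).
    by apply: eq_Rintegral => z _; case: (qre_units (qconj (full_poly_qstft I psi z) * full_poly_qstft I phi z)).
  rewrite comp; congr (_ * _); apply: eq_bigr => j _; apply: eq_Rintegral => t _.
  by case: (qre_units (qconj (psi j t) * phi j t)).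
- rewrite /= qj_sum.
  transitivity (\int[@leb2 R]_z qre (qconj (full_poly_qstft I psi z) * full_poly_qstft I phi z * Quat 0 0 (-1) 0)).
    by apply: eq_Rintegral => z _; case: (qre_units (qconj (full_poly_qstft I psi z) * full_poly_qstft I phi z)).
  rewrite comp; congr (_ * _); apply: eq_bigr => j _; apply: eq_Rintegral => t _.
  by case: (qre_units (qconj (psi j t) * phi j t)).
- rewrite /= qk_sum.
  transitivity (\int[@leb2 R]_z qre (qconj (full_poly_qstft I psi z) * full_poly_qstft I phi z * Quat 0 0 0 (-1))).
    by apply: eq_Rintegral => z _; case: (qre_units (qconj (full_poly_qstft I psi z) * full_poly_qstft I phi z)).
  rewrite comp; congr (_ * _); apply: eq_bigr => j _; apply: eq_Rintegral => t _.
  by case: (qre_units (qconj (psi j t) * phi j t)).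
Qed.

End Inner.

Lemma qL2_stft (I : H) n (phi : 'I_n.+1 -> R -> H) : I * I = -1 ->
  (forall j, qsqintegrable (phi j)) -> qL2 leb2 (full_poly_qstft I phi).
Proof.
move=> hI sp; split; first exact: qmeasurable_stft.
under eq_integral do rewrite qnorm_sq.
have /integrable_fin_num := (stft_energy_real hI sp).1.
by rewrite fin_numElt => /(_ measurableT)/andP[].
Qed.

End Isometry.

Theorem proposition6p8 (R : realType) (I : quat R) (hI : I ^+ 2 = -1)
    (n : nat) (vphi phi : 'I_n.+1 -> R -> quat R)
    (hvphi : forall j : 'I_n.+1, qL2 leb1 (vphi j))
    (hphi : forall j : 'I_n.+1, qL2 leb1 (phi j)) :
  [/\ qL2 leb2 (full_poly_qstft I phi),
      qL2 leb2 (full_poly_qstft I vphi) &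
      qinner leb2 (full_poly_qstft I phi) (full_poly_qstft I vphi)
      = 2 *: qvinner phi vphi].
Proof.
have hJ : I * I = -1 by rewrite -expr2.
have sp j := qL2_qsqintegrable (hphi j); have sv j := qL2_qsqintegrable (hvphi j).
split; [exact: qL2_stft | exact: qL2_stft | exact: stft_inner].
Qed.
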